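(* Let $n\ge1$ be an integer, $\lambda>0$ with $\lambda\neq1$, and let $\mathcal H^+$ be the fluctuation operator of the static rotationally invariant $n$-vortex with radial profiles $f_n,\beta_n$ (see context). The spectrum of the eigenvalue problem $\mathcal H^+\xi=\omega^2\xi$ (in the background gauge) comprises three types of eigenfunctions: 1. Derrick-type modes: these have the form $$\xi=\big(\widetilde v(r)\sin\theta,\ -\widetilde v(r)\cos\theta,\ \widetilde u(r)\cos(n\theta),\ \widetilde u(r)\sin(n\theta)\big)^{\intercal},$$ where the two radial functions $(\widetilde v,\widetilde u)$ are determined by the reduced spectral problem $\overline{\mathcal H}_0(\widetilde v,\widetilde u)^{\intercal}=\omega^2(\widetilde v,\widetilde u)^{\intercal}$ of the one-dimensional $2\times2$ matrix differential operator $$\overline{\mathcal H}_0=\begin{pmatrix}-\frac{d^2}{dr^2}-\frac1r\frac{d}{dr}+\frac1{r^2}+f_n^2&\frac{2n}{r}(1-\beta_n)f_n\\[2pt]\frac{2n}{r}(1-\beta_n)f_n&-\frac{d^2}{dr^2}-\frac1r\frac{d}{dr}+\frac{n^2(1-\beta_n)^2}{r^2}+\frac{3\lambda}{2}f_n^2-\frac\lambda2\end{pmatrix}.$$ The number of these modes is restricted only by the strength of the potential well arising in this spectral problem. 2. Multipolar modes: for integers $\overline k\ge1$, these have the form $$\xi=\begin{pmatrix}\cos(\overline k\theta)\sin\theta\,[v'(r)-rf_n(r)w(r)]-\sin(\overline k\theta)\cos\theta\,\frac{\overline k v(r)}{r}\\-\cos(\overline k\theta)\cos\theta\,[v'(r)-rf_n(r)w(r)]-\sin(\overline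 k\theta)\sin\theta\,\frac{\overline kv(r)}{r}\\\cos(\overline k\theta)\cos(n\theta)u(r)+\overline k\sin(\overline k\theta)\sin(n\theta)w(r)\\\cos(\overline k\theta)\sin(n\theta)u(r)-\overline k\sin(\overline k\theta)\cos(n\theta)w(r)\end{pmatrix},$$ where the three radial functions $(v,u,w)$ are eigenfunctions, $\overline{\mathcal H}_{\overline k}(v,u,w)^{\intercal}=\omega^2(v,u,w)^{\intercal}$, of the one-dimensional $3\times3$ matrix differential operator $$\overline{\mathcal H}_{\overline k}=\begin{pmatrix}L+f_n^2&0&2(f_n+rf_n')\\[2pt]\frac{2n(1-\beta_n)f_n}{r}\frac{d}{dr}&L+\frac{n^2(1-\beta_n)^2}{r^2}+\frac{3\lambda}{2}f_n^2-\frac\lambda2&-\frac{2n(1-\beta_n)(\overline k^2+r^2f_n^2)}{r^2}\\[2pt]\frac{2f_n'}{r}&-\frac{2n(1-\beta_n)}{r^2}&L+\frac{n^2(1-\beta_n)^2}{r^2}+f_n^2+\frac\lambda2f_n^2-\frac\lambda2\end{pmatrix},\qquad L=-\frac{d^2}{dr^2}-\frac1r\frac{d}{dr}+\frac{\overline k^2}{r^2}.$$ There are two classes of multipolar modes: (a) Type A: eigenfunctions $\xi^{\mathrm A}$ with radial characteristic $\mathrm{ch}_r[\xi^{\mathrm A}]=\binom{\overline k-1}{n-\overline k}$; as a consequence, the eigenfunctions of this type are restricted to $\overline k\in\{1,\dots,n\}$. (b) Type B: eigenfunctions $\xi^{\mathrm B}$ with radial characteristic $\mathrm{ch}_r[\xi^{\mathrm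 B}]=\binom{\overline k-1}{n+\overline k}$; here the number of discrete modes is fixed only by the strength of the potential well of the corresponding eigenvalue problem (regularity at the origin imposes no restriction on $\overline k\ge1$).
   Context: Polar coordinates $x_1=r\cos\theta$, $x_2=r\sin\theta$ on $\mathbb R^2$. The static rotationally invariant $n$-vortex of the Abelian-Higgs model with coupling $\lambda>0$ (self-dual when $\lambda=1$) is the real four-component field $$\Psi=(V_1,V_2,\psi_1,\psi_2)^{\intercal}=\Big(-\tfrac{n\beta_n(r)}{r}\sin\theta,\ \tfrac{n\beta_n(r)}{r}\cos\theta,\ f_n(r)\cos(n\theta),\ f_n(r)\sin(n\theta)\Big)^{\intercal},$$ where the profiles satisfy $$f_n''+\tfrac1r f_n'-\tfrac{n^2}{r^2}(1-\beta_n)^2f_n+\tfrac{\lambda}{2}(1-f_n^2)f_n=0,\qquad \beta_n''-\tfrac1r\beta_n'+f_n^2(1-\beta_n)=0,$$ $f_n(0)=\beta_n(0)=0$, $f_n(\infty)=\beta_n(\infty)=1$, with expansions near $r=0$: $f_n(r)=r^n\sum_{i\ge0}d_{2i}r^{2i}$ ($d_0\neq0$) and $\beta_n(r)=r^2\big(c_0+\sum_{i\ge n}c_{2i}r^{2i}\big)$. Fluctuations are four-component real fields $\xi=(a_1,a_2,\varphi_1,\varphi_2)^{\intercal}$ on $\mathbb R^2$ ($a_1,a_2$: vector components; $\varphi_1,\varphi_2$: scalar components), required to satisfy the background gauge condition $\partial_1a_1+\partial_2a_2-(\psi_1\varphi_2-\psi_2\varphi_1)=0$. Eigenfunctions are required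 to be regular at the origin; those of the discrete spectrum are square integrable: $\int_{\mathbb R^2}(a_1^2+a_2^2+\varphi_1^2+\varphi_2^2)\,d^2x<\infty$. With $\Delta=\partial_1^2+\partial_2^2$, $|\psi|^2=\psi_1^2+\psi_2^2$, summation over $k=1,2$ in $V_kV_k$ and $V_k\partial_k$, and $\widetilde D_i\psi_1=\partial_i\psi_1+V_i\psi_2$, $\widetilde D_i\psi_2=\partial_i\psi_2-V_i\psi_1$, the fluctuation operator is $$\mathcal H^+=\begin{pmatrix}-\Delta+|\psi|^2&0&-2\widetilde D_1\psi_2&2\widetilde D_1\psi_1\\0&-\Delta+|\psi|^2&-2\widetilde D_2\psi_2&2\widetilde D_2\psi_1\\-2\widetilde D_1\psi_2&-2\widetilde D_2\psi_2&-\Delta+\frac{3\lambda}{2}\psi_1^2+(1+\frac\lambda2)\psi_2^2-\frac\lambda2+V_kV_k&-2V_k\partial_k+(\lambda-1)\psi_1\psi_2\\2\widetilde D_1\psi_1&2\widetilde D_2\psi_1&2V_k\partial_k+(\lambda-1)\psi_1\psi_2&-\Delta+(1+\frac\lambda2)\psi_1^2+\frac{3\lambda}{2}\psi_2^2-\frac\lambda2+V_kV_k\end{pmatrix}.$$ Radial characteristic: $\mathrm{ch}_r[F]=\binom{\ell_1}{\ell_2}$ means that near $r=0$ the vector components of $F$ behave as $r^{\ell_1}$ and the scalar components as $r^{\ell_2}$. For $\overline k\ge1$ each multipolar mode is accompanied by an orthogonal partner with the same eigenvalue, obtained by replacing $\cos(\overline k\theta)\to\sin(\overline k\theta)$, $\sin(\overline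 k\theta)\to-\cos(\overline k\theta)$; modes are listed up to this degeneracy.
   Formalization: Eigenfunctions without mirror symmetry may also have a k=0 odd part (radial vector part, scalar part along the phase direction). Types A/B are asserted for modes with vector part exactly of order r^(k-1); for k>n the characteristic (k-1, k-n) is a third possibility. *)

(* Defs.v *)
From Stdlib Require Import Reals Lra ZArith.
From Coquelicot Require Import Coquelicot.

Open Scope R_scope.

(** ** Four-component real fields on the plane *)

(* [A1], [A2]: vector components; [P1], [P2]: scalar components. *)
Inductive comp : Set := A1 | A2 | P1 | P2.

Definition field := comp -> R -> R -> R.

Definition mkfield (a1 a2 p1 p2 : R -> R -> R) : field :=
  fun c => match c with A1 => a1 | A2 => a2 | P1 => p1 | P2 => p2 end.

Definition d1 (g : R -> R -> R) (x1 x2 : R) : R := Derive (fun t => g t x2) x1.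
Definition d2 (g : R -> R -> R) (x1 x2 : R) : R := Derive (fun t => g x1 t) x2.
Definition laplacian (g : R -> R -> R) (x1 x2 : R) : R :=
  d1 (d1 g) x1 x2 + d2 (d2 g) x1 x2.

(** ** Polar coordinates *)

Definition rad (x1 x2 : R) : R := sqrt (x1 ^ 2 + x2 ^ 2).

(* Polar angle in [(-PI, PI]]; junk at the origin.  Its jump across the negative
   [x1]-axis is invisible below, where it enters only through [cos (m t)] and
   [sin (m t)] with [m] an integer. *)
Definition ang (x1 x2 : R) : R :=
  if Rle_dec 0 x2 then acos (x1 / rad x1 x2) else - acos (x1 / rad x1 x2).

Definition of_polar (g : R -> R -> R) (x1 x2 : R) : R := g (rad x1 x2) (ang x1 x2).

Definition polar_field (a1 a2 p1 p2 : R -> R -> R) : field :=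
  mkfield (of_polar a1) (of_polar a2) (of_polar p1) (of_polar p2).

Lemma of_polar_coordinates (x1 x2 : R) :
  (x1, x2) <> (0, 0) ->
  0 < rad x1 x2 /\ x1 = rad x1 x2 * cos (ang x1 x2) /\ x2 = rad x1 x2 * sin (ang x1 x2).
Proof.
intros Hx.
assert (Hs : 0 < x1 ^ 2 + x2 ^ 2).
{ destruct (Req_dec x1 0) as [-> | H1]; [destruct (Req_dec x2 0) as [-> | H2]|].
  - now destruct Hx.
  - assert (H := pow2_gt_0 _ H2); lra.
  - assert (H := pow2_gt_0 _ H1); assert (H' := pow2_ge_0 x2); lra. }
assert (Hr : 0 < rad x1 x2) by now apply sqrt_lt_R0.
assert (Hrr : rad x1 x2 * rad x1 x2 = x1 ^ 2 + x2 ^ 2)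
  by (apply sqrt_sqrt; lra).
set (r := rad x1 x2) in *.
assert (Hq : (x1 / r) * (x1 / r) + (x2 / r) * (x2 / r) = 1)
  by (field_simplify_eq; nra).
assert (Hb : -1 <= x1 / r <= 1) by (split; nra).
assert (Hsin : sqrt (1 - (x1 / r)²) = Rabs (x2 / r)).
{ rewrite <- sqrt_Rsqr_abs; f_equal; unfold Rsqr; lra. }
split; [exact Hr|].
unfold ang; fold r; destruct (Rle_dec 0 x2) as [H2 | H2].
- rewrite cos_acos, sin_acos, Hsin, Rabs_pos_eq; trivial.
  + split; field; lra.
  + apply Rdiv_le_0_compat; lra.
- rewrite cos_neg, sin_neg, cos_acos, sin_acos, Hsin, Rabs_left; trivial.
  + split; field; lra.
  + apply Rdiv_neg_pos; lra.
Qed.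

(** ** Vortex profiles and the vortex *)

Definition twice_derivable (g : R -> R) : Prop :=
  forall r, 0 < r -> ex_derive g r /\ ex_derive (Derive g) r.

(* [d i] and [c i] are the coefficients written d_{2i} and c_{2i} in the expansions. *)
Definition vortex_profiles (n : nat) (lambda : R) (f beta : R -> R) : Prop :=
  twice_derivable f /\ twice_derivable beta /\
  (forall r, 0 < r ->
     Derive_n f 2 r + Derive f r / r
       - INR n ^ 2 / r ^ 2 * (1 - beta r) ^ 2 * f r
       + lambda / 2 * (1 - f r ^ 2) * f r = 0) /\
  (forall r, 0 < r ->
     Derive_n beta 2 r - Derive beta r / r + f r ^ 2 * (1 - beta r) = 0) /\
  f 0 = 0 /\ beta 0 = 0 /\ is_lim f p_infty 1 /\ is_lim beta p_infty 1 /\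
  (exists (d : nat -> R) (rho : R), 0 < rho /\ d 0%nat <> 0 /\
     forall r, 0 <= r < rho -> is_series (fun i => d i * r ^ (n + 2 * i)) (f r)) /\
  (exists (c : nat -> R) (rho : R), 0 < rho /\
     (forall i, (1 <= i < n)%nat -> c i = 0) /\
     forall r, 0 <= r < rho -> is_series (fun i => c i * r ^ (2 + 2 * i)) (beta r)).

Definition vortex (n : nat) (f beta : R -> R) : field :=
  polar_field
    (fun r t => - (INR n * beta r / r) * sin t)
    (fun r t => INR n * beta r / r * cos t)
    (fun r t => f r * cos (INR n * t))
    (fun r t => f r * sin (INR n * t)).

(** ** The fluctuation operator and the background gauge *)

Section Fluctuations.

(* [Psi] is the background field; its vector components are the potential V. *)
Variables (lambda : R) (Psi : field).

Let V1 := Psi A1.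
Let V2 := Psi A2.
Let psi1 := Psi P1.
Let psi2 := Psi P2.

(* [Dij] is the covariant derivative D_i psi_j. *)
Definition D11 x1 x2 := d1 psi1 x1 x2 + V1 x1 x2 * psi2 x1 x2.
Definition D12 x1 x2 := d1 psi2 x1 x2 - V1 x1 x2 * psi1 x1 x2.
Definition D21 x1 x2 := d2 psi1 x1 x2 + V2 x1 x2 * psi2 x1 x2.
Definition D22 x1 x2 := d2 psi2 x1 x2 - V2 x1 x2 * psi1 x1 x2.

Definition VV x1 x2 := V1 x1 x2 ^ 2 + V2 x1 x2 ^ 2.
Definition Vgrad (g : R -> R -> R) x1 x2 :=
  V1 x1 x2 * d1 g x1 x2 + V2 x1 x2 * d2 g x1 x2.

Definition Hplus (xi : field) : field :=
  mkfield
    (fun x1 x2 =>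
       - laplacian (xi A1) x1 x2 + (psi1 x1 x2 ^ 2 + psi2 x1 x2 ^ 2) * xi A1 x1 x2
       - 2 * D12 x1 x2 * xi P1 x1 x2 + 2 * D11 x1 x2 * xi P2 x1 x2)
    (fun x1 x2 =>
       - laplacian (xi A2) x1 x2 + (psi1 x1 x2 ^ 2 + psi2 x1 x2 ^ 2) * xi A2 x1 x2
       - 2 * D22 x1 x2 * xi P1 x1 x2 + 2 * D21 x1 x2 * xi P2 x1 x2)
    (fun x1 x2 =>
       - 2 * D12 x1 x2 * xi A1 x1 x2 - 2 * D22 x1 x2 * xi A2 x1 x2
       - laplacian (xi P1) x1 x2
       + (3 * lambda / 2 * psi1 x1 x2 ^ 2 + (1 + lambda / 2) * psi2 x1 x2 ^ 2
          - lambda / 2 + VV x1 x2) * xi P1 x1 x2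
       - 2 * Vgrad (xi P2) x1 x2
       + (lambda - 1) * psi1 x1 x2 * psi2 x1 x2 * xi P2 x1 x2)
    (fun x1 x2 =>
       2 * D11 x1 x2 * xi A1 x1 x2 + 2 * D21 x1 x2 * xi A2 x1 x2
       + 2 * Vgrad (xi P1) x1 x2
       + (lambda - 1) * psi1 x1 x2 * psi2 x1 x2 * xi P1 x1 x2
       - laplacian (xi P2) x1 x2
       + ((1 + lambda / 2) * psi1 x1 x2 ^ 2 + 3 * lambda / 2 * psi2 x1 x2 ^ 2
          - lambda / 2 + VV x1 x2) * xi P2 x1 x2).

Definition background_gauge (xi : field) : Prop :=
  forall x1 x2, (x1, x2) <> (0, 0) ->
    d1 (xi A1) x1 x2 + d2 (xi A2) x1 x2
      - (psi1 x1 x2 * xi P2 x1 x2 - psi2 x1 x2 * xi P1 x1 x2) = 0.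

End Fluctuations.

(** ** Eigenfunctions *)

Definition C2_off_origin (xi : field) : Prop :=
  forall c x1 x2, (x1, x2) <> (0, 0) -> ex_diff_n (xi c) 2 x1 x2.

(* The value at the origin itself is immaterial: every component has a finite limit there. *)
Definition regular_at_origin (xi : field) : Prop :=
  forall c, exists l : R,
    filterlim (fun p : R * R => xi c (fst p) (snd p)) (locally' (0, 0)) (locally l).

Definition nonzero_field (xi : field) : Prop :=
  exists c x1 x2, (x1, x2) <> (0, 0) /\ xi c x1 x2 <> 0.

(* The integral of |xi|^2 over the plane in polar coordinates, d^2x = r dt dr. *)
Definition square_integrable (xi : field) : Prop :=
  ex_RInt_gen
    (fun r => RInt (fun t =>
         let x1 := r * cos t in let x2 := r * sin t in
         xi A1 x1 x2 ^ 2 + xi A2 x1 x2 ^ 2 + xi P1 x1 x2 ^ 2 + xi P2 x1 x2 ^ 2)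
       0 (2 * PI) * r)
    (at_right 0) (Rbar_locally p_infty).

(* The eigenvalue omega^2 is an arbitrary real number [w2], possibly negative. *)
Definition in_eigenspace (n : nat) (lambda : R) (f beta : R -> R) (w2 : R) (xi : field)
  : Prop :=
  C2_off_origin xi /\ regular_at_origin xi /\ background_gauge (vortex n f beta) xi /\
  forall c x1 x2, (x1, x2) <> (0, 0) ->
    Hplus lambda (vortex n f beta) xi c x1 x2 = w2 * xi c x1 x2.

Definition eigenfunction (n : nat) (lambda : R) (f beta : R -> R) (w2 : R) (xi : field)
  : Prop :=
  in_eigenspace n lambda f beta w2 xi /\ nonzero_field xi.

(** ** Derrick-type modes *)

Definition derrick (n : nat) (vt ut : R -> R) : field :=
  polar_field
    (fun r t => vt r * sin t)
    (fun r t => - vt r * cos t)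
    (fun r t => ut r * cos (INR n * t))
    (fun r t => ut r * sin (INR n * t)).

Definition Hbar0 (n : nat) (lambda : R) (f beta : R -> R) (vt ut : R -> R) (r : R) : R * R :=
  ( - Derive_n vt 2 r - Derive vt r / r + (1 / r ^ 2 + f r ^ 2) * vt r
      + 2 * INR n / r * (1 - beta r) * f r * ut r,
    2 * INR n / r * (1 - beta r) * f r * vt r
      - Derive_n ut 2 r - Derive ut r / r
      + (INR n ^ 2 * (1 - beta r) ^ 2 / r ^ 2
         + 3 * lambda / 2 * f r ^ 2 - lambda / 2) * ut r ).

Definition radial_eigenfunction0 (n : nat) (lambda : R) (f beta : R -> R) (w2 : R)
    (vt ut : R -> R) : Prop :=
  twice_derivable vt /\ twice_derivable ut /\
  (forall r, 0 < r -> Hbar0 n lambda f beta vt ut r = (w2 * vt r, w2 * ut r)) /\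
  (exists r, 0 < r /\ (vt r <> 0 \/ ut r <> 0)).

Definition radial_regular0 (vt ut : R -> R) : Prop :=
  filterlim vt (at_right 0) (locally 0) /\ filterlim ut (at_right 0) (locally 0).

Definition radial_square_integrable0 (vt ut : R -> R) : Prop :=
  ex_RInt_gen (fun r => (vt r ^ 2 + ut r ^ 2) * r) (at_right 0) (Rbar_locally p_infty).

(** ** Multipolar modes *)

Definition multipolar_gen (n : nat) (f : R -> R) (k : nat) (C S : R -> R)
    (v u w : R -> R) : field :=
  let e r := Derive v r - r * f r * w r in
  polar_field
    (fun r t => C t * sin t * e r - S t * cos t * (INR k * v r / r))
    (fun r t => - (C t * cos t * e r) - S t * sin t * (INR k * v r / r))
    (fun r t => C t * cos (INR n * t) * u r + INR k * S t * sin (INR n * t) * w r)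
    (fun r t => C t * sin (INR n * t) * u r - INR k * S t * cos (INR n * t) * w r).

Definition multipolar (n : nat) (f : R -> R) (k : nat) : (R -> R) -> (R -> R) -> (R -> R) -> field :=
  multipolar_gen n f k (fun t => cos (INR k * t)) (fun t => sin (INR k * t)).

Definition multipolar_partner (n : nat) (f : R -> R) (k : nat)
  : (R -> R) -> (R -> R) -> (R -> R) -> field :=
  multipolar_gen n f k (fun t => sin (INR k * t)) (fun t => - cos (INR k * t)).

Definition Lop (k : nat) (g : R -> R) (r : R) : R :=
  - Derive_n g 2 r - Derive g r / r + INR k ^ 2 / r ^ 2 * g r.

Definition Hbar (n : nat) (lambda : R) (f beta : R -> R) (k : nat)
    (v u w : R -> R) (r : R) : R * R * R :=
  ( Lop k v r + f r ^ 2 * v r + 2 * (f r + r * Derive f r) * w r,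
    2 * INR n * (1 - beta r) * f r / r * Derive v r
      + Lop k u r + (INR n ^ 2 * (1 - beta r) ^ 2 / r ^ 2
                     + 3 * lambda / 2 * f r ^ 2 - lambda / 2) * u r
      - 2 * INR n * (1 - beta r) * (INR k ^ 2 + r ^ 2 * f r ^ 2) / r ^ 2 * w r,
    2 * Derive f r / r * v r
      - 2 * INR n * (1 - beta r) / r ^ 2 * u r
      + Lop k w r + (INR n ^ 2 * (1 - beta r) ^ 2 / r ^ 2
                     + f r ^ 2 + lambda / 2 * f r ^ 2 - lambda / 2) * w r ).

Definition radial_eigenfunction (n : nat) (lambda : R) (f beta : R -> R) (k : nat) (w2 : R)
    (v u w : R -> R) : Prop :=
  twice_derivable v /\ twice_derivable u /\ twice_derivable w /\
  (forall r, 0 < r ->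
     Hbar n lambda f beta k v u w r = (w2 * v r, w2 * u r, w2 * w r)) /\
  (exists r, 0 < r /\ (v r <> 0 \/ u r <> 0 \/ w r <> 0)).

(* The radial density is the angular integral of |xi|^2 divided by PI. *)
Definition radial_square_integrable (f : R -> R) (k : nat) (v u w : R -> R) : Prop :=
  ex_RInt_gen
    (fun r => ((Derive v r - r * f r * w r) ^ 2 + (INR k * v r / r) ^ 2
               + u r ^ 2 + (INR k * w r) ^ 2) * r)
    (at_right 0) (Rbar_locally p_infty).

(** ** Radial characteristic *)

(* The pair of components [(ca, cb)] behaves as [r ^ l] near the origin: along each ray
   it is [r ^ l] times a finite limit, and this angular profile is not identically
   zero.  A single Cartesian component may have a vanishing angular profile, so the
   condition is on the pair. *)
Definition behaves_as (xi : field) (ca cb : comp) (l : Z) : Prop :=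
  exists A B : R -> R,
    (forall t, filterlim (fun r => xi ca (r * cos t) (r * sin t) / powerRZ r l)
                 (at_right 0) (locally (A t))) /\
    (forall t, filterlim (fun r => xi cb (r * cos t) (r * sin t) / powerRZ r l)
                 (at_right 0) (locally (B t))) /\
    (exists t, A t <> 0 \/ B t <> 0).

Definition vector_behaves_as (xi : field) (l : Z) : Prop := behaves_as xi A1 A2 l.
Definition scalar_behaves_as (xi : field) (l : Z) : Prop := behaves_as xi P1 P2 l.

Definition radial_char (xi : field) (l1 l2 : Z) : Prop :=
  vector_behaves_as xi l1 /\ scalar_behaves_as xi l2.

Definition type_A (n k : nat) (xi : field) : Prop :=
  radial_char xi (Z.of_nat k - 1) (Z.of_nat n - Z.of_nat k).

Definition type_B (n k : nat) (xi : field) : Prop :=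
  radial_char xi (Z.of_nat k - 1) (Z.of_nat n + Z.of_nat k).

(** ** Angular decomposition *)

(* Symmetry of the vortex under the reflection [x2 -> - x2]; Derrick-type and
   multipolar modes share it, the multipolar partners are odd under it. *)
Definition mirror_symmetric (xi : field) : Prop :=
  forall x1 x2, (x1, x2) <> (0, 0) ->
    xi A1 x1 (- x2) = - xi A1 x1 x2 /\ xi A2 x1 (- x2) = xi A2 x1 x2 /\
    xi P1 x1 (- x2) = xi P1 x1 x2 /\ xi P2 x1 (- x2) = - xi P2 x1 x2.

(* The mirror-odd fields without angular modulation: radial vector part, and scalar
   part along the phase direction of the vortex.  This is the form to which the
   multipolar partner degenerates at k = 0 when [k v / r] and [k w] are held at
   [g] and [h]. *)
Definition odd_monopole (n : nat) (g h : R -> R) : field :=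
  polar_field
    (fun r t => g r * cos t)
    (fun r t => g r * sin t)
    (fun r t => - h r * sin (INR n * t))
    (fun r t => h r * cos (INR n * t)).

(* Main.v *)
(** In polar components (radial and azimuthal part of the vector, scalar part along and
    across the phase [n t] of the vortex) the operator and the gauge condition have
    coefficients depending on [r] only.  A mode with angular factors
    [C = a cos kt + b sin kt] and [S = a sin kt - b cos kt] therefore satisfies the
    eigenvalue equation iff its four radial profiles [e, g, u, h] solve an ordinary
    differential system; Derrick-type modes, multipolar modes, their partners and the odd
    monopole are the cases [k = 0] or [k >= 1] with [(a, b) = (1, 0)] or [(0, 1)].  With
    [g = k v / r] and [h = k w] the gauge condition says [e = v' - r f w].

    At the origin, [u + h] and [u - h] solve perturbed Euler equations with exponents
    [|n - k|] and [n + k]; a bootstrap on the order of vanishing shows that either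
    [u + h] has a nonzero leading term of order [|n - k|], or both are of order [n + k]
    with a leading coefficient driven by the vector part.

    Completeness is Fourier analysis: the Fourier coefficients in [t] of the polar
    components of an eigenfunction solve the radial system, inherit regularity and (by
    Bessel's inequality) square integrability, and the Fourier series of a smooth periodic
    function converges pointwise. *)

Require Import Defs.
From Stdlib Require Import Reals Lra Lia ZArith FunctionalExtensionality.
From Coquelicot Require Import Coquelicot.
Import Defs.

Open Scope R_scope.

(** The profiles of a mode are not known to have expansions at the origin, so estimates [O(r ^ j)]
    take the place of Frobenius series. The operator [r y'' + y' - m ^ 2 y / r] factors into two
    first-order ones, each inverted with the mean value theorem. Every pass through the equations
    gains one order, until an exponent is met and a homogeneous solution can enter; boundedness
    discards the singular one, [r ^ -m] or [ln r].

    The leading coefficient at order [n + k] is nonzero because [(n + k) ^ 2 - (n - k) ^ 2 = 4 n k]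
    does not vanish: the source made by the vector part is not resonant for [u + h]. That source
    needs one common leading coefficient for [e] and [g], which is available when the scalar part is
    small. For [k > n] the order [k - n] is compatible with regularity, whence the third alternative
    beside types A and B.

    Three radial functions describe four profiles because the gauge condition fixes [e]; the
    equation of [e] then follows by differentiating that of [v] and using the profile equation of
    [f]. *)

(** * Differentiability classes *)

(* [CD D n F]: [F] is of class C^n on the open set [D]. *)
Fixpoint CD (D : R -> R -> Prop) (n : nat) (F : R -> R -> R) : Prop :=
  (forall x y, D x y -> continuity_2d_pt F x y) /\
  match n with
  | O => True
  | S m => exists Fx Fy : R -> R -> R,
      (forall x y, D x y ->
         is_derive (fun z => F z y) x (Fx x y) /\ is_derive (fun z => F x z) y (Fy x y)) /\
      CD D m Fx /\ CD D m Fy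
  end.

Lemma ex_derive_cont_pt (y : R -> R) x : ex_derive y x -> continuity_pt y x.
Proof.
intros H; apply continuity_pt_filterlim, (ex_derive_continuous (V := R_NormedModule)), H.
Qed.

Definition open2 (D : R -> R -> Prop) : Prop := forall x y, D x y -> locally_2d D x y.

Lemma CD_cont D n F x y : CD D n F -> D x y -> continuity_2d_pt F x y.
Proof. destruct n; intros [H _]; apply H. Qed.

Lemma CD_pred D n F : CD D (S n) F -> CD D n F.
Proof.
revert F; induction n as [|n IH]; intros F [Hc [Fx [Fy [Hd [Hx Hy]]]]].
- split; [exact Hc | exact I].
- split; [exact Hc|]. exists Fx, Fy; split; [exact Hd|]; split; apply IH; assumption.
Qed.

Lemma CD_le D n m F : (m <= n)%nat -> CD D n F -> CD D m F.
Proof.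
intros H; induction H as [|n H IH]; [trivial|]; intros HF; apply IH, CD_pred, HF.
Qed.

Lemma CD_plus D n F G : CD D n F -> CD D n G -> CD D n (fun x y => F x y + G x y).
Proof.
revert F G; induction n as [|n IH]; intros F G HF HG.
- split; [|exact I]; intros x y H; apply continuity_2d_pt_plus;
    [apply (proj1 HF)|apply (proj1 HG)]; exact H.
- destruct HF as [Fc [Fx [Fy [Fd [FX FY]]]]], HG as [Gc [Gx [Gy [Gd [GX GY]]]]].
  split.
  + intros x y H; apply continuity_2d_pt_plus; auto.
  + exists (fun x y => Fx x y + Gx x y), (fun x y => Fy x y + Gy x y).
    split; [|split; apply IH; assumption].
    intros x y H; destruct (Fd x y H), (Gd x y H); split.
    * apply (is_derive_plus (fun z => F z y) (fun z => G z y)); assumption.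
    * apply (is_derive_plus (fun z => F x z) (fun z => G x z)); assumption.
Qed.

Lemma CD_mult D n F G : CD D n F -> CD D n G -> CD D n (fun x y => F x y * G x y).
Proof.
revert F G; induction n as [|n IH]; intros F G HF HG.
- split; [|exact I]; intros x y H; apply continuity_2d_pt_mult;
    [apply (proj1 HF)|apply (proj1 HG)]; exact H.
- assert (HF' := CD_pred _ _ _ HF); assert (HG' := CD_pred _ _ _ HG).
  destruct HF as [Fc [Fx [Fy [Fd [FX FY]]]]], HG as [Gc [Gx [Gy [Gd [GX GY]]]]].
  split.
  + intros x y H; apply continuity_2d_pt_mult; auto.
  + exists (fun x y => Fx x y * G x y + F x y * Gx x y),
      (fun x y => Fy x y * G x y + F x y * Gy x y).
    split; [|split; apply CD_plus; apply IH; assumption].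
    intros x y H; destruct (Fd x y H), (Gd x y H); split.
    * apply (is_derive_mult (fun z => F z y) (fun z => G z y)); trivial; apply Rmult_comm.
    * apply (is_derive_mult (fun z => F x z) (fun z => G x z)); trivial; apply Rmult_comm.
Qed.

Lemma CD_const D n c : CD D n (fun _ _ => c).
Proof.
revert c; induction n as [|n IH]; intros c.
- split; [|exact I]; intros; apply continuity_2d_pt_const.
- split; [intros; apply continuity_2d_pt_const|].
  exists (fun _ _ => 0), (fun _ _ => 0); split; [|split; apply IH].
  intros; split; apply (is_derive_const (V := R_NormedModule)).
Qed.

Lemma CD_id1 D n : CD D n (fun x _ => x).
Proof.
destruct n as [|n].
- split; [|exact I]; intros; apply continuity_2d_pt_id1.
- split; [intros; apply continuity_2d_pt_id1|].
  exists (fun _ _ => 1), (fun _ _ => 0); split; [|split; apply CD_const].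
  intros; split; [apply (is_derive_id (K := R_AbsRing))
                 |apply (is_derive_const (V := R_NormedModule))].
Qed.

Lemma CD_id2 D n : CD D n (fun _ y => y).
Proof.
destruct n as [|n].
- split; [|exact I]; intros; apply continuity_2d_pt_id2.
- split; [intros; apply continuity_2d_pt_id2|].
  exists (fun _ _ => 0), (fun _ _ => 1); split; [|split; apply CD_const].
  intros; split; [apply (is_derive_const (V := R_NormedModule))
                 |apply (is_derive_id (K := R_AbsRing))].
Qed.

(** Openness of [D] lets the equality pass to derivatives: around each point of [D] the two
    functions agree on a neighbourhood. *)
Lemma CD_ext D n F G : open2 D -> (forall x y, D x y -> F x y = G x y) ->
  CD D n F -> CD D n G.
Proof.
intros HD HE HF.
assert (HL : forall x y, D x y -> locally_2d (fun u v => F u v = G u v) x y).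
{ intros x y H; apply locally_2d_impl with (2 := HD x y H), locally_2d_forall; auto. }
assert (Hc : forall x y, D x y -> continuity_2d_pt G x y).
{ intros x y H; apply continuity_2d_pt_ext_loc with (1 := HL x y H).
  apply (CD_cont D n); trivial. }
destruct n as [|n]; [split; [exact Hc|exact I]|].
split; [exact Hc|].
destruct HF as [Fc [Fx [Fy [Fd [FX FY]]]]].
exists Fx, Fy; split; [|split; assumption].
intros x y H; destruct (Fd x y H); split.
- apply is_derive_ext_loc with (2 := H0); apply locally_2d_1d_const_y with (1 := HL x y H).
- apply is_derive_ext_loc with (2 := H1); apply locally_2d_1d_const_x with (1 := HL x y H).
Qed.

Lemma CD_scal D n c F : CD D n F -> CD D n (fun x y => c * F x y).
Proof. intros H; apply CD_mult; [apply CD_const|exact H]. Qed.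

Lemma CD_opp D n F : CD D n F -> CD D n (fun x y => - F x y).
Proof.
intros H; replace (fun x y => - F x y) with (fun x y => -1 * F x y).
- now apply CD_scal.
- do 2 (apply functional_extensionality; intro); ring.
Qed.

Lemma CD_minus D n F G : CD D n F -> CD D n G -> CD D n (fun x y => F x y - G x y).
Proof. intros; apply CD_plus; [|apply CD_opp]; assumption. Qed.

(** Uniqueness of derivatives replaces the existential witnesses of [CD] by [d1 F] and [d2 F], in
    which the operators of the statement are written. *)
Lemma CD_derives D n F : open2 D -> CD D (S n) F ->
  (forall x y, D x y ->
     is_derive (fun z => F z y) x (d1 F x y) /\ is_derive (fun z => F x z) y (d2 F x y)) /\
  CD D n (d1 F) /\ CD D n (d2 F).
Proof.
intros HD [Fc [Fx [Fy [Fd [FX FY]]]]].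
assert (E : forall x y, D x y -> Fx x y = d1 F x y /\ Fy x y = d2 F x y).
{ intros x y H; destruct (Fd x y H); split; symmetry; apply is_derive_unique; assumption. }
split; [|split].
- intros x y H; destruct (E x y H) as [<- <-]; auto.
- apply CD_ext with (F := Fx); trivial; intros; apply E; trivial.
- apply CD_ext with (F := Fy); trivial; intros; apply E; trivial.
Qed.

Lemma CD_ex_diff_n D n F : open2 D -> CD D n F -> forall x y, D x y -> ex_diff_n F n x y.
Proof.
intros HD; revert F; induction n as [|n IH]; intros F HF x y H.
- split; [apply (proj1 HF); exact H|exact I].
- split; [apply (proj1 HF); exact H|].
  destruct (CD_derives D n F HD HF) as [Hd [H1 H2]].
  destruct (Hd x y H) as [Hx Hy]; split; [exists (d1 F x y); exact Hx|].
  split; [exists (d2 F x y); exact Hy|].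
  split; [apply (IH (d1 F))|apply (IH (d2 F))]; assumption.
Qed.

Lemma ex_diff_n_CD D n F : (forall x y, D x y -> ex_diff_n F n x y) -> CD D n F.
Proof.
revert F; induction n as [|n IH]; intros F HF.
- split; [|exact I]; intros x y H; apply (HF x y H).
- split; [intros x y H; apply (HF x y H)|].
  exists (d1 F), (d2 F); split; [|split].
  + intros x y H; destruct (HF x y H) as [_ [Hx [Hy _]]]; split; apply Derive_correct; assumption.
  + apply IH; intros x y H; apply (HF x y H).
  + apply IH; intros x y H; apply (HF x y H).
Qed.

Lemma continuity_2d_slice1 F x y : continuity_2d_pt F x y -> continuity_pt (fun z => F z y) x.
Proof.
intros H; apply continuity_pt_filterlim; intros P [eps He].
destruct (H eps) as [d Hd]; exists d; intros z Hz; apply He, Hd; [exact Hz|].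
rewrite Rminus_diag, Rabs_R0; apply cond_pos.
Qed.

Lemma continuity_2d_slice2 F x y : continuity_2d_pt F x y -> continuity_pt (fun z => F x z) y.
Proof.
intros H; apply continuity_pt_filterlim; intros P [eps He].
destruct (H eps) as [d Hd]; exists d; intros z Hz; apply He, Hd; [|exact Hz].
rewrite Rminus_diag, Rabs_R0; apply cond_pos.
Qed.

(** The domain of polar coordinates. The angle is unrestricted, so the punctured plane is covered
    infinitely often and no branch cut appears. *)
Definition half (r t : R) : Prop := 0 < r.

Lemma open_half : open2 half.
Proof.
intros r t H; unfold half in *; exists (mkposreal r H); simpl; intros u v Hu _.
apply Rabs_lt_between in Hu; lra.
Qed.

Lemma locally_pos r : 0 < r -> locally r (fun s => 0 < s).
Proof. intros H; apply (open_gt 0 r H). Qed.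

(* [CR n y]: [y] is of class C^n on the open half-line. *)
Definition CR (n : nat) (y : R -> R) : Prop := CD half n (fun r _ => y r).

Lemma CR_cont n y r : CR n y -> 0 < r -> continuity_pt y r.
Proof.
intros H Hr; apply (continuity_2d_slice1 (fun r _ => y r) r 0), (CD_cont half n); trivial.
Qed.

Lemma CR_pred n y : CR (S n) y -> CR n y.
Proof. apply CD_pred. Qed.

Lemma CR_le n m y : (m <= n)%nat -> CR n y -> CR m y.
Proof. apply CD_le. Qed.

Lemma CR_plus n y z : CR n y -> CR n z -> CR n (fun r => y r + z r).
Proof. apply (CD_plus half n (fun r _ => y r) (fun r _ => z r)). Qed.

Lemma CR_mult n y z : CR n y -> CR n z -> CR n (fun r => y r * z r).
Proof. apply (CD_mult half n (fun r _ => y r) (fun r _ => z r)). Qed.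

Lemma CR_const n c : CR n (fun _ => c).
Proof. exact (CD_const half n c). Qed.

Lemma CR_id n : CR n (fun r => r).
Proof. exact (CD_id1 half n). Qed.

Lemma CR_ext n y z : (forall r, 0 < r -> y r = z r) -> CR n y -> CR n z.
Proof. intros E; apply CD_ext; [exact open_half|intros r t; apply E]. Qed.

Lemma CR_scal n c y : CR n y -> CR n (fun r => c * y r).
Proof. intros H; apply CR_mult; [apply CR_const|exact H]. Qed.

Lemma CR_opp n y : CR n y -> CR n (fun r => - y r).
Proof. apply (CD_opp half n (fun r _ => y r)). Qed.

Lemma CR_minus n y z : CR n y -> CR n z -> CR n (fun r => y r - z r).
Proof. intros; apply CR_plus; [|apply CR_opp]; assumption. Qed.

Lemma CR_pow n m y : CR n y -> CR n (fun r => y r ^ m).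
Proof.
intros H; induction m as [|m IH]; [exact (CR_const n 1)|exact (CR_mult n _ _ H IH)].
Qed.

Lemma CR_derives n y : CR (S n) y ->
  (forall r, 0 < r -> is_derive y r (Derive y r)) /\ CR n (Derive y).
Proof.
intros H; destruct (CD_derives half n _ open_half H) as [Hd [H1 _]].
split; [intros r Hr; apply (Hd r 0 Hr)|exact H1].
Qed.

Lemma CR_ex_derive n y r : CR (S n) y -> 0 < r -> ex_derive y r.
Proof. intros H Hr; eexists; apply (proj1 (CR_derives n y H)), Hr. Qed.

Lemma CR_0 y : (forall r, 0 < r -> continuity_pt y r) -> CR 0 y.
Proof.
intros H; split; [|exact I]; intros r t Hr.
apply (continuity_1d_2d_pt_comp y (fun u _ => u)); [apply H, Hr|apply continuity_2d_pt_id1].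
Qed.

Lemma CR_derive n y y' : (forall r, 0 < r -> is_derive y r (y' r)) -> CR n y' -> CR (S n) y.
Proof.
intros H H'; split.
- apply CR_0; intros r Hr; apply ex_derive_cont_pt; eexists; apply H, Hr.
- exists (fun r _ => y' r), (fun _ _ => 0); split; [|split; [exact H'|apply CD_const]].
  intros r t Hr; split; [apply H, Hr|apply (is_derive_const (V := R_NormedModule))].
Qed.

Lemma CR_S n y : (forall r, 0 < r -> ex_derive y r) -> CR n (Derive y) -> CR (S n) y.
Proof. intros H; apply CR_derive; intros r Hr; apply Derive_correct, H, Hr. Qed.

Lemma CR_inv n : CR n Rinv.
Proof.
induction n as [|n IH].
- apply CR_0; intros r H; apply continuity_pt_inv; [apply continuity_pt_id|lra].
- apply CR_derive with (fun r => - (/ r * / r)); [|apply CR_opp, CR_mult; exact IH].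
  intros r H; auto_derive; [lra|]; field; lra.
Qed.

Lemma CR_div n y : CR n y -> CR n (fun r => y r / r).
Proof. intros; apply CR_mult; [assumption|apply CR_inv]. Qed.

Lemma CR_twice_derivable y : CR 2 y -> twice_derivable y.
Proof.
intros H r Hr; split; [apply (CR_ex_derive 1); trivial|].
apply (CR_ex_derive 0); trivial; apply CR_derives, H.
Qed.

(** Only class C^1, since the second derivative is not assumed continuous. The differential
    equations supply that continuity later. *)
Lemma twice_derivable_CR y : twice_derivable y -> CR 1 y.
Proof.
intros H; apply CR_S; [intros r Hr; apply (H r Hr)|].
apply CR_0; intros r Hr; apply ex_derive_cont_pt, (H r Hr).
Qed.

Lemma CR_of_CD n X t : CD half n X -> CR n (fun r => X r t).
Proof.
revert X; induction n as [|n IH]; intros X HX.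
- apply CR_0; intros r Hr; apply (continuity_2d_slice1 X), (CD_cont half 0); trivial.
- destruct (CD_derives half n X open_half HX) as [Hd [H1 _]].
  apply CR_derive with (fun r => d1 X r t); [intros r Hr; apply (Hd r t Hr)|apply IH, H1].
Qed.

(** * The punctured plane and polar coordinates *)

Definition off (x y : R) : Prop := (x, y) <> (0, 0).
Lemma off_rad x y : off x y -> 0 < rad x y.
Proof. intros H; apply of_polar_coordinates; exact H. Qed.

Lemma off_sq x y : off x y <-> 0 < x ^ 2 + y ^ 2.
Proof.
split.
- intros H; apply off_rad in H; unfold rad in H.
  destruct (Rle_or_lt (x ^ 2 + y ^ 2) 0) as [H'|H']; trivial.
  rewrite sqrt_neg_0 in H; lra.
- intros H E; injection E; intros -> ->; lra.
Qed.

Lemma open_off : open2 off.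
Proof.
intros x y H.
assert (Hc : continuity_2d_pt (fun u v => u ^ 2 + v ^ 2) x y).
{ apply continuity_2d_pt_plus;
  [apply (continuity_1d_2d_pt_comp (fun z => z ^ 2) (fun u v => u))
  |apply (continuity_1d_2d_pt_comp (fun z => z ^ 2) (fun u v => v))];
  try apply continuity_2d_pt_id1; try apply continuity_2d_pt_id2; reg. }
apply off_sq in H.
assert (Hl := continuity_2d_pt_neq_0 _ _ _ Hc (Rgt_not_eq _ _ H)).
apply locally_2d_impl with (2 := Hl), locally_2d_forall.
intros u v Huv; apply off_sq; assert (H1 := pow2_ge_0 u); assert (H2 := pow2_ge_0 v); lra.
Qed.

Lemma pow_sin_cos t : cos t ^ 2 + sin t ^ 2 = 1.
Proof. assert (H := sin2_cos2 t); unfold Rsqr in H; lra. Qed.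

Lemma cos_sq t : cos t ^ 2 = 1 - sin t ^ 2.
Proof. rewrite <- (pow_sin_cos t); ring. Qed.

Lemma off_polar r t : 0 < r -> off (r * cos t) (r * sin t).
Proof.
intros H; apply off_sq.
replace ((r * cos t) ^ 2 + (r * sin t) ^ 2) with (r ^ 2 * (cos t ^ 2 + sin t ^ 2)) by ring.
rewrite pow_sin_cos; nra.
Qed.

Lemma rad_polar r t : 0 <= r -> rad (r * cos t) (r * sin t) = r.
Proof.
intros H; unfold rad.
replace ((r * cos t) ^ 2 + (r * sin t) ^ 2) with (r ^ 2 * (cos t ^ 2 + sin t ^ 2)) by ring.
rewrite pow_sin_cos, Rmult_1_r, <- Rsqr_pow2; apply sqrt_Rsqr, H.
Qed.

Lemma off_is_polar x y : off x y ->
  exists r t, 0 < r /\ x = r * cos t /\ y = r * sin t.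
Proof.
intros H; exists (rad x y), (ang x y); apply of_polar_coordinates, H.
Qed.

(** [ang] returns a branch of the angle that may differ from [t]. Its cosine and sine are those of
    [t], and the addition formulas carry this to integer multiples. *)
Lemma cos_sin_ang k r t : 0 < r ->
  cos (INR k * ang (r * cos t) (r * sin t)) = cos (INR k * t) /\
  sin (INR k * ang (r * cos t) (r * sin t)) = sin (INR k * t).
Proof.
intros Hr.
destruct (of_polar_coordinates _ _ (off_polar r t Hr)) as [_ [H1 H2]].
rewrite rad_polar in H1, H2 by lra.
apply Rmult_eq_reg_l in H1; [|lra]; apply Rmult_eq_reg_l in H2; [|lra].
set (a := ang _ _) in *; clearbody a.
induction k as [|k [IH1 IH2]].
- simpl; rewrite !Rmult_0_l; auto.
- rewrite S_INR, !Rmult_plus_distr_r, !Rmult_1_l, !cos_plus, !sin_plus, IH1, IH2, H1, H2; auto.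
Qed.

(** The inverse radius comes before the radius because its partial derivatives are polynomials in
    the coordinates and in [/ rad] itself, so that the induction closes. *)
Lemma CD_inv_rad n : CD off n (fun x y => / rad x y).
Proof.
induction n as [|n IH].
- split; [|exact I]; intros x y H.
  apply continuity_2d_pt_inv; [|apply Rgt_not_eq, off_rad, H].
  apply (continuity_1d_2d_pt_comp sqrt).
  + apply continuity_pt_sqrt; apply off_sq in H; lra.
  + apply continuity_2d_pt_plus;
    [apply (continuity_1d_2d_pt_comp (fun z => z ^ 2) (fun u v => u))
    |apply (continuity_1d_2d_pt_comp (fun z => z ^ 2) (fun u v => v))];
    try apply continuity_2d_pt_id1; try apply continuity_2d_pt_id2; reg.
- split; [intros x y H; apply (CD_cont off n); trivial|].
  exists (fun x y => - (x * (/ rad x y * (/ rad x y * / rad x y)))),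
    (fun x y => - (y * (/ rad x y * (/ rad x y * / rad x y)))).
  split; [|split; apply CD_opp, CD_mult; try apply CD_id1; try apply CD_id2;
    repeat apply CD_mult; exact IH].
  intros x y H; assert (H' := proj1 (off_sq x y) H).
  assert (Hr := off_rad _ _ H); unfold rad in *.
  change (x ^ 2 + y ^ 2) with (x * (x * 1) + y * (y * 1)) in *.
  split; (auto_derive; [repeat split; lra|field; lra]).
Qed.

Lemma CD_rad n : CD off n rad.
Proof.
apply CD_ext with (F := fun x y => (x * x + y * y) * / rad x y).
- exact open_off.
- intros x y H; assert (Hr := off_rad _ _ H).
  assert (E : rad x y * rad x y = x * x + y * y).
  { unfold rad; rewrite sqrt_sqrt; [ring|apply off_sq in H; lra]. }
  rewrite <- E; field; lra.
- apply CD_mult; [|apply CD_inv_rad].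
  apply CD_plus; apply CD_mult; try apply CD_id1; apply CD_id2.
Qed.

Lemma CD_radial n y : CR n y -> CD off n (fun x1 x2 => y (rad x1 x2)).
Proof.
revert y; induction n as [|n IH]; intros y Hy;
  assert (Hc : forall u v, off u v -> continuity_2d_pt (fun u v => y (rad u v)) u v)
    by (intros u v H; apply continuity_1d_2d_pt_comp;
        [apply (CR_cont _ _ _ Hy), off_rad, H|apply (CD_cont off 0); trivial; apply CD_rad]).
- split; [exact Hc|exact I].
- split; [exact Hc|].
  destruct (CD_derives off n rad open_off (CD_rad (S n))) as [Hd [H1 H2]].
  destruct (CR_derives n y Hy) as [Dy Hy'].
  exists (fun u v => d1 rad u v * Derive y (rad u v)), (fun u v => d2 rad u v * Derive y (rad u v)).
  split; [|split; apply CD_mult; try apply (IH _ Hy'); trivial].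
  intros u v H; destruct (Hd u v H) as [Hu Hv]; split.
  + apply (is_derive_comp y (fun z => rad z v)); [apply Dy, off_rad, H|exact Hu].
  + apply (is_derive_comp y (fun z => rad u z)); [apply Dy, off_rad, H|exact Hv].
Qed.

(** Although [ang] jumps, its cosine and sine are [x / rad] and [y / rad]; integer multiples follow
    by the addition formulas. *)
Lemma CD_cos_sin_ang n k :
  CD off n (fun x y => cos (INR k * ang x y)) /\ CD off n (fun x y => sin (INR k * ang x y)).
Proof.
induction k as [|k [IH1 IH2]].
- split; [apply CD_ext with (F := fun _ _ => 1)|apply CD_ext with (F := fun _ _ => 0)];
    try exact open_off; try apply CD_const; intros; simpl; rewrite Rmult_0_l;
    [rewrite cos_0|rewrite sin_0]; reflexivity.
- assert (E : forall x y, off x y -> cos (ang x y) = x * / rad x y /\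
  sin (ang x y) = y * / rad x y).
  { intros x y H; destruct (of_polar_coordinates x y H) as [Hr [H1 H2]].
    split; [rewrite H1 at 2|rewrite H2 at 2]; field; lra. }
  assert (Cx : CD off n (fun x y => x * / rad x y)).
  { apply CD_mult; [apply CD_id1|apply CD_inv_rad]. }
  assert (Cy : CD off n (fun x y => y * / rad x y)).
  { apply CD_mult; [apply CD_id2|apply CD_inv_rad]. }
  split.
  + apply CD_ext with (F := fun x y => cos (INR k * ang x y) * (x * / rad x y)
                               - sin (INR k * ang x y) * (y * / rad x y)).
    * exact open_off.
    * intros x y H; destruct (E x y H) as [<- <-].
      rewrite S_INR, Rmult_plus_distr_r, Rmult_1_l, cos_plus; ring.
    * apply CD_minus; apply CD_mult; assumption.
  + apply CD_ext with (F := fun x y => sin (INR k * ang x y) * (x * / rad x y)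
                               + cos (INR k * ang x y) * (y * / rad x y)).
    * exact open_off.
    * intros x y H; destruct (E x y H) as [<- <-].
      rewrite S_INR, Rmult_plus_distr_r, Rmult_1_l, sin_plus; ring.
    * apply CD_plus; apply CD_mult; assumption.
Qed.

Lemma CD_cos_sin D n m :
  CD D n (fun _ t => cos (m * t)) /\ CD D n (fun _ t => sin (m * t)).
Proof.
assert (Cc : forall x y, continuity_2d_pt (fun _ t => cos (m * t)) x y).
{ intros x y; apply (continuity_1d_2d_pt_comp (fun t => cos (m * t)) (fun _ v => v));
  [reg|apply continuity_2d_pt_id2]. }
assert (Cs : forall x y, continuity_2d_pt (fun _ t => sin (m * t)) x y).
{ intros x y; apply (continuity_1d_2d_pt_comp (fun t => sin (m * t)) (fun _ v => v));
  [reg|apply continuity_2d_pt_id2]. }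
induction n as [|n [IH1 IH2]].
- split; (split; [intros; auto|exact I]).
- split; (split; [intros; auto|]).
  + exists (fun _ _ => 0), (fun _ t => - m * sin (m * t)).
    split; [|split; [apply CD_const|apply CD_scal, IH2]].
    intros; split; [apply (is_derive_const (V := R_NormedModule))|].
    auto_derive; trivial; ring.
  + exists (fun _ _ => 0), (fun _ t => m * cos (m * t)).
    split; [|split; [apply CD_const|apply CD_scal, IH1]].
    intros; split; [apply (is_derive_const (V := R_NormedModule))|].
    auto_derive; trivial; ring.
Qed.

Lemma CD_cos D n m : CD D n (fun _ t => cos (m * t)).
Proof. apply CD_cos_sin. Qed.

Lemma CD_sin D n m : CD D n (fun _ t => sin (m * t)).
Proof. apply CD_cos_sin. Qed.

Definition pol (F : R -> R -> R) (r t : R) : R := F (r * cos t) (r * sin t).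

(** Partial derivatives at a point do not give the chain rule; the existence of one of them nearby
    and its continuity do. *)
Lemma derive_along n F (a b : R -> R) (s da db : R) :
  CD off (S n) F -> off (a s) (b s) -> is_derive a s da -> is_derive b s db ->
  is_derive (fun z => F (a z) (b z)) s (d1 F (a s) (b s) * da + d2 F (a s) (b s) * db).
Proof.
intros HF H Ha Hb.
destruct (CD_derives off n F open_off HF) as [Hd [H1 H2]].
apply is_derive_Reals; apply derivable_pt_lim_comp_2d;
  [|apply is_derive_Reals, Ha|apply is_derive_Reals, Hb].
apply filterdiff_differentiable_pt_lim.
refine (is_derive_filterdiff F (a s) (b s) (d1 F) (d2 F (a s) (b s)) _ _ _).
- apply (locally_2d_locally (fun u v => is_derive (fun z => F z v) u (d1 F u v))).
  apply locally_2d_impl with (2 := open_off _ _ H), locally_2d_forall; intros u v Huv;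
    apply Hd, Huv.
- apply Hd, H.
- apply (continuity_2d_pt_filterlim (d1 F)), (CD_cont off n); trivial.
Qed.

Lemma CD_pol n F : CD off n F -> CD half n (pol F).
Proof.
revert F; induction n as [|n IH]; intros F HF.
- split; [|exact I]; intros r t H.
  assert (HC := CD_cont off 0 F _ _ HF (off_polar r t H)).
  assert (K1 : continuity_2d_pt (fun r t => r * cos t) r t).
  { apply continuity_2d_pt_mult; [apply continuity_2d_pt_id1|].
    apply (continuity_1d_2d_pt_comp cos (fun _ v => v)); [reg|apply continuity_2d_pt_id2]. }
  assert (K2 : continuity_2d_pt (fun r t => r * sin t) r t).
  { apply continuity_2d_pt_mult; [apply continuity_2d_pt_id1|].
    apply (continuity_1d_2d_pt_comp sin (fun _ v => v)); [reg|apply continuity_2d_pt_id2]. }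
  intros eps; destruct (HC eps) as [d Hd].
  apply locally_2d_impl with (2 := locally_2d_and _ _ _ _ (K1 d) (K2 d)), locally_2d_forall.
  intros u v [h1 h2]; apply Hd; trivial.
- split.
  + intros r t H; apply (CD_cont half n); [apply IH, CD_pred, HF|exact H].
  + destruct (CD_derives off n F open_off HF) as [Hd [H1 H2]].
    exists (fun r t => pol (d1 F) r t * cos t + pol (d2 F) r t * sin t),
      (fun r t => pol (d1 F) r t * (r * - sin t) + pol (d2 F) r t * (r * cos t)).
    assert (Cc : CD half n (fun _ t => cos t)).
    { apply CD_ext with (F := fun _ t => cos (1 * t)); [exact open_half| |apply CD_cos].
      intros; rewrite Rmult_1_l; reflexivity. }
    assert (Cs : CD half n (fun _ t => sin t)).
    { apply CD_ext with (F := fun _ t => sin (1 * t)); [exact open_half| |apply CD_sin].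
      intros; rewrite Rmult_1_l; reflexivity. }
    split; [|split; apply CD_plus; repeat apply CD_mult; try apply CD_opp; try apply CD_id1;
              try apply IH; assumption].
    intros r t H; split.
    * apply (derive_along n F (fun z => z * cos t) (fun z => z * sin t)); trivial;
        [apply off_polar, H|auto_derive; trivial; ring|auto_derive; trivial; ring].
    * apply (derive_along n F (fun z => r * cos z) (fun z => r * sin z)); trivial;
        [apply off_polar, H|auto_derive; trivial; ring|auto_derive; trivial; ring].
Qed.

Lemma d1_pol n F r t : CD off (S n) F -> 0 < r ->
  d1 (pol F) r t = pol (d1 F) r t * cos t + pol (d2 F) r t * sin t.
Proof.
intros HF H; apply is_derive_unique.
apply (derive_along n F (fun z => z * cos t) (fun z => z * sin t)); trivial;
  [apply off_polar, H|auto_derive; trivial; ring|auto_derive; trivial; ring].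
Qed.

Lemma d2_pol n F r t : CD off (S n) F -> 0 < r ->
  d2 (pol F) r t = r * (cos t * pol (d2 F) r t - sin t * pol (d1 F) r t).
Proof.
intros HF H; apply is_derive_unique.
replace (r * _) with (pol (d1 F) r t * (r * - sin t) + pol (d2 F) r t * (r * cos t)) by ring.
apply (derive_along n F (fun z => r * cos z) (fun z => r * sin z)); trivial;
  [apply off_polar, H|auto_derive; trivial; ring|auto_derive; trivial; ring].
Qed.

(** The Laplacian in polar coordinates. *)
Definition plap (A : R -> R -> R) (r t : R) : R :=
  d1 (d1 A) r t + d1 A r t / r + d2 (d2 A) r t / r ^ 2.

Lemma d1_ext A B r t : (forall r t, 0 < r -> A r t = B r t) -> 0 < r -> d1 A r t = d1 B r t.
Proof.
intros HE Hr; apply Derive_ext_loc; generalize (locally_pos r Hr); apply filter_imp; auto.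
Qed.

Lemma d2_ext A B r t : (forall r t, 0 < r -> A r t = B r t) -> 0 < r -> d2 A r t = d2 B r t.
Proof. intros HE Hr; apply Derive_ext; auto. Qed.

Lemma plap_ext A B r t : (forall r t, 0 < r -> A r t = B r t) -> 0 < r ->
  plap A r t = plap B r t.
Proof.
intros HE Hr; unfold plap.
rewrite (d1_ext A B r t), (d1_ext (d1 A) (d1 B) r t), (d2_ext (d2 A) (d2 B) r t);
  trivial; intros; try apply d1_ext; try apply d2_ext; trivial.
Qed.

Lemma CD_half_d n A r t : CD half (S n) A -> 0 < r ->
  ex_derive (fun z => A z t) r /\ ex_derive (fun z => A r z) t.
Proof.
intros HA Hr; destruct (CD_derives half n A open_half HA) as [Hd _].
destruct (Hd r t Hr); split; eexists; eassumption.
Qed.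

Lemma laplacian_pol F r t : CD off 2 F -> 0 < r -> pol (laplacian F) r t = plap (pol F) r t.
Proof.
intros HF Hr; unfold plap.
destruct (CD_derives off 1 F open_off HF) as [_ [H1 H2]].
destruct (CD_half_d 0 _ r t (CD_pol 1 _ H1) Hr) as [E1 E2].
destruct (CD_half_d 0 _ r t (CD_pol 1 _ H2) Hr) as [E3 E4].
rewrite (d1_ext (d1 (pol F)) (fun r t => pol (d1 F) r t * cos t + pol (d2 F) r t * sin t) r t),
  (d2_ext (d2 (pol F)) (fun r t => r * (cos t * pol (d2 F) r t - sin t * pol (d1 F) r t)) r t),
  (d1_pol 1 F r t); trivial; try (intros; first [apply (d1_pol 1)|apply (d2_pol 1)]; trivial).
assert (Q1 : d1 (fun r t => pol (d1 F) r t * cos t + pol (d2 F) r t * sin t) r t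
  = d1 (pol (d1 F)) r t * cos t + d1 (pol (d2 F)) r t * sin t).
{ apply is_derive_unique; auto_derive; [repeat split; trivial|unfold d1; ring]. }
assert (Q2 : d2 (fun r t => r * (cos t * pol (d2 F) r t - sin t * pol (d1 F) r t)) r t
  = r * (- sin t * pol (d2 F) r t + cos t * d2 (pol (d2 F)) r t
         - cos t * pol (d1 F) r t - sin t * d2 (pol (d1 F)) r t)).
{ apply is_derive_unique; auto_derive; [repeat split; trivial|unfold d2; ring]. }
rewrite Q1, Q2.
rewrite !(d1_pol 0), !(d2_pol 0); trivial.
assert (HL : pol (laplacian F) r t = pol (d1 (d1 F)) r t + pol (d2 (d2 F)) r t) by reflexivity.
rewrite HL; set (c := cos t) in *; set (s := sin t) in *.
assert (Hcs : c ^ 2 = 1 - s ^ 2) by (unfold c, s; rewrite <- (pow_sin_cos t); ring).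
field_simplify_eq; [|lra]; ring [Hcs].
Qed.

(** * The polar Laplacian in a rotating frame *)

Section Rotation.

Variables (m : R) (A B : R -> R -> R).
Hypotheses (HA : CD half 2 A) (HB : CD half 2 B).

(** The pair [(A, B)] turned by the angle [m t]. With [m = 1] this gives the Cartesian components of
    a vector from its polar ones, with [m = n] those of a scalar from its parts along and across the
    vortex phase. *)
Definition rotc (r t : R) : R := cos (m * t) * A r t - sin (m * t) * B r t.
Definition rots (r t : R) : R := sin (m * t) * A r t + cos (m * t) * B r t.

Lemma d1_rotc r t : 0 < r -> d1 rotc r t = cos (m * t) * d1 A r t - sin (m * t) * d1 B r t.
Proof.
intros Hr; destruct (CD_half_d 1 A r t HA Hr), (CD_half_d 1 B r t HB Hr).
apply is_derive_unique; unfold rotc; auto_derive; [repeat split; trivial|unfold d1; ring].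
Qed.

Lemma d1_rots r t : 0 < r -> d1 rots r t = sin (m * t) * d1 A r t + cos (m * t) * d1 B r t.
Proof.
intros Hr; destruct (CD_half_d 1 A r t HA Hr), (CD_half_d 1 B r t HB Hr).
apply is_derive_unique; unfold rots; auto_derive; [repeat split; trivial|unfold d1; ring].
Qed.

Lemma d2_rotc r t : 0 < r -> d2 rotc r t =
  cos (m * t) * (d2 A r t - m * B r t) - sin (m * t) * (d2 B r t + m * A r t).
Proof.
intros Hr; destruct (CD_half_d 1 A r t HA Hr), (CD_half_d 1 B r t HB Hr).
apply is_derive_unique; unfold rotc; auto_derive; [repeat split; trivial|unfold d2; ring].
Qed.

Lemma d2_rots r t : 0 < r -> d2 rots r t =
  sin (m * t) * (d2 A r t - m * B r t) + cos (m * t) * (d2 B r t + m * A r t).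
Proof.
intros Hr; destruct (CD_half_d 1 A r t HA Hr), (CD_half_d 1 B r t HB Hr).
apply is_derive_unique; unfold rots; auto_derive; [repeat split; trivial|unfold d2; ring].
Qed.

(** The Laplacian as seen in the frame turning with [m t]: a centrifugal term [m ^ 2 / r ^ 2] and a
    coupling of the two components through their angular derivatives. *)
Definition roteqA r t := plap A r t - m ^ 2 / r ^ 2 * A r t - 2 * m / r ^ 2 * d2 B r t.
Definition roteqB r t := plap B r t - m ^ 2 / r ^ 2 * B r t + 2 * m / r ^ 2 * d2 A r t.

Lemma plap_rotc r t : 0 < r ->
  plap rotc r t = cos (m * t) * roteqA r t - sin (m * t) * roteqB r t.
Proof.
intros Hr; unfold plap.
rewrite (d1_ext (d1 rotc) (fun r t => cos (m * t) * d1 A r t - sin (m * t) * d1 B r t) r t d1_rotc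
  Hr).
rewrite (d2_ext (d2 rotc) _ r t d2_rotc Hr), d1_rotc by trivial.
destruct (CD_derives half 1 A open_half HA) as [_ [A1' A2']].
destruct (CD_derives half 1 B open_half HB) as [_ [B1' B2']].
destruct (CD_half_d 1 A r t HA Hr), (CD_half_d 1 B r t HB Hr).
destruct (CD_half_d 0 _ r t A1' Hr), (CD_half_d 0 _ r t B1' Hr),
 (CD_half_d 0 _ r t A2' Hr), (CD_half_d 0 _ r t B2' Hr).
assert (Q1 : d1 (fun r t => cos (m * t) * d1 A r t - sin (m * t) * d1 B r t) r t
   = cos (m * t) * d1 (d1 A) r t - sin (m * t) * d1 (d1 B) r t).
{ apply is_derive_unique; auto_derive; [repeat split; trivial|unfold d1; ring]. }
assert (Q2 : d2 (fun r t => cos (m * t) * (d2 A r t - m * B r t) - sin (m * t) *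
  (d2 B r t + m * A r t)) r t
   = cos (m * t) * (d2 (d2 A) r t - 2 * m * d2 B r t - m ^ 2 * A r t)
     - sin (m * t) * (d2 (d2 B) r t + 2 * m * d2 A r t - m ^ 2 * B r t)).
{ apply is_derive_unique; auto_derive; [repeat split; trivial|unfold d2; ring]. }
rewrite Q1, Q2; unfold roteqA, roteqB, plap; field; lra.
Qed.

Lemma plap_rots r t : 0 < r ->
  plap rots r t = sin (m * t) * roteqA r t + cos (m * t) * roteqB r t.
Proof.
intros Hr; unfold plap.
rewrite (d1_ext (d1 rots) _ r t d1_rots Hr).
rewrite (d2_ext (d2 rots) _ r t d2_rots Hr), d1_rots by trivial.
destruct (CD_derives half 1 A open_half HA) as [_ [A1' A2']].
destruct (CD_derives half 1 B open_half HB) as [_ [B1' B2']].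
destruct (CD_half_d 1 A r t HA Hr), (CD_half_d 1 B r t HB Hr).
destruct (CD_half_d 0 _ r t A1' Hr), (CD_half_d 0 _ r t B1' Hr),
 (CD_half_d 0 _ r t A2' Hr), (CD_half_d 0 _ r t B2' Hr).
assert (Q1 : d1 (fun r t => sin (m * t) * d1 A r t + cos (m * t) * d1 B r t) r t
   = sin (m * t) * d1 (d1 A) r t + cos (m * t) * d1 (d1 B) r t).
{ apply is_derive_unique; auto_derive; [repeat split; trivial|unfold d1; ring]. }
assert (Q2 : d2 (fun r t => sin (m * t) * (d2 A r t - m * B r t) + cos (m * t) *
  (d2 B r t + m * A r t)) r t
   = sin (m * t) * (d2 (d2 A) r t - 2 * m * d2 B r t - m ^ 2 * A r t)
     + cos (m * t) * (d2 (d2 B) r t + 2 * m * d2 A r t - m ^ 2 * B r t)).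
{ apply is_derive_unique; auto_derive; [repeat split; trivial|unfold d2; ring]. }
rewrite Q1, Q2; unfold roteqA, roteqB, plap; field; lra.
Qed.

End Rotation.

(** * The fluctuation operator in polar components *)

Section Vortex.

Variables (n : nat) (lambda : R) (f beta : R -> R).
Hypothesis Hv : vortex_profiles n lambda f beta.

(** The profile equation expresses the second derivative of [f] through continuous functions, which
    raises twice derivability to class C^2. *)
Lemma CR_f : CR 2 f.
Proof.
destruct Hv as [Tf [Tb [Ef _]]].
assert (F1 := twice_derivable_CR f Tf); assert (B0 := CR_pred _ _ (twice_derivable_CR beta Tb)).
apply CR_S; [intros r Hr; apply (Tf r Hr)|].
apply CR_S; [intros r Hr; apply (Tf r Hr)|].
apply CR_ext with (fun r => INR n ^ 2 * (/ r) ^ 2 * (1 - beta r) ^ 2 * f r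
       - (lambda / 2 * (1 - f r ^ 2) * f r) - Derive f r / r).
- intros r Hr; specialize (Ef r Hr); simpl Derive_n in Ef.
  change (Derive (Derive f) r) with (Derive (fun x => Derive (fun x => f x) x) r).
  rewrite pow_inv; unfold Rdiv in *; lra.
- assert (F0 := CR_pred _ _ F1).
  destruct (CR_derives 0 f F1) as [_ D0].
  repeat first [apply CR_minus|apply CR_mult|apply CR_pow|apply CR_const|apply CR_inv|apply
    CR_div|assumption].
Qed.

Lemma CR_beta : CR 1 beta.
Proof. apply twice_derivable_CR, Hv. Qed.

Lemma of_polar_pol g r t : 0 < r ->
  pol (of_polar g) r t = g r (ang (r * cos t) (r * sin t)).
Proof. intros Hr; unfold pol, of_polar; rewrite rad_polar by lra; reflexivity. Qed.

Lemma vortex_pol r t : 0 < r ->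
  pol (vortex n f beta A1) r t = - (INR n * beta r / r) * sin t /\
  pol (vortex n f beta A2) r t = INR n * beta r / r * cos t /\
  pol (vortex n f beta P1) r t = f r * cos (INR n * t) /\
  pol (vortex n f beta P2) r t = f r * sin (INR n * t).
Proof.
intros Hr; unfold vortex, polar_field, mkfield; rewrite !of_polar_pol by trivial.
destruct (cos_sin_ang 1 r t Hr) as [E1 E2]; simpl INR in E1, E2; rewrite !Rmult_1_l in E1, E2.
destruct (cos_sin_ang n r t Hr) as [E3 E4].
rewrite E1, E2, E3, E4; auto.
Qed.

Lemma CD_vortex : CD off 2 (vortex n f beta P1) /\ CD off 2 (vortex n f beta P2).
Proof.
destruct (CD_cos_sin_ang 2 n) as [Hc Hs].
split; [apply (CD_mult off 2 (fun x y => f (rad x y)) _ (CD_radial 2 f CR_f) Hc)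
       |apply (CD_mult off 2 (fun x y => f (rad x y)) _ (CD_radial 2 f CR_f) Hs)].
Qed.

(** [ar] and [at'] are the radial and azimuthal parts of the vector, [sg] and [ta] the scalar parts
    along and across the phase [n t]. In this frame the background is independent of the angle. *)
Definition frame (xi : field) (ar at' sg ta : R -> R -> R) : Prop :=
  forall r t, 0 < r ->
    pol (xi A1) r t = cos t * ar r t - sin t * at' r t /\
    pol (xi A2) r t = sin t * ar r t + cos t * at' r t /\
    pol (xi P1) r t = cos (INR n * t) * sg r t - sin (INR n * t) * ta r t /\
    pol (xi P2) r t = sin (INR n * t) * sg r t + cos (INR n * t) * ta r t.

Variables (ar at' sg ta : R -> R -> R).

(* [Er] and [Et] are the radial and azimuthal components of the operator, [Es] and [Eta]
   its components along and across the phase [n t]; [Eg] is the gauge condition. *)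
Definition Er r t := - plap ar r t + ar r t / r ^ 2 + 2 / r ^ 2 * d2 at' r t
  + f r ^ 2 * ar r t + 2 * Derive f r * ta r t.
Definition Et r t := - plap at' r t + at' r t / r ^ 2 - 2 / r ^ 2 * d2 ar r t
  + f r ^ 2 * at' r t - 2 * INR n * (1 - beta r) * f r / r * sg r t.
Definition Es r t := - plap sg r t + 2 * INR n * (1 - beta r) / r ^ 2 * d2 ta r t
  + (INR n ^ 2 * (1 - beta r) ^ 2 / r ^ 2 + 3 * lambda / 2 * f r ^ 2 - lambda / 2) * sg r t
  - 2 * INR n * (1 - beta r) * f r / r * at' r t.
Definition Eta r t := - plap ta r t - 2 * INR n * (1 - beta r) / r ^ 2 * d2 sg r t
  + (INR n ^ 2 * (1 - beta r) ^ 2 / r ^ 2 + f r ^ 2 + lambda / 2 * f r ^ 2 - lambda / 2) * ta r t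
  + 2 * Derive f r * ar r t.
Definition Eg r t := d1 ar r t + ar r t / r + d2 at' r t / r - f r * ta r t.

Hypotheses (Har : CD half 2 ar) (Hat : CD half 2 at') (Hsg : CD half 2 sg) (Hta : CD half 2 ta).

Variable xi : field.
Hypotheses (Hxi : forall c, CD off 2 (xi c)) (Hfr : frame xi ar at' sg ta).

Lemma cart_d1 F r t : CD off 2 F -> 0 < r ->
  pol (d1 F) r t = cos t * d1 (pol F) r t - sin t / r * d2 (pol F) r t.
Proof.
intros HF Hr; rewrite (d1_pol 1), (d2_pol 1) by trivial.
assert (Hcs : cos t ^ 2 = 1 - sin t ^ 2) by apply cos_sq.
field_simplify_eq; [|lra]; ring [Hcs].
Qed.

Lemma cart_d2 F r t : CD off 2 F -> 0 < r ->
  pol (d2 F) r t = sin t * d1 (pol F) r t + cos t / r * d2 (pol F) r t.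
Proof.
intros HF Hr; rewrite (d1_pol 1), (d2_pol 1) by trivial.
assert (Hcs : cos t ^ 2 = 1 - sin t ^ 2) by apply cos_sq.
field_simplify_eq; [|lra]; ring [Hcs].
Qed.

Lemma frame_rot r t : 0 < r ->
  pol (xi A1) r t = rotc 1 ar at' r t /\ pol (xi A2) r t = rots 1 ar at' r t /\
  pol (xi P1) r t = rotc (INR n) sg ta r t /\ pol (xi P2) r t = rots (INR n) sg ta r t.
Proof. intros Hr; unfold rotc, rots; rewrite !Rmult_1_l; apply Hfr, Hr. Qed.

Lemma vortex_d r t : 0 < r ->
  d1 (pol (vortex n f beta P1)) r t = Derive f r * cos (INR n * t) /\
  d1 (pol (vortex n f beta P2)) r t = Derive f r * sin (INR n * t) /\
  d2 (pol (vortex n f beta P1)) r t = - INR n * f r * sin (INR n * t) /\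
  d2 (pol (vortex n f beta P2)) r t = INR n * f r * cos (INR n * t).
Proof.
intros Hr.
rewrite (d1_ext (pol (vortex n f beta P1)) (fun r t => f r * cos (INR n * t)) r t),
  (d2_ext (pol (vortex n f beta P1)) (fun r t => f r * cos (INR n * t)) r t)
  by (trivial; intros; apply vortex_pol; trivial).
rewrite (d1_ext (pol (vortex n f beta P2)) (fun r t => f r * sin (INR n * t)) r t),
  (d2_ext (pol (vortex n f beta P2)) (fun r t => f r * sin (INR n * t)) r t)
  by (trivial; intros; apply vortex_pol; trivial).
assert (H := CR_ex_derive 1 f r CR_f Hr).
repeat split; apply is_derive_unique; auto_derive; trivial;
  try change (Derive (fun x => f x) r) with (Derive f r); ring.
Qed.

(** Collects the values and first derivatives of the field and of the vortex in the frame. [Hcs] and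
    [Hcn] are oriented as rewrite rules for squared cosines, so that the identities below are
    decided by [ring] modulo [cos ^ 2 + sin ^ 2 = 1] at the angles [t] and [n t]. *)
Ltac frame_setup r t Hr :=
  pose proof (frame_rot r t Hr) as [X1 [X2 [X3 X4]]];
  pose proof (vortex_pol r t Hr) as [Y1 [Y2 [Y3 Y4]]];
  pose proof (vortex_d r t Hr) as [Z1 [Z2 [Z3 Z4]]];
  destruct CD_vortex as [CV1 CV2];
  assert (Hcs : cos t ^ 2 = 1 - sin t ^ 2) by apply cos_sq;
  assert (Hcn : cos (INR n * t) ^ 2 = 1 - sin (INR n * t) ^ 2)
    by (rewrite <- (pow_sin_cos (INR n * t)); ring);
  assert (W1 := d1_ext _ _ r t (fun r t H => proj1 (frame_rot r t H)) Hr);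
  assert (W2 := d1_ext _ _ r t (fun r t H => proj1 (proj2 (frame_rot r t H))) Hr);
  assert (W3 := d1_ext _ _ r t (fun r t H => proj1 (proj2 (proj2 (frame_rot r t H)))) Hr);
  assert (W4 := d1_ext _ _ r t (fun r t H => proj2 (proj2 (proj2 (frame_rot r t H)))) Hr);
  assert (W5 := d2_ext _ _ r t (fun r t H => proj1 (frame_rot r t H)) Hr);
  assert (W6 := d2_ext _ _ r t (fun r t H => proj1 (proj2 (frame_rot r t H))) Hr);
  assert (W7 := d2_ext _ _ r t (fun r t H => proj1 (proj2 (proj2 (frame_rot r t H)))) Hr);
  assert (W8 := d2_ext _ _ r t (fun r t H => proj2 (proj2 (proj2 (frame_rot r t H)))) Hr);
  rewrite d1_rotc in W1, W3 by trivial; rewrite d1_rots in W2, W4 by trivial;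
  rewrite d2_rotc in W5, W7 by trivial; rewrite d2_rots in W6, W8 by trivial;
  unfold rotc, rots in X1, X2, X3, X4; rewrite ?Rmult_1_l in X1, X2, W1, W2, W5, W6.

Lemma gauge_frame r t : 0 < r ->
  pol (d1 (xi A1)) r t + pol (d2 (xi A2)) r t
      - (pol (vortex n f beta P1) r t * pol (xi P2) r t - pol (vortex n f beta P2) r t * pol (xi P1)
        r t)
  = Eg r t.
Proof.
intros Hr; frame_setup r t Hr.
rewrite cart_d1, cart_d2 by trivial.
rewrite W1, W2, W5, W6, X3, X4, Y3, Y4; unfold Eg.
field_simplify_eq; [|lra]; ring [Hcs Hcn].
Qed.

Lemma Hplus_vector r t : 0 < r ->
  pol (Hplus lambda (vortex n f beta) xi A1) r t = cos t * Er r t - sin t * Et r t /\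
  pol (Hplus lambda (vortex n f beta) xi A2) r t = sin t * Er r t + cos t * Et r t.
Proof.
intros Hr; frame_setup r t Hr.
assert (L1 := plap_ext _ _ r t (fun r t H => proj1 (frame_rot r t H)) Hr).
assert (L2 := plap_ext _ _ r t (fun r t H => proj1 (proj2 (frame_rot r t H))) Hr).
rewrite plap_rotc in L1 by trivial; rewrite plap_rots in L2 by trivial.
rewrite Rmult_1_l in L1, L2.
assert (G1 := cart_d1 _ r t CV1 Hr); assert (G2 := cart_d1 _ r t CV2 Hr).
assert (G3 := cart_d2 _ r t CV1 Hr); assert (G4 := cart_d2 _ r t CV2 Hr).
rewrite Z1, Z3 in G1, G3; rewrite Z2, Z4 in G2, G4.
split.
(* Passing to polar coordinates commutes with every algebraic operation in [Hplus], so this form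
   holds by conversion and exposes the derivatives to rewriting. *)
- transitivity (- pol (laplacian (xi A1)) r t
    + (pol (vortex n f beta P1) r t ^ 2 + pol (vortex n f beta P2) r t ^ 2) * pol (xi A1) r t
    - 2 * (pol (d1 (vortex n f beta P2)) r t - pol (vortex n f beta A1) r t * pol
      (vortex n f beta P1) r t) * pol (xi P1) r t
    + 2 * (pol (d1 (vortex n f beta P1)) r t + pol (vortex n f beta A1) r t * pol
      (vortex n f beta P2) r t) * pol (xi P2) r t);
  [reflexivity|].
  rewrite laplacian_pol, L1, X1, X3, X4, Y1, Y3, Y4, G1, G2 by trivial.
  unfold Er, Et, roteqA, roteqB; field_simplify_eq; [|lra]; ring [Hcs Hcn].
- transitivity (- pol (laplacian (xi A2)) r t
    + (pol (vortex n f beta P1) r t ^ 2 + pol (vortex n f beta P2) r t ^ 2) * pol (xi A2) r t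
    - 2 * (pol (d2 (vortex n f beta P2)) r t - pol (vortex n f beta A2) r t * pol
      (vortex n f beta P1) r t) * pol (xi P1) r t
    + 2 * (pol (d2 (vortex n f beta P1)) r t + pol (vortex n f beta A2) r t * pol
      (vortex n f beta P2) r t) * pol (xi P2) r t);
  [reflexivity|].
  rewrite laplacian_pol, L2, X2, X3, X4, Y2, Y3, Y4, G3, G4 by trivial.
  unfold Er, Et, roteqA, roteqB; field_simplify_eq; [|lra]; ring [Hcs Hcn].
Qed.

Lemma Hplus_scalar r t : 0 < r ->
  pol (Hplus lambda (vortex n f beta) xi P1) r t = cos (INR n * t) * Es r t - sin (INR n * t) * Eta
    r t /\
  pol (Hplus lambda (vortex n f beta) xi P2) r t = sin (INR n * t) * Es r t + cos (INR n * t) * Eta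
    r t.
Proof.
intros Hr; frame_setup r t Hr.
assert (L1 := plap_ext _ _ r t (fun r t H => proj1 (proj2 (proj2 (frame_rot r t H)))) Hr).
assert (L2 := plap_ext _ _ r t (fun r t H => proj2 (proj2 (proj2 (frame_rot r t H)))) Hr).
rewrite plap_rotc in L1 by trivial; rewrite plap_rots in L2 by trivial.
assert (G1 := cart_d1 _ r t CV1 Hr); assert (G2 := cart_d1 _ r t CV2 Hr).
assert (G3 := cart_d2 _ r t CV1 Hr); assert (G4 := cart_d2 _ r t CV2 Hr).
rewrite Z1, Z3 in G1, G3; rewrite Z2, Z4 in G2, G4.
assert (K1 := cart_d1 _ r t (Hxi P1) Hr); assert (K2 := cart_d1 _ r t (Hxi P2) Hr).
assert (K3 := cart_d2 _ r t (Hxi P1) Hr); assert (K4 := cart_d2 _ r t (Hxi P2) Hr).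
rewrite W3, W7 in K1, K3; rewrite W4, W8 in K2, K4.
set (Psi := vortex n f beta) in *.
split.
- transitivity (
    - 2 * (pol (d1 (Psi P2)) r t - pol (Psi A1) r t * pol (Psi P1) r t) * pol (xi A1) r t
    - 2 * (pol (d2 (Psi P2)) r t - pol (Psi A2) r t * pol (Psi P1) r t) * pol (xi A2) r t
    - pol (laplacian (xi P1)) r t
    + (3 * lambda / 2 * pol (Psi P1) r t ^ 2 + (1 + lambda / 2) * pol (Psi P2) r t ^ 2 - lambda / 2
       + (pol (Psi A1) r t ^ 2 + pol (Psi A2) r t ^ 2)) * pol (xi P1) r t
    - 2 * (pol (Psi A1) r t * pol (d1 (xi P2)) r t + pol (Psi A2) r t * pol (d2 (xi P2)) r t)
    + (lambda - 1) * pol (Psi P1) r t * pol (Psi P2) r t * pol (xi P2) r t); [reflexivity|].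
  rewrite laplacian_pol, L1, X1, X2, X3, X4, Y1, Y2, Y3, Y4, G2, G4, K2, K4 by trivial.
  unfold Es, Eta, roteqA, roteqB; field_simplify_eq; [|lra]; ring [Hcs Hcn].
- transitivity (
    2 * (pol (d1 (Psi P1)) r t + pol (Psi A1) r t * pol (Psi P2) r t) * pol (xi A1) r t
    + 2 * (pol (d2 (Psi P1)) r t + pol (Psi A2) r t * pol (Psi P2) r t) * pol (xi A2) r t
    + 2 * (pol (Psi A1) r t * pol (d1 (xi P1)) r t + pol (Psi A2) r t * pol (d2 (xi P1)) r t)
    + (lambda - 1) * pol (Psi P1) r t * pol (Psi P2) r t * pol (xi P1) r t
    - pol (laplacian (xi P2)) r t
    + ((1 + lambda / 2) * pol (Psi P1) r t ^ 2 + 3 * lambda / 2 * pol (Psi P2) r t ^ 2 - lambda / 2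
       + (pol (Psi A1) r t ^ 2 + pol (Psi A2) r t ^ 2)) * pol (xi P2) r t); [reflexivity|].
  rewrite laplacian_pol, L2, X1, X2, X3, X4, Y1, Y2, Y3, Y4, G1, G3, K1, K3 by trivial.
  unfold Es, Eta, roteqA, roteqB; field_simplify_eq; [|lra]; ring [Hcs Hcn].
Qed.

End Vortex.

Lemma C2_iff xi : C2_off_origin xi <-> forall c, CD off 2 (xi c).
Proof.
split.
- intros H c; apply ex_diff_n_CD; intros x y Hxy; apply H, Hxy.
- intros H c x y Hxy; apply (CD_ex_diff_n off); trivial; exact open_off.
Qed.

Lemma forall_polar (P : R -> R -> Prop) :
  (forall x y, (x, y) <> (0, 0) -> P x y) <-> (forall r t, 0 < r -> P (r * cos t) (r * sin t)).
Proof.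
split.
- intros H r t Hr; apply H, off_polar, Hr.
- intros H x y Hxy; destruct (off_is_polar x y Hxy) as [r [t [Hr [-> ->]]]]; auto.
Qed.

Lemma rot_zero s x y : cos s * x - sin s * y = 0 -> sin s * x + cos s * y = 0 -> x = 0 /\ y = 0.
Proof.
intros H1 H2; assert (H := pow_sin_cos s).
split.
- replace x with (x * (cos s ^ 2 + sin s ^ 2)) by (rewrite H; ring).
  transitivity (cos s * (cos s * x - sin s * y) + sin s * (sin s * x + cos s * y)); [ring|].
  rewrite H1, H2; ring.
- replace y with (y * (cos s ^ 2 + sin s ^ 2)) by (rewrite H; ring).
  transitivity (- sin s * (cos s * x - sin s * y) + cos s * (sin s * x + cos s * y)); [ring|].
  rewrite H1, H2; ring.
Qed.

(** The frame components are the inverse rotations of the Cartesian ones. The formulas stay in the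
    conclusion because Fourier coefficients will be taken of exactly these functions. *)
Lemma frame_exists n xi : (forall c, CD off 2 (xi c)) -> exists ar at' sg ta,
  CD half 2 ar /\ CD half 2 at' /\ CD half 2 sg /\ CD half 2 ta /\ frame n xi ar at' sg ta /\
  ar = (fun r t => cos t * pol (xi A1) r t + sin t * pol (xi A2) r t) /\
  at' = (fun r t => - sin t * pol (xi A1) r t + cos t * pol (xi A2) r t) /\
  sg = (fun r t => cos (INR n * t) * pol (xi P1) r t + sin (INR n * t) * pol (xi P2) r t) /\
  ta = (fun r t => - sin (INR n * t) * pol (xi P1) r t + cos (INR n * t) * pol (xi P2) r t).
Proof.
intros H.
exists (fun r t => cos t * pol (xi A1) r t + sin t * pol (xi A2) r t),
  (fun r t => - sin t * pol (xi A1) r t + cos t * pol (xi A2) r t),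
  (fun r t => cos (INR n * t) * pol (xi P1) r t + sin (INR n * t) * pol (xi P2) r t),
  (fun r t => - sin (INR n * t) * pol (xi P1) r t + cos (INR n * t) * pol (xi P2) r t).
assert (Hp : forall c, CD half 2 (pol (xi c))) by (intros c; apply CD_pol, H).
assert (Cc : CD half 2 (fun _ t => cos t)).
{ apply CD_ext with (F := fun _ t => cos (1 * t)); [exact open_half| |apply CD_cos].
  intros; rewrite Rmult_1_l; reflexivity. }
assert (Cs : CD half 2 (fun _ t => sin t)).
{ apply CD_ext with (F := fun _ t => sin (1 * t)); [exact open_half| |apply CD_sin].
  intros; rewrite Rmult_1_l; reflexivity. }
assert (Cn := CD_cos half 2 (INR n)); assert (Sn := CD_sin half 2 (INR n)).
assert (Cs' := CD_opp half 2 _ Cs); assert (Sn' := CD_opp half 2 _ Sn).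
repeat (split; [apply CD_plus; apply CD_mult; auto|]).
split; [|repeat split].
intros r t Hr.
repeat split; ring [(cos_sq t) (cos_sq (INR n * t))].
Qed.

Definition eigen_eq n lambda f beta w2 (xi : field) : Prop :=
  forall c x1 x2, (x1, x2) <> (0, 0) ->
    Hplus lambda (vortex n f beta) xi c x1 x2 = w2 * xi c x1 x2.

Lemma eigen_frame n lambda f beta w2 xi ar at' sg ta :
  vortex_profiles n lambda f beta ->
  CD half 2 ar -> CD half 2 at' -> CD half 2 sg -> CD half 2 ta ->
  (forall c, CD off 2 (xi c)) -> frame n xi ar at' sg ta ->
  (eigen_eq n lambda f beta w2 xi <->
   forall r t, 0 < r ->
     Er f ar at' ta r t = w2 * ar r t /\ Et n f beta ar at' sg r t = w2 * at' r t /\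
     Es n lambda f beta at' sg ta r t = w2 * sg r t /\
     Eta n lambda f beta ar sg ta r t = w2 * ta r t).
Proof.
intros Hv H1 H2 H3 H4 Hxi Hfr; split.
- intros HE r t Hr.
  destruct (Hplus_vector n lambda f beta Hv ar at' sg ta H1 H2 H3 H4 xi Hxi Hfr r t Hr) as [K1 K2].
  destruct (Hplus_scalar n lambda f beta Hv ar at' sg ta H1 H2 H3 H4 xi Hxi Hfr r t Hr) as [K3 K4].
  destruct (Hfr r t Hr) as [F1 [F2 [F3 F4]]].
  assert (G1 := HE A1 _ _ (off_polar r t Hr)); assert (G2 := HE A2 _ _ (off_polar r t Hr)).
  assert (G3 := HE P1 _ _ (off_polar r t Hr)); assert (G4 := HE P2 _ _ (off_polar r t Hr)).
  unfold pol in *; rewrite K1, F1 in G1; rewrite K2, F2 in G2; rewrite K3, F3 in G3;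
    rewrite K4, F4 in G4.
  destruct (rot_zero t (Er f ar at' ta r t - w2 * ar r t)
    (Et n f beta ar at' sg r t - w2 * at' r t)) as [Q1 Q2];
    [lra|lra|].
  destruct (rot_zero (INR n * t) (Es n lambda f beta at' sg ta r t - w2 * sg r t)
    (Eta n lambda f beta ar sg ta r t - w2 * ta r t)) as [Q3 Q4]; [lra|lra|].
  repeat split; lra.
- intros HE c; apply forall_polar; intros r t Hr.
  destruct (Hplus_vector n lambda f beta Hv ar at' sg ta H1 H2 H3 H4 xi Hxi Hfr r t Hr) as [K1 K2].
  destruct (Hplus_scalar n lambda f beta Hv ar at' sg ta H1 H2 H3 H4 xi Hxi Hfr r t Hr) as [K3 K4].
  destruct (Hfr r t Hr) as [F1 [F2 [F3 F4]]].
  destruct (HE r t Hr) as [Q1 [Q2 [Q3 Q4]]].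
  unfold pol in *; rewrite Q1, Q2 in *; rewrite Q3, Q4 in *.
  destruct c; [rewrite K1, F1|rewrite K2, F2|rewrite K3, F3|rewrite K4, F4]; ring.
Qed.

Lemma gauge_iff n lambda f beta xi ar at' sg ta :
  vortex_profiles n lambda f beta ->
  CD half 2 ar -> CD half 2 at' -> CD half 2 sg -> CD half 2 ta ->
  (forall c, CD off 2 (xi c)) -> frame n xi ar at' sg ta ->
  (background_gauge (vortex n f beta) xi <-> forall r t, 0 < r -> Eg f ar at' ta r t = 0).
Proof.
intros Hv H1 H2 H3 H4 Hxi Hfr; unfold background_gauge.
rewrite forall_polar; split; intros HE r t Hr.
- rewrite <- (gauge_frame n lambda f beta Hv ar at' sg ta H1 H2 H3 H4 xi Hxi Hfr r t Hr).
  exact (HE r t Hr).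
- rewrite <- (HE r t Hr).
  exact (gauge_frame n lambda f beta Hv ar at' sg ta H1 H2 H3 H4 xi Hxi Hfr r t Hr).
Qed.

(** * Modes with separated variables *)

Definition Cos (a b : R) (k : nat) (t : R) : R := a * cos (INR k * t) + b * sin (INR k * t).
Definition Sin (a b : R) (k : nat) (t : R) : R := a * sin (INR k * t) - b * cos (INR k * t).

(** A quarter turn of [(a, b)] exchanges the two angular factors, so integrals and projections are
    computed for [Cos] only. *)
Lemma Sin_as_Cos a b k : Sin a b k = Cos (- b) a k.
Proof. apply functional_extensionality; intros t; unfold Sin, Cos; ring. Qed.

Lemma Sin_rotated a b k t : Sin (- b) a k t = - Cos a b k t.
Proof. unfold Sin, Cos; ring. Qed.

(** The signs are those of the multipolar ansatz: [e] is its azimuthal and [g] its radial vector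
    profile, [u] and [h] are the scalar profiles along and across the phase. *)
Definition is_mode (n : nat) (a b : R) (k : nat) (e g u h : R -> R) (xi : field) : Prop :=
  frame n xi (fun r t => - Sin a b k t * g r) (fun r t => - Cos a b k t * e r)
    (fun r t => Cos a b k t * u r) (fun r t => - Sin a b k t * h r).

(* [Kg], [Ke], [Ku], [Kh], [Kc] are [Er], [Et], [Es], [Eta], [Eg] on a separated mode, with
   the angular factor removed. *)
Definition Kg (f : R -> R) (k : nat) (e g h : R -> R) (r : R) : R :=
  Lop k g r + g r / r ^ 2 - 2 * INR k / r ^ 2 * e r + f r ^ 2 * g r + 2 * Derive f r * h r.
Definition Ke (n : nat) (f beta : R -> R) (k : nat) (e g u : R -> R) (r : R) : R :=
  Lop k e r + e r / r ^ 2 - 2 * INR k / r ^ 2 * g r + f r ^ 2 * e r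
  + 2 * INR n * (1 - beta r) * f r / r * u r.
Definition Ku (n : nat) (lambda : R) (f beta : R -> R) (k : nat) (e u h : R -> R) (r : R) : R :=
  Lop k u r - 2 * INR n * INR k * (1 - beta r) / r ^ 2 * h r
  + (INR n ^ 2 * (1 - beta r) ^ 2 / r ^ 2 + 3 * lambda / 2 * f r ^ 2 - lambda / 2) * u r
  + 2 * INR n * (1 - beta r) * f r / r * e r.
Definition Kh (n : nat) (lambda : R) (f beta : R -> R) (k : nat) (g u h : R -> R) (r : R) : R :=
  Lop k h r - 2 * INR n * INR k * (1 - beta r) / r ^ 2 * u r
  + (INR n ^ 2 * (1 - beta r) ^ 2 / r ^ 2 + f r ^ 2 + lambda / 2 * f r ^ 2 - lambda / 2) * h r
  + 2 * Derive f r * g r.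
Definition Kc (f : R -> R) (k : nat) (e g h : R -> R) (r : R) : R :=
  Derive g r + g r / r - INR k * e r / r - f r * h r.

Lemma CD_Cos D n a b k : CD D n (fun _ t => Cos a b k t).
Proof. apply CD_plus; apply CD_scal; [apply CD_cos|apply CD_sin]. Qed.

Lemma CD_Sin D n a b k : CD D n (fun _ t => Sin a b k t).
Proof. apply CD_minus; apply CD_scal; [apply CD_sin|apply CD_cos]. Qed.

Lemma Cos_derive a b k t : is_derive (Cos a b k) t (- INR k * Sin a b k t).
Proof. unfold Cos, Sin; auto_derive; trivial; ring. Qed.

Lemma Sin_derive a b k t : is_derive (Sin a b k) t (INR k * Cos a b k t).
Proof. unfold Cos, Sin; auto_derive; trivial; ring. Qed.

Lemma CD_sep n T y : CD half n (fun _ t => T t) -> CR n y -> CD half n (fun r t => T t * y r).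
Proof. intros HT Hy; apply CD_mult; [exact HT|exact Hy]. Qed.

Lemma plap_sep (k : nat) (T T' : R -> R) y r t :
  (forall t, is_derive T t (T' t)) -> (forall t, is_derive T' t (- INR k ^ 2 * T t)) ->
  CR 2 y -> 0 < r -> plap (fun r t => T t * y r) r t = - T t * Lop k y r.
Proof.
intros HT HT' Hy Hr; unfold plap, Lop.
destruct (CR_derives 1 y Hy) as [D1 Hy1]; destruct (CR_derives 0 _ Hy1) as [D2 _].
assert (E1 : forall r t, 0 < r -> d1 (fun r t => T t * y r) r t = T t * Derive y r).
{ intros s q Hs; apply Derive_scal. }
assert (E2 : forall r t, 0 < r -> d2 (fun r t => T t * y r) r t = T' t * y r).
{ intros s q Hs; unfold d2; rewrite Derive_scal_l; f_equal; apply is_derive_unique, HT. }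
rewrite (d1_ext _ _ r t E1 Hr), (d2_ext _ _ r t E2 Hr), (E1 r t Hr).
replace (d1 (fun r t => T t * Derive y r) r t) with (T t * Derive_n y 2 r)
  by (symmetry; apply Derive_scal).
replace (d2 (fun r t => T' t * y r) r t) with (- INR k ^ 2 * T t * y r).
2:{ symmetry; unfold d2; rewrite Derive_scal_l; f_equal; apply is_derive_unique, HT'. }
field; lra.
Qed.

Lemma opp_derive (T : R -> R) t l : is_derive T t l -> is_derive (fun t => - T t) t (- l).
Proof. intros H; apply (is_derive_opp T); exact H. Qed.

Lemma mode_eqs n lambda f beta a b k e g u h r t :
  CR 2 e -> CR 2 g -> CR 2 u -> CR 2 h -> 0 < r ->
  let ar := fun r t => - Sin a b k t * g r in
  let at' := fun r t => - Cos a b k t * e r in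
  let sg := fun r t => Cos a b k t * u r in
  let ta := fun r t => - Sin a b k t * h r in
  Er f ar at' ta r t = - Sin a b k t * Kg f k e g h r /\
  Et n f beta ar at' sg r t = - Cos a b k t * Ke n f beta k e g u r /\
  Es n lambda f beta at' sg ta r t = Cos a b k t * Ku n lambda f beta k e u h r /\
  Eta n lambda f beta ar sg ta r t = - Sin a b k t * Kh n lambda f beta k g u h r /\
  Eg f ar at' ta r t = - Sin a b k t * Kc f k e g h r.
Proof.
intros He Hg Hu Hh Hr ar at' sg ta.
assert (PS : forall y, CR 2 y -> plap (fun r t => - Sin a b k t * y r) r t = Sin a b k t * Lop k y
  r).
{ intros y Hy; rewrite (plap_sep k (fun t => - Sin a b k t) (fun t => - (INR k * Cos a b k t)));
  trivial; try ring.
  - intros; apply opp_derive, Sin_derive.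
  - intros s; replace (- INR k ^ 2 * - Sin a b k s) with (- (INR k * (- INR k * Sin a b k s)))
    by ring.
    apply opp_derive, is_derive_scal, Cos_derive. }
assert (PC : forall y, CR 2 y -> plap (fun r t => Cos a b k t * y r) r t = - Cos a b k t * Lop k y
  r).
{ intros y Hy; rewrite (plap_sep k (fun t => Cos a b k t) (fun t => - INR k * Sin a b k t));
  trivial; try ring.
  - intros; apply Cos_derive.
  - intros s; replace (- INR k ^ 2 * Cos a b k s) with (- INR k * (INR k * Cos a b k s)) by ring.
    apply is_derive_scal, Sin_derive. }
assert (PC' : forall y, CR 2 y -> plap (fun r t => - Cos a b k t * y r) r t = Cos a b k t * Lop k y
  r).
{ intros y Hy; rewrite (plap_sep k (fun t => - Cos a b k t) (fun t => - (- INR k * Sin a b k t)));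
  trivial; try ring.
  - intros; apply opp_derive, Cos_derive.
  - intros s; replace (- INR k ^ 2 * - Cos a b k s) with (- (- INR k * (INR k * Cos a b k s)))
    by ring.
    apply opp_derive, is_derive_scal, Sin_derive. }
assert (D1 : d2 at' r t = INR k * Sin a b k t * e r).
{ unfold d2, at'; rewrite Derive_scal_l; f_equal; apply is_derive_unique.
  replace (INR k * Sin a b k t) with (- (- INR k * Sin a b k t)) by ring;
    apply opp_derive, Cos_derive. }
assert (D2 : d2 ar r t = - (INR k * Cos a b k t) * g r).
{ unfold d2, ar; rewrite Derive_scal_l; f_equal; apply is_derive_unique, opp_derive, Sin_derive. }
assert (D3 : d2 sg r t = - INR k * Sin a b k t * u r).
{ unfold d2, sg; rewrite Derive_scal_l; f_equal; apply is_derive_unique, Cos_derive. }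
assert (D4 : d2 ta r t = - (INR k * Cos a b k t) * h r).
{ unfold d2, ta; rewrite Derive_scal_l; f_equal; apply is_derive_unique, opp_derive, Sin_derive. }
assert (D5 : d1 ar r t = - Sin a b k t * Derive g r) by apply Derive_scal.
unfold Er, Et, Es, Eta, Eg; rewrite D1, D2, D3, D4, D5.
assert (L1 : plap ar r t = _) by exact (PS g Hg).
assert (L2 : plap at' r t = _) by exact (PC' e He).
assert (L3 : plap sg r t = _) by exact (PC u Hu).
assert (L4 : plap ta r t = _) by exact (PS h Hh).
rewrite L1, L2, L3, L4.
unfold ar, at', sg, ta, Kg, Ke, Ku, Kh, Kc; repeat split; field; lra.
Qed.

Lemma at_polar F x y : off x y -> F x y = pol F (rad x y) (ang x y).
Proof.
intros H; destruct (of_polar_coordinates x y H) as [_ [H1 H2]].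
unfold pol; rewrite <- H1, <- H2; reflexivity.
Qed.

(** The field is assembled from functions of [rad] and from the cosine and sine of integer multiples
    of [ang], all smooth off the origin although [ang] is not. *)
Lemma CD_mode n a b k e g u h xi :
  is_mode n a b k e g u h xi -> CR 2 e -> CR 2 g -> CR 2 u -> CR 2 h -> forall c, CD off 2 (xi c).
Proof.
intros HM He Hg Hu Hh c.
destruct (CD_cos_sin_ang 2 k) as [Ck Sk].
destruct (CD_cos_sin_ang 2 n) as [Cn Sn].
assert (C1 : CD off 2 (fun x y => cos (ang x y))).
{ apply CD_ext with (3 := proj1 (CD_cos_sin_ang 2 1)); [exact open_off|].
  intros; simpl INR; rewrite Rmult_1_l; reflexivity. }
assert (S1 : CD off 2 (fun x y => sin (ang x y))).
{ apply CD_ext with (3 := proj2 (CD_cos_sin_ang 2 1)); [exact open_off|].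
  intros; simpl INR; rewrite Rmult_1_l; reflexivity. }
assert (KC : CD off 2 (fun x y => Cos a b k (ang x y)))
  by (apply CD_plus; apply CD_scal; assumption).
assert (KS : CD off 2 (fun x y => - Sin a b k (ang x y)))
  by (apply CD_opp, CD_minus; apply CD_scal; assumption).
assert (Ke := CD_radial 2 e He); assert (Kg := CD_radial 2 g Hg).
assert (Ku := CD_radial 2 u Hu); assert (Kh := CD_radial 2 h Hh).
assert (AR := CD_mult _ _ _ _ KS Kg). assert (AT := CD_mult _ _ _ _ (CD_opp _ _ _ KC) Ke).
assert (SG := CD_mult _ _ _ _ KC Ku). assert (TA := CD_mult _ _ _ _ KS Kh).
assert (HM' := fun x y (H : off x y) => HM (rad x y) (ang x y) (off_rad x y H)).
destruct c.
- refine (CD_ext off 2 _ _ open_off _ (CD_minus _ _ _ _ (CD_mult _ _ _ _ C1 AR)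
  (CD_mult _ _ _ _ S1 AT))).
  intros x y H; rewrite (at_polar (xi A1) x y H); destruct (HM' x y H) as [F1 [F2 [F3 F4]]];
    symmetry; exact F1.
- refine (CD_ext off 2 _ _ open_off _ (CD_plus _ _ _ _ (CD_mult _ _ _ _ S1 AR)
  (CD_mult _ _ _ _ C1 AT))).
  intros x y H; rewrite (at_polar (xi A2) x y H); destruct (HM' x y H) as [F1 [F2 [F3 F4]]];
    symmetry; exact F2.
- refine (CD_ext off 2 _ _ open_off _ (CD_minus _ _ _ _ (CD_mult _ _ _ _ Cn SG)
  (CD_mult _ _ _ _ Sn TA))).
  intros x y H; rewrite (at_polar (xi P1) x y H); destruct (HM' x y H) as [F1 [F2 [F3 F4]]];
    symmetry; exact F3.
- refine (CD_ext off 2 _ _ open_off _ (CD_plus _ _ _ _ (CD_mult _ _ _ _ Sn SG)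
  (CD_mult _ _ _ _ Cn TA))).
  intros x y H; rewrite (at_polar (xi P2) x y H); destruct (HM' x y H) as [F1 [F2 [F3 F4]]];
    symmetry; exact F4.
Qed.

(** The angular factors are kept because for [k = 0] and [(a, b) = (1, 0)] or [(0, 1)] one of them
    vanishes identically, and only the equations carrying the other one remain. *)
Lemma mode_solves n lambda f beta w2 a b k e g u h xi :
  vortex_profiles n lambda f beta -> is_mode n a b k e g u h xi ->
  CR 2 e -> CR 2 g -> CR 2 u -> CR 2 h ->
  (background_gauge (vortex n f beta) xi /\ eigen_eq n lambda f beta w2 xi <->
   forall r t, 0 < r ->
     Sin a b k t * (Kg f k e g h r - w2 * g r) = 0 /\
     Cos a b k t * (Ke n f beta k e g u r - w2 * e r) = 0 /\
     Cos a b k t * (Ku n lambda f beta k e u h r - w2 * u r) = 0 /\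
     Sin a b k t * (Kh n lambda f beta k g u h r - w2 * h r) = 0 /\
     Sin a b k t * Kc f k e g h r = 0).
Proof.
intros Hv HM He Hg Hu Hh.
assert (HC := CD_mode n a b k e g u h xi HM He Hg Hu Hh).
assert (TC := CD_Cos half 2 a b k); assert (TS := CD_Sin half 2 a b k).
assert (H1 := CD_sep 2 (fun t => - Sin a b k t) g (CD_opp _ _ _ TS) Hg).
assert (H2 := CD_sep 2 (fun t => - Cos a b k t) e (CD_opp _ _ _ TC) He).
assert (H3 := CD_sep 2 (fun t => Cos a b k t) u TC Hu).
assert (H4 := CD_sep 2 (fun t => - Sin a b k t) h (CD_opp _ _ _ TS) Hh).
rewrite (eigen_frame n lambda f beta w2 xi _ _ _ _ Hv H1 H2 H3 H4 HC HM).
rewrite (gauge_iff n lambda f beta xi _ _ _ _ Hv H1 H2 H3 H4 HC HM).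
split.
- intros [HG HE] r t Hr.
  destruct (mode_eqs n lambda f beta a b k e g u h r t He Hg Hu Hh Hr) as [Q1 [Q2 [Q3 [Q4 Q5]]]].
  specialize (HG r t Hr); destruct (HE r t Hr) as [E1 [E2 [E3 E4]]].
  rewrite Q1 in E1; rewrite Q2 in E2; rewrite Q3 in E3; rewrite Q4 in E4; rewrite Q5 in HG.
  repeat split; lra.
- intros H; split; intros r t Hr;
  destruct (mode_eqs n lambda f beta a b k e g u h r t He Hg Hu Hh Hr) as [Q1 [Q2 [Q3 [Q4 Q5]]]];
  destruct (H r t Hr) as [E1 [E2 [E3 [E4 E5]]]].
  + rewrite Q5; lra.
  + rewrite Q1, Q2, Q3, Q4; repeat split; lra.
Qed.

Lemma mode_profiles n a b k e g u h xi r t : is_mode n a b k e g u h xi -> 0 < r ->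
  Sin a b k t * g r = - (cos t * pol (xi A1) r t + sin t * pol (xi A2) r t) /\
  Cos a b k t * e r = - (- sin t * pol (xi A1) r t + cos t * pol (xi A2) r t) /\
  Cos a b k t * u r = cos (INR n * t) * pol (xi P1) r t + sin (INR n * t) * pol (xi P2) r t /\
  Sin a b k t * h r = - (- sin (INR n * t) * pol (xi P1) r t + cos (INR n * t) * pol (xi P2) r t).
Proof.
intros HM Hr; destruct (HM r t Hr) as [-> [-> [-> ->]]].
repeat split; ring [(cos_sq t) (cos_sq (INR n * t))].
Qed.

(** On a ray where the angular factor is one, the profile is a fixed linear combination of the field
    components and inherits their smoothness. *)
Lemma mode_CR_Cos n a b k e g u h xi t : is_mode n a b k e g u h xi ->
  (forall c, CD off 2 (xi c)) ->
  Cos a b k t = 1 -> CR 2 e /\ CR 2 u.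
Proof.
intros HM HC Ht.
assert (Hp : forall c, CR 2 (fun r => pol (xi c) r t)).
{ intros c; apply (CR_of_CD 2 (pol (xi c))), CD_pol, HC. }
split.
- apply CR_ext with (fun r => - (- sin t * pol (xi A1) r t + cos t * pol (xi A2) r t)).
  + intros r Hr; rewrite <- (proj1 (proj2 (mode_profiles _ _ _ _ _ _ _ _ _ r t HM Hr))), Ht; ring.
  + apply CR_opp, CR_plus; apply CR_scal, Hp.
- apply CR_ext with (fun r => cos (INR n * t) * pol (xi P1) r t + sin (INR n * t) * pol (xi P2) r
  t).
  + intros r Hr; rewrite <- (proj1 (proj2 (proj2 (mode_profiles _ _ _ _ _ _ _ _ _ r t HM Hr)))), Ht;
    ring.
  + apply CR_plus; apply CR_scal, Hp.
Qed.

Lemma mode_CR_Sin n a b k e g u h xi t : is_mode n a b k e g u h xi ->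
  (forall c, CD off 2 (xi c)) ->
  Sin a b k t = 1 -> CR 2 g /\ CR 2 h.
Proof.
intros HM HC Ht.
assert (Hp : forall c, CR 2 (fun r => pol (xi c) r t)).
{ intros c; apply (CR_of_CD 2 (pol (xi c))), CD_pol, HC. }
split.
- apply CR_ext with (fun r => - (cos t * pol (xi A1) r t + sin t * pol (xi A2) r t)).
  + intros r Hr; rewrite <- (proj1 (mode_profiles _ _ _ _ _ _ _ _ _ r t HM Hr)), Ht; ring.
  + apply CR_opp, CR_plus; apply CR_scal, Hp.
- apply CR_ext with (fun r => - (- sin (INR n * t) * pol (xi P1) r t + cos (INR n * t) * pol (xi P2)
  r t)).
  + intros r Hr; rewrite <- (proj2 (proj2 (proj2 (mode_profiles _ _ _ _ _ _ _ _ _ r t HM Hr)))), Ht;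
    ring.
  + apply CR_opp, CR_plus; apply CR_scal, Hp.
Qed.

Lemma derrick_is_mode n vt ut :
  is_mode n 1 0 0 vt (fun _ => 0) ut (fun _ => 0) (derrick n vt ut).
Proof.
intros r t Hr; unfold derrick, polar_field, mkfield; rewrite !of_polar_pol by trivial.
destruct (cos_sin_ang 1 r t Hr) as [E1 E2]; simpl INR in E1, E2; rewrite !Rmult_1_l in E1, E2.
destruct (cos_sin_ang n r t Hr) as [E3 E4]; rewrite E1, E2, E3, E4.
unfold Cos, Sin; replace (INR 0 * t) with 0 by (simpl; ring); rewrite cos_0, sin_0; repeat split;
  ring.
Qed.

Lemma odd_monopole_is_mode n g h :
  is_mode n 0 1 0 (fun _ => 0) g (fun _ => 0) h (odd_monopole n g h).
Proof.
intros r t Hr; unfold odd_monopole, polar_field, mkfield; rewrite !of_polar_pol by trivial.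
destruct (cos_sin_ang 1 r t Hr) as [E1 E2]; simpl INR in E1, E2; rewrite !Rmult_1_l in E1, E2.
destruct (cos_sin_ang n r t Hr) as [E3 E4]; rewrite E1, E2, E3, E4.
unfold Cos, Sin; replace (INR 0 * t) with 0 by (simpl; ring); rewrite cos_0, sin_0; repeat split;
  ring.
Qed.

Definition ev (f v w : R -> R) (r : R) : R := Derive v r - r * f r * w r.

Lemma multipolar_is_mode n f k v u w :
  is_mode n 1 0 k (ev f v w) (fun r => INR k * v r / r) u (fun r => INR k * w r)
    (multipolar n f k v u w).
Proof.
intros r t Hr; unfold multipolar, multipolar_gen, polar_field, mkfield;
  rewrite !of_polar_pol by trivial.
destruct (cos_sin_ang 1 r t Hr) as [E1 E2]; simpl INR in E1, E2; rewrite !Rmult_1_l in E1, E2.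
destruct (cos_sin_ang n r t Hr) as [E3 E4], (cos_sin_ang k r t Hr) as [E5 E6].
rewrite E1, E2, E3, E4, E5, E6.
unfold Cos, Sin, ev; repeat split; ring.
Qed.

Lemma partner_is_mode n f k v u w :
  is_mode n 0 1 k (ev f v w) (fun r => INR k * v r / r) u (fun r => INR k * w r)
    (multipolar_partner n f k v u w).
Proof.
intros r t Hr; unfold multipolar_partner, multipolar_gen, polar_field, mkfield;
  rewrite !of_polar_pol by trivial.
destruct (cos_sin_ang 1 r t Hr) as [E1 E2]; simpl INR in E1, E2; rewrite !Rmult_1_l in E1, E2.
destruct (cos_sin_ang n r t Hr) as [E3 E4], (cos_sin_ang k r t Hr) as [E5 E6].
rewrite E1, E2, E3, E4, E5, E6.
unfold Cos, Sin, ev; repeat split; ring.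
Qed.

(** * The matrix operator and the system of radial equations *)

Lemma CR_SS n y z : twice_derivable y -> (forall r, 0 < r -> Derive_n y 2 r = z r) -> CR n z ->
  CR (S (S n)) y.
Proof.
intros Hy E Hz; apply CR_S; [intros r Hr; apply (Hy r Hr)|].
apply CR_S; [intros r Hr; apply (Hy r Hr)|].
apply CR_ext with (2 := Hz); intros r Hr; rewrite <- E; trivial.
Qed.

Ltac CR_tac := repeat first [apply CR_minus|apply CR_plus|apply CR_opp|apply CR_mult|apply
  CR_pow|apply CR_const|apply CR_id|apply CR_inv|apply CR_div|assumption].

Lemma triple_eq (a b c a' b' c' : R) : (a, b, c) = (a', b', c') -> a = a' /\ b = b' /\ c = c'.
Proof. intros H; inversion H; auto. Qed.

Section Radial.

Variables (n : nat) (lambda : R) (f beta : R -> R).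
Hypothesis Hv : vortex_profiles n lambda f beta.

Lemma f_ode r : 0 < r -> Derive_n f 2 r = - Derive f r / r
       + INR n ^ 2 / r ^ 2 * (1 - beta r) ^ 2 * f r
       - lambda / 2 * (1 - f r ^ 2) * f r.
Proof.
destruct Hv as [_ [_ [E _]]]; intros Hr; specialize (E r Hr); unfold Rdiv in *; lra.
Qed.

Lemma CR_df : CR 1 (Derive f).
Proof. apply CR_derives, (CR_f n lambda f beta Hv). Qed.

Lemma ev_derive v w r : CR 2 v -> CR 1 w -> 0 < r ->
  Derive (ev f v w) r = Derive_n v 2 r - (f r + r * Derive f r) * w r - r * f r * Derive w r.
Proof.
intros Hv2 Hw Hr.
assert (Cf := CR_f n lambda f beta Hv).
assert (D1 := CR_ex_derive 1 f r Cf Hr).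
assert (D2 := CR_ex_derive 0 w r Hw Hr).
assert (D3 := CR_ex_derive 0 _ r (proj2 (CR_derives 1 v Hv2)) Hr).
apply is_derive_unique; unfold ev; auto_derive; [repeat split; trivial|].
change (Derive_n v 2 r) with (Derive (fun x => Derive v x) r).
change (Derive (fun x => f x) r) with (Derive f r);
  change (Derive (fun x => w x) r) with (Derive w r); ring.
Qed.

(** The gauge condition is built into [ev], and the equations of [g], [u], [h] are the three rows,
    the first multiplied by [k / r] and the last by [k]. The equation of [e] is the nontrivial one:
    it comes from differentiating the first row and inserting the third row and the profile equation
    of [f]. *)
Lemma radial_from_Hbar w2 k v u w : 
  twice_derivable v -> twice_derivable u -> twice_derivable w ->
  (forall r, 0 < r -> Hbar n lambda f beta k v u w r = (w2 * v r, w2 * u r, w2 * w r)) ->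
  (CR 2 (ev f v w) /\ CR 2 v /\ CR 2 u /\ CR 2 w) /\
  forall r, 0 < r ->
    Kg f k (ev f v w) (fun r => INR k * v r / r) (fun r => INR k * w r) r = w2 * (INR k * v r / r)
      /\
    Ke n f beta k (ev f v w) (fun r => INR k * v r / r) u r = w2 * ev f v w r /\
    Ku n lambda f beta k (ev f v w) u (fun r => INR k * w r) r = w2 * u r /\
    Kh n lambda f beta k (fun r => INR k * v r / r) u (fun r => INR k * w r) r = w2 * (INR k * w r)
      /\
    Kc f k (ev f v w) (fun r => INR k * v r / r) (fun r => INR k * w r) r = 0.
Proof.
intros Tv Tu Tw HH.
assert (Cv := twice_derivable_CR v Tv); assert (Cu := twice_derivable_CR u Tu).
assert (Cw := twice_derivable_CR w Tw).
assert (Cf := CR_f n lambda f beta Hv); assert (Cdf := CR_df).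
assert (Cb := CR_beta n lambda f beta Hv).
assert (Cf1 := CR_pred _ _ Cf); assert (Cf0 := CR_pred _ _ Cf1).
assert (Cdf0 := CR_pred _ _ Cdf); assert (Cb0 := CR_pred _ _ Cb).
assert (Cv0 := CR_pred _ _ Cv); assert (Cu0 := CR_pred _ _ Cu); assert (Cw0 := CR_pred _ _ Cw).
destruct (CR_derives 0 v Cv) as [_ Cdv]; destruct (CR_derives 0 u Cu) as [_ Cdu];
destruct (CR_derives 0 w Cw) as [_ Cdw].
assert (E : forall r, 0 < r ->
  Derive_n v 2 r = - (Derive v r * / r) + INR k ^ 2 * (/ r) ^ 2 * v r + f r ^ 2 * v r
     + 2 * (f r + r * Derive f r) * w r - w2 * v r /\
  Derive_n u 2 r = 2 * INR n * (1 - beta r) * f r * / r * Derive v r - Derive u r * / r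
     + INR k ^ 2 * (/ r) ^ 2 * u r
     + (INR n ^ 2 * (1 - beta r) ^ 2 * (/ r) ^ 2 + 3 * lambda / 2 * f r ^ 2 - lambda / 2) * u r
      - 2 * INR n * (1 - beta r) * (INR k ^ 2 + r ^ 2 * f r ^ 2) * (/ r) ^ 2 * w r - w2 * u r /\
  Derive_n w 2 r = 2 * Derive f r * / r * v r
      - 2 * INR n * (1 - beta r) * (/ r) ^ 2 * u r
      - Derive w r * / r + INR k ^ 2 * (/ r) ^ 2 * w r + (INR n ^ 2 * (1 - beta r) ^ 2 * (/ r) ^ 2
                     + f r ^ 2 + lambda / 2 * f r ^ 2 - lambda / 2) * w r - w2 * w r).
{ intros r Hr; specialize (HH r Hr); unfold Hbar, Lop in HH; apply triple_eq in HH;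
  destruct HH as [H1 [H2 H3]].
  rewrite !pow_inv; unfold Rdiv in *; repeat split; lra. }
assert (Cv2 : CR 2 v).
{ eapply CR_SS; [exact Tv|intros r Hr; apply (E r Hr)|]; CR_tac. }
assert (Cu2 : CR 2 u).
{ eapply CR_SS; [exact Tu|intros r Hr; apply (E r Hr)|]; CR_tac. }
assert (Cw2 : CR 2 w).
{ eapply CR_SS; [exact Tw|intros r Hr; apply (E r Hr)|]; CR_tac. }
assert (Cdv1 : CR 1 (Derive v)) by apply CR_derives, Cv2.
(* A second pass through the first row, whose right-hand side is now of class C^1. Three derivatives
   of [v] are what class C^2 of [ev] costs. *)
assert (Cv3 : CR 3 v).
{ eapply CR_SS; [exact Tv|intros r Hr; apply (E r Hr)|]; CR_tac. }
assert (Ce : CR 2 (ev f v w)).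
{ unfold ev; destruct (CR_derives 2 v Cv3) as [_ C]; CR_tac. }
split; [auto|].
intros r Hr.
assert (Df := CR_ex_derive 0 f r Cf1 Hr); assert (Ddf := CR_ex_derive 0 _ r Cdf Hr).
assert (Dv := CR_ex_derive 0 v r Cv Hr); assert (Ddv := CR_ex_derive 0 _ r Cdv1 Hr).
assert (Dw := CR_ex_derive 0 w r Cw Hr).
assert (Ddw := CR_ex_derive 0 _ r (proj2 (CR_derives 1 w Cw2)) Hr).
assert (Ef := f_ode r Hr).
destruct (E r Hr) as [E1 [E2 E3]].
assert (F1 : forall r, 0 < r -> Derive (fun r => INR k * v r / r) r = INR k *
  (Derive v r / r - v r / r ^ 2)).
{ intros s Hs; apply is_derive_unique; auto_derive.
  - split; [apply (CR_ex_derive 0 v s Cv Hs)|split; [lra|trivial]].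
  - change (Derive (fun x => v x) s) with (Derive v s); field; lra. }
assert (F2 : Derive_n (fun r => INR k * v r / r) 2 r
  = INR k * (Derive_n v 2 r / r - 2 * Derive v r / r ^ 2 + 2 * v r / r ^ 3)).
{ change (Derive_n (fun r => INR k * v r / r) 2 r)
  with (Derive (fun r => Derive (fun r => INR k * v r / r) r) r).
  transitivity (Derive (fun r => INR k * (Derive v r / r - v r / r ^ 2)) r).
  - apply Derive_ext_loc; generalize (locally_pos r Hr); apply filter_imp; exact F1.
  - apply is_derive_unique; auto_derive; [repeat split; trivial; nra|].
    change (Derive_n v 2 r) with (Derive (fun x => Derive v x) r).
    change (Derive (fun x => v x) r) with (Derive v r).
    field; lra. }
assert (F3 : Derive (fun r => INR k * w r) r = INR k * Derive w r) by apply Derive_scal.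
assert (F4 : Derive_n (fun r => INR k * w r) 2 r = INR k * Derive_n w 2 r) by apply Derive_n_scal_l.
assert (F5 := ev_derive v w r Cv2 Cw Hr).
assert (F6 : Derive_n (ev f v w) 2 r =
  - Derive_n v 2 r / r + Derive v r / r ^ 2 + INR k ^ 2 / r ^ 2 * Derive v r - 2 * INR k ^ 2 / r ^ 3
    * v r
  + 2 * f r * Derive f r * v r + f r ^ 2 * Derive v r + 2 * (2 * Derive f r + r * Derive_n f 2 r) *
    w r
  + 2 * (f r + r * Derive f r) * Derive w r - w2 * Derive v r
  - 2 * Derive f r * w r - 2 * f r * Derive w r - r * Derive_n f 2 r * w r - 2 * r * Derive f r *
    Derive w r
  - r * f r * Derive_n w 2 r).
{ change (Derive_n (ev f v w) 2 r) with (Derive (fun r => Derive (ev f v w) r) r).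
  (* The second derivative of [v] is replaced by its value from the first row before the next
     differentiation, so that no third derivative has to be named. *)
  transitivity (Derive (fun r => - (Derive v r * / r) + INR k ^ 2 * (/ r) ^ 2 * v r + f r ^ 2 * v r
     + 2 * (f r + r * Derive f r) * w r - w2 * v r - (f r + r * Derive f r) * w r - r * f r * Derive
       w r) r).
  - apply Derive_ext_loc; generalize (locally_pos r Hr); apply filter_imp; intros s Hs.
    rewrite (ev_derive v w s Cv2 Cw Hs), (proj1 (E s Hs)); reflexivity.
  - apply is_derive_unique; auto_derive; [repeat split; trivial; nra|].
    change (Derive_n v 2 r) with (Derive (fun x => Derive v x) r).
    change (Derive_n w 2 r) with (Derive (fun x => Derive w x) r).
    change (Derive_n f 2 r) with (Derive (fun x => Derive f x) r).
    change (Derive (fun x => v x) r) with (Derive v r).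
    change (Derive (fun x => w x) r) with (Derive w r).
    change (Derive (fun x => f x) r) with (Derive f r).
    field; lra. }
unfold Kg, Ke, Ku, Kh, Kc, Lop; rewrite F1, F2, F3, F4, F5, F6 by trivial.
unfold ev; rewrite ?E1, ?E2, ?E3, ?Ef.
repeat split; field; lra.
Qed.

(** The rows are recovered by dividing by [k / r] and by [k], which is where [k >= 1] enters. *)
Lemma Hbar_from_radial w2 k v u w : (1 <= k)%nat -> CR 2 v -> CR 1 w ->
  (forall r, 0 < r ->
    Kg f k (ev f v w) (fun r => INR k * v r / r) (fun r => INR k * w r) r = w2 * (INR k * v r / r)
      /\
    Ku n lambda f beta k (ev f v w) u (fun r => INR k * w r) r = w2 * u r /\
    Kh n lambda f beta k (fun r => INR k * v r / r) u (fun r => INR k * w r) r = w2 * (INR k * w r))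
      ->
  (forall r, 0 < r -> Hbar n lambda f beta k v u w r = (w2 * v r, w2 * u r, w2 * w r)).
Proof.
intros Hk Cv2 Cw HH r Hr.
assert (Hk' : INR k <> 0) by (apply not_0_INR; lia).
assert (Cv := CR_pred _ _ Cv2).
assert (Cdv1 : CR 1 (Derive v)) by apply CR_derives, Cv2.
assert (Dv := CR_ex_derive 0 v r Cv Hr); assert (Ddv := CR_ex_derive 0 _ r Cdv1 Hr).
destruct (HH r Hr) as [H1 [H2 H3]].
assert (F1 : forall r, 0 < r -> Derive (fun r => INR k * v r / r) r = INR k *
  (Derive v r / r - v r / r ^ 2)).
{ intros s Hs; apply is_derive_unique; auto_derive.
  - split; [apply (CR_ex_derive 0 v s Cv Hs)|split; [lra|trivial]].
  - change (Derive (fun x => v x) s) with (Derive v s); field; lra. }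
assert (F2 : Derive_n (fun r => INR k * v r / r) 2 r
  = INR k * (Derive_n v 2 r / r - 2 * Derive v r / r ^ 2 + 2 * v r / r ^ 3)).
{ change (Derive_n (fun r => INR k * v r / r) 2 r)
  with (Derive (fun r => Derive (fun r => INR k * v r / r) r) r).
  transitivity (Derive (fun r => INR k * (Derive v r / r - v r / r ^ 2)) r).
  - apply Derive_ext_loc; generalize (locally_pos r Hr); apply filter_imp; exact F1.
  - apply is_derive_unique; auto_derive; [repeat split; trivial; nra|].
    change (Derive_n v 2 r) with (Derive (fun x => Derive v x) r).
    change (Derive (fun x => v x) r) with (Derive v r).
    field; lra. }
assert (F3 : Derive (fun r => INR k * w r) r = INR k * Derive w r) by apply Derive_scal.
assert (F4 : Derive_n (fun r => INR k * w r) 2 r = INR k * Derive_n w 2 r) by apply Derive_n_scal_l.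
unfold Kg, Ku, Kh, Lop in *; rewrite F1, F2, ?F3, ?F4 in * by trivial; unfold ev in *.
unfold Hbar, Lop; f_equal; [f_equal|].
- apply (Rmult_eq_reg_l (INR k / r)).
  2:{ apply Rgt_not_eq, Rdiv_lt_0_compat; trivial; apply lt_0_INR; lia. }
  transitivity (w2 * (INR k * v r / r)); [rewrite <- H1|]; field; lra.
- rewrite <- H2; field; lra.
- apply (Rmult_eq_reg_l (INR k)); trivial.
  transitivity (w2 * (INR k * w r)); [rewrite <- H3|]; field; lra.
Qed.

End Radial.

(** * Limits at the origin *)

Lemma lim_right_iff y l : filterlim y (at_right 0) (locally l) <->
  forall eps, 0 < eps -> exists d, 0 < d /\ forall r, 0 < r < d -> Rabs (y r - l) < eps.
Proof.
split.
- intros H eps He.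
  destruct (H (ball l (mkposreal eps He)) (locally_ball l (mkposreal eps He))) as [d Hd].
  exists d; split; [apply cond_pos|]; intros r Hr; apply (Hd r); [|apply Hr].
  change (Rabs (r - 0) < d); rewrite Rabs_pos_eq; lra.
- intros H P [eps He]; destruct (H eps (cond_pos eps)) as [d [Hd H']].
  exists (mkposreal d Hd); intros r Hr Hr0; apply He, H'.
  change (Rabs (r - 0) < d) in Hr; rewrite Rabs_pos_eq in Hr; lra.
Qed.

(** The bound is uniform in the angle: this characterises a limit in the plane, whereas limits along
    all rays would not. *)
Definition polar_lim (F : R -> R -> R) (l : R) : Prop :=
  forall eps, 0 < eps -> exists d, 0 < d /\ forall r t, 0 < r < d -> Rabs (pol F r t - l) < eps.

Lemma polar_lim_ray F l t : polar_lim F l -> filterlim (fun r => pol F r t) (at_right 0)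
  (locally l).
Proof.
intros H; apply lim_right_iff; intros eps He; destruct (H eps He) as [d [Hd H']]; exists d; auto.
Qed.

Lemma polar_lim_iff F l :
  filterlim (fun p : R * R => F (fst p) (snd p)) (locally' (0, 0)) (locally l) <-> polar_lim F l.
Proof.
split.
- intros H eps He.
  destruct (H (ball l (mkposreal eps He)) (locally_ball l (mkposreal eps He))) as [d Hd].
  exists d; split; [apply cond_pos|]; intros r t Hr.
  apply (Hd (r * cos t, r * sin t)).
  + assert (Bc := COS_bound t); assert (Bs := SIN_bound t).
    split; [change (Rabs (r * cos t - 0) < d)|change (Rabs (r * sin t - 0) < d)];
      apply Rabs_lt_between; nra.
  + apply off_polar, Hr.
- intros H P [eps He]; destruct (H eps (cond_pos eps)) as [d [Hd H']].
  assert (Hd2 : 0 < d / 2) by lra.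
  exists (mkposreal (d / 2) Hd2); intros [x y] [Hx Hy] H0; apply He.
  change (Rabs (x - 0) < d / 2) in Hx; change (Rabs (y - 0) < d / 2) in Hy.
  assert (H0' := off_rad x y H0).
  change (Rabs (F x y - l) < eps); rewrite (at_polar F x y H0); apply H'; split; trivial.
  rewrite Rminus_0_r in Hx, Hy; apply Rabs_lt_between in Hx; apply Rabs_lt_between in Hy.
  unfold rad in *; rewrite <- (sqrt_pow2 d) by lra; apply sqrt_lt_1_alt.
  split; [apply Rplus_le_le_0_compat; apply pow2_ge_0|nra].
Qed.

Lemma regular_iff xi : regular_at_origin xi <-> forall c, exists l, polar_lim (xi c) l.
Proof.
split; intros H c; destruct (H c) as [l Hl]; exists l; apply polar_lim_iff; exact Hl.
Qed.

Lemma polar_lim_comb F G H l m a b : polar_lim G l -> polar_lim H m ->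
  forall al, (forall r t, 0 < r -> pol F r t = a * pol G r (t + al) + b * pol H r (t + al)) ->
  polar_lim F (a * l + b * m).
Proof.
intros HG HH al E eps He.
set (c := Rabs a + Rabs b + 1).
assert (Hc : 0 < c) by (unfold c; assert (H1 := Rabs_pos a); assert (H2 := Rabs_pos b); lra).
assert (He' : 0 < eps / c) by (apply Rdiv_lt_0_compat; trivial).
destruct (HG _ He') as [d [Hd H1]], (HH _ He') as [d' [Hd' H2]].
exists (Rmin d d'); split; [apply Rmin_glb_lt; trivial|]; intros r t Hr.
assert (M1 := Rmin_l d d'); assert (M2 := Rmin_r d d').
rewrite E by lra.
specialize (H1 r (t + al) ltac:(lra)); specialize (H2 r (t + al) ltac:(lra)).
replace (_ - _) with (a * (pol G r (t + al) - l) + b * (pol H r (t + al) - m)) by ring.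
eapply Rle_lt_trans; [apply Rabs_triang|]; rewrite !Rabs_mult.
apply Rle_lt_trans with (Rabs a * (eps / c) + Rabs b * (eps / c)).
- assert (P1 := Rabs_pos a); assert (P2 := Rabs_pos b); nra.
- replace eps with (c * (eps / c)) at 3 by (field; lra). unfold c at 3; nra.
Qed.

(** Turning the plane by [al] and the scalar phase by [n al] is a symmetry of the vortex; it maps
    one angular parity of a mode to the other. *)
Lemma mode_rotate n a b a' b' k e g u h xi xi' al :
  is_mode n a b k e g u h xi -> is_mode n a' b' k e g u h xi' ->
  (forall t, Cos a' b' k t = Cos a b k (t + al) /\ Sin a' b' k t = Sin a b k (t + al)) ->
  regular_at_origin xi -> regular_at_origin xi'.
Proof.
intros HM HM' HT HR; apply regular_iff; assert (HR' := proj1 (regular_iff xi) HR).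
destruct (HR' A1) as [l1 L1], (HR' A2) as [l2 L2], (HR' P1) as [l3 L3], (HR' P2) as [l4 L4].
assert (K : forall r t, 0 < r ->
  pol (xi' A1) r t = cos al * pol (xi A1) r (t + al) + sin al * pol (xi A2) r (t + al) /\
  pol (xi' A2) r t = - sin al * pol (xi A1) r (t + al) + cos al * pol (xi A2) r (t + al) /\
  pol (xi' P1) r t = cos (INR n * al) * pol (xi P1) r (t + al) + sin (INR n * al) * pol (xi P2) r
    (t + al) /\
  pol (xi' P2) r t = - sin (INR n * al) * pol (xi P1) r (t + al) + cos (INR n * al) * pol (xi P2) r
    (t + al)).
{ intros r t Hr; destruct (HM r (t + al) Hr) as [-> [-> [-> ->]]].
  destruct (HM' r t Hr) as [-> [-> [-> ->]]]; destruct (HT t) as [-> ->].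
  set (C := Cos a b k (t + al)); set (S := Sin a b k (t + al)).
  rewrite (Rmult_plus_distr_l (INR n) t al), !cos_plus, !sin_plus.
  assert (E := pow_sin_cos al); assert (E' := pow_sin_cos (INR n * al)).
  assert (E1 : cos al ^ 2 = 1 - sin al ^ 2) by lra.
  assert (E2 : cos (INR n * al) ^ 2 = 1 - sin (INR n * al) ^ 2) by lra.
  repeat split; ring [E1 E2]. }
intros c; destruct c; eexists;
  [apply (polar_lim_comb _ _ _ _ _ (cos al) (sin al) L1 L2 al)
  |apply (polar_lim_comb _ _ _ _ _ (- sin al) (cos al) L1 L2 al)
  |apply (polar_lim_comb _ _ _ _ _ (cos (INR n * al)) (sin (INR n * al)) L3 L4 al)
  |apply (polar_lim_comb _ _ _ _ _ (- sin (INR n * al)) (cos (INR n * al)) L3 L4 al)];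
  intros r t Hr; apply (K r t Hr).
Qed.

Lemma Cos_Sin_bound a b k t :
  Rabs (Cos a b k t) <= Rabs a + Rabs b /\ Rabs (Sin a b k t) <= Rabs a + Rabs b.
Proof.
assert (Bc := COS_bound (INR k * t)); assert (Bs := SIN_bound (INR k * t)).
apply Rabs_le_between in Bc; apply Rabs_le_between in Bs.
assert (P1 := Rabs_pos a); assert (P2 := Rabs_pos b).
unfold Cos, Sin, Rminus; split; eapply Rle_trans; try apply Rabs_triang;
  rewrite ?Rabs_Ropp, !Rabs_mult; nra.
Qed.

(* The constant [E] stands for the value at the origin of a constant vector field, which
   has angular momentum one; likewise [U] for a constant scalar, at [k = n]. *)
Lemma mode_regular n a b k e g u h xi E U :
  is_mode n a b k e g u h xi -> (k = 1%nat \/ E = 0) -> (k = n \/ U = 0) ->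
  filterlim e (at_right 0) (locally E) -> filterlim g (at_right 0) (locally E) ->
  filterlim u (at_right 0) (locally U) -> filterlim h (at_right 0) (locally U) ->
  regular_at_origin xi.
Proof.
intros HM HE HU Le Lg Lu Lh; apply regular_iff.
assert (Gen : forall F y z L l (p q : R -> R), filterlim y (at_right 0) (locally L) ->
  filterlim z (at_right 0) (locally L) -> (forall t, Rabs (p t) <= 1) ->
    (forall t, Rabs (q t) <= 1) ->
  (forall t, (p t * Cos a b k t + q t * Sin a b k t) * L = l) ->
  (forall r t, 0 < r -> pol F r t = p t * Cos a b k t * y r + q t * Sin a b k t * z r) ->
  polar_lim F l).
{ intros F y z L l p q Ly Lz Hp Hq Hl HF eps He.
  set (c := 2 * (Rabs a + Rabs b) + 1).
  assert (Pa := Rabs_pos a); assert (Pb := Rabs_pos b).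
  assert (Hc : 0 < c) by (unfold c; lra).
  assert (He' : 0 < eps / c) by (apply Rdiv_lt_0_compat; trivial).
  destruct (proj1 (lim_right_iff _ _) Ly _ He') as [d [Hd H1]].
  destruct (proj1 (lim_right_iff _ _) Lz _ He') as [d' [Hd' H2]].
  exists (Rmin d d'); split; [apply Rmin_glb_lt; trivial|]; intros r t Hr.
  assert (M1 := Rmin_l d d'); assert (M2 := Rmin_r d d').
  rewrite HF by lra.
  specialize (H1 r ltac:(lra)); specialize (H2 r ltac:(lra)).
  rewrite <- (Hl t).
  replace (_ - _) with (p t * Cos a b k t * (y r - L) + q t * Sin a b k t * (z r - L)) by ring.
  eapply Rle_lt_trans; [apply Rabs_triang|]; rewrite !Rabs_mult.
  destruct (Cos_Sin_bound a b k t) as [B1 B2]; specialize (Hp t); specialize (Hq t).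
  assert (Q : forall x1 x2 x3, 0 <= x1 <= 1 -> 0 <= x2 <= Rabs a + Rabs b -> 0 <= x3 < eps / c ->
     x1 * x2 * x3 <= (Rabs a + Rabs b) * (eps / c)).
  { intros x1 x2 x3 X1 X2 X3; apply Rmult_le_compat; try lra; nra. }
  apply Rle_lt_trans with ((Rabs a + Rabs b) * (eps / c) + (Rabs a + Rabs b) * (eps / c)).
  - apply Rplus_le_compat; apply Q; split; trivial; apply Rabs_pos.
  - replace eps with (c * (eps / c)) at 3 by (field; lra). unfold c at 3; nra. }
assert (Bs : forall m t, Rabs (sin (m * t)) <= 1)
  by (intros; apply Rabs_le_between, SIN_bound).
assert (Bc : forall m t, Rabs (cos (m * t)) <= 1)
  by (intros; apply Rabs_le_between, COS_bound).
assert (Bs' : forall m t, Rabs (- sin (m * t)) <= 1) by (intros; rewrite Rabs_Ropp; auto).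
assert (Bc' : forall m t, Rabs (- cos (m * t)) <= 1) by (intros; rewrite Rabs_Ropp; auto).
assert (T : forall m t, cos (m * t) ^ 2 = 1 - sin (m * t) ^ 2)
  by (intros m t; assert (X := pow_sin_cos (m * t)); lra).
intros c; destruct c.
(* For [k = 1] the combination [sin t * Cos - cos t * Sin] is the constant [b], so equal limits of
   [e] and [g] give a value independent of the direction. The other three components work alike, the
   scalar ones at [k = n]. *)
- exists (b * E); apply (Gen _ e g E _ (fun t => sin (1 * t)) (fun t => - cos (1 * t)) Le Lg); auto.
  + intros t; destruct HE as [-> | ->]; [|ring]; f_equal; unfold Cos, Sin; simpl INR;
    ring [(T 1 t)].
  + intros r t Hr; rewrite !Rmult_1_l; rewrite (proj1 (HM r t Hr)); ring.
- exists (- a * E); apply (Gen _ e g E _ (fun t => - cos (1 * t)) (fun t => - sin (1 * t)) Le Lg);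
  auto.
  + intros t; destruct HE as [-> | ->]; [|ring]; f_equal; unfold Cos, Sin; simpl INR;
    ring [(T 1 t)].
  + intros r t Hr; rewrite !Rmult_1_l; rewrite (proj1 (proj2 (HM r t Hr))); ring.
- exists (a * U); apply (Gen _ u h U _ (fun t => cos (INR n * t)) (fun t => sin (INR n * t)) Lu Lh);
  auto.
  + intros t; destruct HU as [-> | ->]; [|ring]; f_equal; unfold Cos, Sin; ring [(T (INR n) t)].
  + intros r t Hr; rewrite (proj1 (proj2 (proj2 (HM r t Hr)))); ring.
- exists (b * U); apply (Gen _ u h U _ (fun t => sin (INR n * t)) (fun t => - cos (INR n * t)) Lu
  Lh); auto.
  + intros t; destruct HU as [-> | ->]; [|ring]; f_equal; unfold Cos, Sin; ring [(T (INR n) t)].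
  + intros r t Hr; rewrite (proj2 (proj2 (proj2 (HM r t Hr)))); ring.
Qed.

Lemma in_eigenspace_iff n lambda f beta w2 xi : in_eigenspace n lambda f beta w2 xi <->
  (forall c, CD off 2 (xi c)) /\ regular_at_origin xi /\
  (background_gauge (vortex n f beta) xi /\ eigen_eq n lambda f beta w2 xi).
Proof. unfold in_eigenspace; rewrite C2_iff; unfold eigen_eq; tauto. Qed.

Lemma mode_nonzero n a b k e g u h xi : is_mode n a b k e g u h xi ->
  (nonzero_field xi <-> exists r t, 0 < r /\
     (Sin a b k t * g r <> 0 \/ Cos a b k t * e r <> 0 \/
      Cos a b k t * u r <> 0 \/ Sin a b k t * h r <> 0)).
Proof.
intros HM; split.
- intros [c [x [y [Hxy Hc]]]].
  destruct (off_is_polar x y Hxy) as [r [t [Hr [-> ->]]]]; exists r, t; split; trivial.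
  destruct (Req_dec (Sin a b k t * g r) 0) as [Z1|]; [|tauto].
  destruct (Req_dec (Cos a b k t * e r) 0) as [Z2|]; [|tauto].
  destruct (Req_dec (Cos a b k t * u r) 0) as [Z3|]; [|tauto].
  destruct (Req_dec (Sin a b k t * h r) 0) as [Z4|]; [|tauto].
  exfalso; apply Hc; change (pol (xi c) r t = 0).
  destruct (HM r t Hr) as [E1 [E2 [E3 E4]]].
  replace (- Sin a b k t * g r) with (- (Sin a b k t * g r)) in * by ring.
  replace (- Sin a b k t * h r) with (- (Sin a b k t * h r)) in * by ring.
  replace (- Cos a b k t * e r) with (- (Cos a b k t * e r)) in * by ring.
  rewrite Z1, Z2, Z3, Z4 in *.
  destruct c; [rewrite E1|rewrite E2|rewrite E3|rewrite E4]; ring.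
- intros [r [t [Hr H]]].
  destruct (mode_profiles n a b k e g u h xi r t HM Hr) as [E1 [E2 [E3 E4]]].
  destruct (Req_dec (pol (xi A1) r t) 0) as [Z1|Z1].
  2:{ exists A1, (r * cos t), (r * sin t); split; [apply off_polar, Hr|exact Z1]. }
  destruct (Req_dec (pol (xi A2) r t) 0) as [Z2|Z2].
  2:{ exists A2, (r * cos t), (r * sin t); split; [apply off_polar, Hr|exact Z2]. }
  destruct (Req_dec (pol (xi P1) r t) 0) as [Z3|Z3].
  2:{ exists P1, (r * cos t), (r * sin t); split; [apply off_polar, Hr|exact Z3]. }
  destruct (Req_dec (pol (xi P2) r t) 0) as [Z4|Z4].
  2:{ exists P2, (r * cos t), (r * sin t); split; [apply off_polar, Hr|exact Z4]. }
  rewrite Z1, Z2, Z3, Z4 in *; exfalso; lra.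
Qed.

(** * Angular integrals and the norm of a mode *)

Ltac toR := match goal with |- @eq _ ?x ?y => change (@eq R x y) end.


Lemma sin_cos_2PI k : cos (INR k * (2 * PI)) = 1 /\ sin (INR k * (2 * PI)) = 0.
Proof.
replace (INR k * (2 * PI)) with (0 + 2 * INR k * PI) by ring.
rewrite cos_period, sin_period, cos_0, sin_0; auto.
Qed.

Lemma Cos_Sin_2PI a b k t :
  Cos a b k (t + 2 * PI) = Cos a b k t /\ Sin a b k (t + 2 * PI) = Sin a b k t.
Proof.
unfold Cos, Sin; destruct (sin_cos_2PI k) as [E1 E2].
rewrite Rmult_plus_distr_l, cos_plus, sin_plus, E1, E2; split; ring.
Qed.

Lemma Cos_Sin_ex_derive a b k t : ex_derive (Cos a b k) t /\ ex_derive (Sin a b k) t.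
Proof. split; eexists; [apply Cos_derive|apply Sin_derive]. Qed.

Lemma ex_RInt_of_derive (y : R -> R) (a b : R) : (forall t, ex_derive y t) -> ex_RInt y a b.
Proof.
intros H; apply (ex_RInt_continuous (V := R_CompleteNormedModule)); intros t _.
apply (ex_derive_continuous (V := R_NormedModule)), H.
Qed.

Lemma RInt_antiderivative (F y : R -> R) a b :
  (forall t, is_derive F t (y t)) -> (forall t, ex_derive y t) -> RInt y a b = F b - F a.
Proof.
intros HF Hy; apply is_RInt_unique.
apply (is_RInt_derive (V := R_CompleteNormedModule) F y); intros t _; trivial.
apply (ex_derive_continuous (V := R_NormedModule)), Hy.
Qed.

Lemma Cos_sq_ex a b k t : ex_derive (fun t => Cos a b k t ^ 2) t.
Proof. unfold Cos; auto_derive; trivial. Qed.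

Lemma Sin_sq_ex a b k t : ex_derive (fun t => Sin a b k t ^ 2) t.
Proof. unfold Sin; auto_derive; trivial. Qed.

Lemma RInt_Cos_sq a b k : (1 <= k)%nat ->
  RInt (fun t => Cos a b k t ^ 2) 0 (2 * PI) = PI * (a ^ 2 + b ^ 2) /\
  RInt (fun t => Sin a b k t ^ 2) 0 (2 * PI) = PI * (a ^ 2 + b ^ 2).
Proof.
intros Hk; assert (Hk' : INR k <> 0) by (apply not_0_INR; lia).
assert (HC : forall a b, RInt (fun t => Cos a b k t ^ 2) 0 (2 * PI) = PI * (a ^ 2 + b ^ 2)).
{ clear a b; intros a b.
  (* [Cos ^ 2 + Sin ^ 2] is the constant [a ^ 2 + b ^ 2], and [Cos ^ 2 - Sin ^ 2] is the derivative
     of [Sin * Cos / k]. *)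
  rewrite (RInt_antiderivative (fun t => (a ^ 2 + b ^ 2) * t / 2 + Sin a b k t * Cos a b k t /
    (2 * INR k))).
  - destruct (Cos_Sin_2PI a b k 0) as [E1 E2]; rewrite Rplus_0_l in E1, E2.
    rewrite E1, E2; toR; field; trivial.
  - intros t; unfold Sin, Cos; auto_derive; [trivial|].
    assert (E1 := cos_sq (INR k * t)); field_simplify_eq; [|trivial]; ring [E1].
  - apply Cos_sq_ex. }
split; [apply HC|].
rewrite Sin_as_Cos, HC; toR; ring.
Qed.

Definition density (xi : field) (r : R) : R :=
  RInt (fun t => pol (xi A1) r t ^ 2 + pol (xi A2) r t ^ 2 + pol (xi P1) r t ^ 2 + pol (xi P2) r t ^
    2)
    0 (2 * PI).

Lemma RInt_lin (f g : R -> R) a b p q : ex_RInt f a b -> ex_RInt g a b ->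
  RInt (fun t => p * f t + q * g t) a b = p * RInt f a b + q * RInt g a b.
Proof.
intros Hf Hg.
rewrite (RInt_plus (V := R_CompleteNormedModule) (fun t => p * f t) (fun t => q * g t)).
- apply (f_equal2 Rplus); apply (RInt_scal (V := R_CompleteNormedModule)); trivial.
- apply (ex_RInt_scal (V := R_NormedModule)); trivial.
- apply (ex_RInt_scal (V := R_NormedModule)); trivial.
Qed.

Lemma mode_density n a b k e g u h xi r : is_mode n a b k e g u h xi -> 0 < r ->
  density xi r = (e r ^ 2 + u r ^ 2) * RInt (fun t => Cos a b k t ^ 2) 0 (2 * PI)
    + (g r ^ 2 + h r ^ 2) * RInt (fun t => Sin a b k t ^ 2) 0 (2 * PI).
Proof.
intros HM Hr; unfold density; rewrite <- RInt_lin.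
- apply RInt_ext; intros t _; destruct (HM r t Hr) as [-> [-> [-> ->]]].
toR; ring [(cos_sq t) (cos_sq (INR n * t))].
- apply ex_RInt_of_derive; intros t; apply Cos_sq_ex.
- apply ex_RInt_of_derive; intros t; apply Sin_sq_ex.
Qed.

Lemma pos_prod : filter_prod (at_right 0) (Rbar_locally p_infty)
  (fun ab : R * R => 0 < fst ab /\ fst ab < snd ab).
Proof.
apply Filter_prod with (fun a => 0 < a < 1) (fun b => 1 < b).
- exists (mkposreal 1 Rlt_0_1); intros y Hy H0; split; trivial.
  change (Rabs (y - 0) < 1) in Hy; apply Rabs_lt_between in Hy; lra.
- exists 1; trivial.
- simpl; intros; lra.
Qed.

Lemma ex_RInt_gen_scale (y z : R -> R) c : c <> 0 -> (forall r, 0 < r -> y r = c * z r) ->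
  (ex_RInt_gen y (at_right 0) (Rbar_locally p_infty) <->
   ex_RInt_gen z (at_right 0) (Rbar_locally p_infty)).
Proof.
assert (K : forall (y z : R -> R) c, (forall r, 0 < r -> y r = c * z r) ->
  ex_RInt_gen z (at_right 0) (Rbar_locally p_infty) ->
  ex_RInt_gen y (at_right 0) (Rbar_locally p_infty)).
{ clear; intros y z c E [l Hl]; exists (scal c l).
  apply is_RInt_gen_ext with (fun r => scal c (z r)).
  - generalize pos_prod; apply filter_imp; intros [p q] [H1 H2] r Hr; simpl in *.
    symmetry; apply E; rewrite Rmin_left in Hr; lra.
  - exact (is_RInt_gen_scal z c l Hl). }
intros Hc E; split.
- apply (K _ _ (/ c)); intros r Hr; rewrite E by trivial; field; trivial.
- apply (K _ _ c); exact E.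
Qed.

Lemma square_integrable_density xi : square_integrable xi <->
  ex_RInt_gen (fun r => density xi r * r) (at_right 0) (Rbar_locally p_infty).
Proof. reflexivity. Qed.

(** * Leading behaviour of a mode along rays *)

Lemma filterlim_lin (F : (R -> Prop) -> Prop) {FF : Filter F} (y z : R -> R) l m p q :
  filterlim y F (locally l) -> filterlim z F (locally m) ->
  filterlim (fun r => p * y r + q * z r) F (locally (p * l + q * m)).
Proof.
intros Hy Hz.
apply (filterlim_comp_2 (H := locally (q * m)) (G := locally (p * l)) (fun r => p * y r)
  (fun r => q * z r) Rplus).
- apply (filterlim_comp _ _ _ y (fun x => p * x) F (locally l)); trivial.
  apply (filterlim_scal_r (V := R_NormedModule) p l).
- apply (filterlim_comp _ _ _ z (fun x => q * x) F (locally m)); trivial.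
  apply (filterlim_scal_r (V := R_NormedModule) q m).
- apply (filterlim_plus (V := R_NormedModule)).
Qed.

Lemma right_ext (y z : R -> R) l : (forall r, 0 < r -> y r = z r) ->
  filterlim y (at_right 0) (locally l) -> filterlim z (at_right 0) (locally l).
Proof.
intros E; apply filterlim_ext_loc; exists (mkposreal 1 Rlt_0_1); intros r _ Hr; apply E, Hr.
Qed.

Lemma right_unique (y : R -> R) l m :
  filterlim y (at_right 0) (locally l) -> filterlim y (at_right 0) (locally m) -> l = m.
Proof. apply (filterlim_locally_unique (V := R_NormedModule) (F := at_right 0)). Qed.

Lemma angle_exists k : (1 <= k)%nat -> exists tc ts, Cos 1 0 k tc = 1 /\ Sin 1 0 k ts = 1.
Proof.
intros Hk; assert (Hk' : INR k <> 0) by (apply not_0_INR; lia).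
exists 0, (PI / 2 / INR k).
unfold Cos, Sin; replace (INR k * (PI / 2 / INR k)) with (PI / 2) by (field; trivial).
rewrite Rmult_0_r, cos_0, sin_0, cos_PI2, sin_PI2; split; ring.
Qed.

Lemma angle_exists' k : (1 <= k)%nat -> exists tc ts, Cos 0 1 k tc = 1 /\ Sin 0 1 k ts = 1.
Proof.
intros Hk; assert (Hk' : INR k <> 0) by (apply not_0_INR; lia).
exists (PI / 2 / INR k), (PI / INR k).
unfold Cos, Sin; replace (INR k * (PI / 2 / INR k)) with (PI / 2) by (field; trivial).
replace (INR k * (PI / INR k)) with PI by (field; trivial).
rewrite sin_PI2, cos_PI; split; ring.
Qed.

(** The profiles are read off on the two rays where an angular factor equals one. Were both limits
    zero, uniqueness of limits would make the angular profile vanish on every ray. *)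
Lemma mode_vector_behaves n k e g u h xi l : (1 <= k)%nat -> is_mode n 1 0 k e g u h xi ->
  vector_behaves_as xi l -> exists E G,
    filterlim (fun r => e r / powerRZ r l) (at_right 0) (locally E) /\
    filterlim (fun r => g r / powerRZ r l) (at_right 0) (locally G) /\ (E <> 0 \/ G <> 0).
Proof.
intros Hk HM [A [B [HA [HB [t0 Ht0]]]]].
destruct (angle_exists k Hk) as [tc [ts [C1 S2]]].
set (E := sin tc * A tc + - cos tc * B tc); set (G := - cos ts * A ts + - sin ts * B ts).
assert (LE : filterlim (fun r => e r / powerRZ r l) (at_right 0) (locally E)).
{ apply right_ext with (2 := filterlim_lin (at_right 0) _ _ _ _ (sin tc) (- cos tc) (HA tc)
  (HB tc)).
  intros r Hr; destruct (mode_profiles _ _ _ _ _ _ _ _ _ r tc HM Hr) as [_ [Q _]].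
  rewrite C1, Rmult_1_l in Q; rewrite Q; unfold pol, Rdiv; ring. }
assert (LG : filterlim (fun r => g r / powerRZ r l) (at_right 0) (locally G)).
{ apply right_ext with (2 := filterlim_lin (at_right 0) _ _ _ _ (- cos ts) (- sin ts) (HA ts)
  (HB ts)).
  intros r Hr; destruct (mode_profiles _ _ _ _ _ _ _ _ _ r ts HM Hr) as [Q _].
  rewrite S2, Rmult_1_l in Q; rewrite Q; unfold pol, Rdiv; ring. }
exists E, G; split; [exact LE|split; [exact LG|]].
assert (QA : A t0 = (sin t0 * Cos 1 0 k t0) * E + (- cos t0 * Sin 1 0 k t0) * G).
{ apply (right_unique _ _ _ (HA t0)).
  apply right_ext with (2 := filterlim_lin (at_right 0) _ _ _ _ (sin t0 * Cos 1 0 k t0)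
    (- cos t0 * Sin 1 0 k t0) LE LG).
  intros r Hr; destruct (HM r t0 Hr) as [Q _]; unfold pol in Q; rewrite Q; unfold Rdiv; ring. }
assert (QB : B t0 = (- cos t0 * Cos 1 0 k t0) * E + (- sin t0 * Sin 1 0 k t0) * G).
{ apply (right_unique _ _ _ (HB t0)).
  apply right_ext with (2 := filterlim_lin (at_right 0) _ _ _ _ (- cos t0 * Cos 1 0 k t0)
    (- sin t0 * Sin 1 0 k t0) LE LG).
  intros r Hr; destruct (HM r t0 Hr) as [_ [Q _]]; unfold pol in Q; rewrite Q; unfold Rdiv; ring. }
destruct (Req_dec E 0) as [ZE|]; [|tauto]; destruct (Req_dec G 0) as [ZG|]; [|tauto].
rewrite ZE, ZG in QA, QB; exfalso; destruct Ht0 as [Z|Z]; apply Z; [rewrite QA|rewrite QB]; ring.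
Qed.

Lemma mode_scalar_limits n k e g u h xi l : (1 <= k)%nat -> is_mode n 1 0 k e g u h xi ->
  scalar_behaves_as xi l -> exists U H,
    filterlim (fun r => u r / powerRZ r l) (at_right 0) (locally U) /\
    filterlim (fun r => h r / powerRZ r l) (at_right 0) (locally H).
Proof.
intros Hk HM [A [B [HA [HB _]]]].
destruct (angle_exists k Hk) as [tc [ts [C1 S2]]].
exists (cos (INR n * tc) * A tc + sin (INR n * tc) * B tc),
  (sin (INR n * ts) * A ts + - cos (INR n * ts) * B ts).
split.
- apply right_ext with (2 := filterlim_lin (at_right 0) _ _ _ _ (cos (INR n * tc))
  (sin (INR n * tc)) (HA tc) (HB tc)).
  intros r Hr; destruct (mode_profiles _ _ _ _ _ _ _ _ _ r tc HM Hr) as [_ [_ [Q _]]].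
  rewrite C1, Rmult_1_l in Q; rewrite Q; unfold pol, Rdiv; ring.
- apply right_ext with (2 := filterlim_lin (at_right 0) _ _ _ _ (sin (INR n * ts))
  (- cos (INR n * ts)) (HA ts) (HB ts)).
  intros r Hr; destruct (mode_profiles _ _ _ _ _ _ _ _ _ r ts HM Hr) as [_ [_ [_ Q]]].
  rewrite S2, Rmult_1_l in Q; rewrite Q; unfold pol, Rdiv; ring.
Qed.

Lemma powerRZ_nat r m : powerRZ r (Z.of_nat m) = r ^ m.
Proof. symmetry; apply pow_powerRZ. Qed.

Lemma lim_id0 : filterlim (fun r : R => r) (at_right 0) (locally 0).
Proof.
apply lim_right_iff; intros eps He; exists eps; split; trivial; intros r Hr; rewrite Rabs_pos_eq;
  lra.
Qed.

Lemma filterlim_mult_right (y z : R -> R) l m :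
  filterlim y (at_right 0) (locally l) -> filterlim z (at_right 0) (locally m) ->
  filterlim (fun r => y r * z r) (at_right 0) (locally (l * m)).
Proof.
intros Hy Hz; apply (filterlim_comp_2 (H := locally m) (G := locally l) y z Rmult); trivial.
apply (filterlim_mult (K := R_AbsRing)).
Qed.

Lemma lim_pow_mult (y : R -> R) L m : (1 <= m)%nat ->
  filterlim (fun r => y r / r ^ m) (at_right 0) (locally L) ->
  filterlim y (at_right 0) (locally 0).
Proof.
intros Hm H.
assert (Hp : filterlim (fun r => r ^ m) (at_right 0) (locally 0)).
{ clear H; induction Hm as [|m Hm IH].
  - apply right_ext with (2 := lim_id0); intros; ring.
  - assert (Z := filterlim_mult_right _ _ _ _ lim_id0 IH); rewrite Rmult_0_l in Z; exact Z. }
assert (Z := filterlim_mult_right _ _ _ _ H Hp); rewrite Rmult_0_r in Z.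
apply right_ext with (2 := Z); intros r Hr; field; apply pow_nonzero; lra.
Qed.

Lemma powerRZ_scalar_lim (y : R -> R) L (m : Z) : (0 < m)%Z ->
  filterlim (fun r => y r / powerRZ r m) (at_right 0) (locally L) ->
  filterlim y (at_right 0) (locally 0).
Proof.
intros Hm H; apply (lim_pow_mult y L (Z.to_nat m)); [lia|].
apply right_ext with (2 := H); intros r Hr; f_equal.
rewrite <- powerRZ_nat; f_equal; lia.
Qed.

(** A one-sided L'Hopital rule for a function without a value at the origin: the mean value theorem
    is applied on [[s, r]] with [s] so small that [v s] and [L s] are negligible. *)
Lemma derivative_quotient v L : (forall r, 0 < r -> ex_derive v r) ->
  filterlim v (at_right 0) (locally 0) -> filterlim (Derive v) (at_right 0) (locally L) ->
  filterlim (fun r => v r / r) (at_right 0) (locally L).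
Proof.
intros Hd H0 HL; apply lim_right_iff; intros eps He.
destruct (proj1 (lim_right_iff _ _) HL (eps / 2) ltac:(lra)) as [d [Hd0 HD]].
exists d; split; trivial; intros r Hr.
assert (K : Rabs (v r - L * r) <= eps / 2 * r).
{ apply Rnot_lt_le; intros HK.
  set (del := Rabs (v r - L * r) - eps / 2 * r).
  assert (Hdel : 0 < del) by (unfold del; lra).
  destruct (proj1 (lim_right_iff _ _) H0 (del / 2) ltac:(lra)) as [d1 [Hd1 HV]].
  set (c := Rabs L + 1); assert (Hc : 0 < c) by (unfold c; assert (Z := Rabs_pos L); lra).
  set (s := Rmin (Rmin (d1 / 2) (r / 2)) (del / (2 * c))).
  assert (Hs0 : 0 < s).
  { unfold s; repeat apply Rmin_glb_lt; try lra; apply Rdiv_lt_0_compat; lra. }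
  assert (Hs1 : s <= d1 / 2) by (unfold s; eapply Rle_trans; [apply Rmin_l|apply Rmin_l]).
  assert (Hs2 : s <= r / 2) by (unfold s; eapply Rle_trans; [apply Rmin_l|apply Rmin_r]).
  assert (Hs3 : c * s <= del / 2).
  { assert (Z : s <= del / (2 * c)) by apply Rmin_r.
    apply Rle_trans with (c * (del / (2 * c))); [apply Rmult_le_compat_l; lra|].
    apply Req_le; field; lra. }
  destruct (MVT_gen v s r (Derive v)) as [x [Hx Ex]].
  - rewrite Rmin_left, Rmax_right by lra; intros x Hx; apply Derive_correct, Hd; lra.
  - rewrite Rmin_left, Rmax_right by lra; intros x Hx.
    apply ex_derive_cont_pt, Hd; lra.
  - rewrite Rmin_left, Rmax_right in Hx by lra.
    assert (B1 := HD x ltac:(lra)); assert (B2 := HV s ltac:(lra)).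
    rewrite Rminus_0_r in B2.
    assert (T : v r - L * r = (Derive v x - L) * (r - s) + v s - L * s) by nra.
    assert (T2 : Rabs (v r - L * r) <= Rabs (Derive v x - L) * (r - s) + Rabs (v s) + Rabs L * s).
    { rewrite T; unfold Rminus at 1; eapply Rle_trans; [apply Rabs_triang|].
      apply Rplus_le_compat.
      - eapply Rle_trans; [apply Rabs_triang|]; rewrite Rabs_mult, (Rabs_pos_eq (r - s)) by lra;
        lra.
      - rewrite Rabs_Ropp, Rabs_mult, (Rabs_pos_eq s) by lra; lra. }
    assert (Rabs (Derive v x - L) * (r - s) <= eps / 2 * r) by nra.
    unfold c in Hs3; unfold del in *; nra. }
replace (v r / r - L) with ((v r - L * r) / r) by (field; lra).
rewrite Rabs_div by lra; rewrite (Rabs_pos_eq r) by lra.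
apply Rle_lt_trans with (eps / 2); [|lra].
apply Rle_div_l; lra.
Qed.

(** * Derrick-type modes *)

Lemma derrick_regular n vt ut : (1 <= n)%nat ->
  (regular_at_origin (derrick n vt ut) <-> radial_regular0 vt ut).
Proof.
intros Hn; assert (Hn' : INR n <> 0) by (apply not_0_INR; lia).
assert (HM := derrick_is_mode n vt ut); split.
- intros HR; assert (HR' := proj1 (regular_iff _) HR); split.
  + destruct (HR' A1) as [l L].
    (* The limit at the origin is common to all rays, and on the ray [0] the component [A1]
       vanishes. *)
    assert (l = 0).
    { apply (right_unique (fun _ => 0)); [|apply filterlim_const].
      apply right_ext with (2 := polar_lim_ray _ _ 0 L).
      intros r Hr; rewrite (proj1 (HM r 0 Hr)), sin_0; unfold Sin; simpl INR;
        rewrite Rmult_0_l, sin_0; ring. }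
    subst l; apply right_ext with (2 := polar_lim_ray _ _ (PI / 2) L).
    intros r Hr; rewrite (proj1 (HM r (PI / 2) Hr)), sin_PI2; unfold Sin, Cos; simpl INR.
    rewrite !Rmult_0_l, sin_0, cos_0; ring.
  + destruct (HR' P1) as [l L].
    assert (L1 : filterlim ut (at_right 0) (locally l)).
    { apply right_ext with (2 := polar_lim_ray _ _ 0 L).
      intros r Hr; rewrite (proj1 (proj2 (proj2 (HM r 0 Hr)))), Rmult_0_r, sin_0, cos_0.
      unfold Cos; simpl INR; rewrite Rmult_0_r, cos_0, sin_0; ring. }
    (* Between the rays [0] and [PI / n] the component [P1] changes sign, so its limit equals its
       opposite. *)
    assert (L2 : filterlim (fun r => -1 * ut r + 0 * ut r) (at_right 0) (locally l)).
    { apply right_ext with (2 := polar_lim_ray _ _ (PI / INR n) L).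
      intros r Hr; rewrite (proj1 (proj2 (proj2 (HM r (PI / INR n) Hr)))).
      replace (INR n * (PI / INR n)) with PI by (field; trivial); rewrite cos_PI, sin_PI.
      unfold Cos, Sin; simpl INR; rewrite Rmult_0_l, cos_0, sin_0; ring. }
    assert (E := right_unique _ _ _ L2 (filterlim_lin (at_right 0) _ _ _ _ (-1) 0 L1 L1)).
    replace l with 0 in L1; trivial.
    assert (E' : l = -1 * l + 0 * l) by exact E. lra.
- intros [Lv Lu].
  apply (mode_regular n 1 0 0 vt (fun _ => 0) ut (fun _ => 0) _ 0 0 HM); auto;
    apply filterlim_const.
Qed.

Lemma CR_zero m : CR m (fun _ => 0).
Proof. apply CR_const. Qed.

Lemma Cos_10_0 t : Cos 1 0 0 t = 1 /\ Sin 1 0 0 t = 0.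
Proof.
unfold Cos, Sin; replace (INR 0 * t) with 0 by (simpl; ring); rewrite cos_0, sin_0; split; ring.
Qed.

Lemma Cos_01_0 t : Cos 0 1 0 t = 0 /\ Sin 0 1 0 t = -1.
Proof.
unfold Cos, Sin; replace (INR 0 * t) with 0 by (simpl; ring); rewrite cos_0, sin_0; split; ring.
Qed.

Lemma derrick_eqs n lambda f beta w2 vt ut r : 0 < r ->
  (Hbar0 n lambda f beta vt ut r = (w2 * vt r, w2 * ut r) <->
   Ke n f beta 0 vt (fun _ => 0) ut r = w2 * vt r /\
   Ku n lambda f beta 0 vt ut (fun _ => 0) r = w2 * ut r).
Proof.
intros Hr; unfold Hbar0, Ke, Ku, Lop; simpl INR.
assert (Hr' : r <> 0) by lra.
split.
- intros H.
  assert (H1 : - Derive_n vt 2 r - Derive vt r / r + (1 / r ^ 2 + f r ^ 2) * vt r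
      + 2 * INR n / r * (1 - beta r) * f r * ut r = w2 * vt r) by exact (f_equal fst H).
  assert (H2 : 2 * INR n / r * (1 - beta r) * f r * vt r
      - Derive_n ut 2 r - Derive ut r / r
      + (INR n ^ 2 * (1 - beta r) ^ 2 / r ^ 2
         + 3 * lambda / 2 * f r ^ 2 - lambda / 2) * ut r = w2 * ut r) by exact (f_equal snd H).
  rewrite <- H1, <- H2; split; field; trivial.
- intros [<- <-]; apply f_equal2; field; trivial.
Qed.

Lemma derrick_in n lambda f beta w2 vt ut : vortex_profiles n lambda f beta -> (1 <= n)%nat ->
  (in_eigenspace n lambda f beta w2 (derrick n vt ut) <->
   (CR 2 vt /\ CR 2 ut) /\ radial_regular0 vt ut /\
   forall r, 0 < r -> Hbar0 n lambda f beta vt ut r = (w2 * vt r, w2 * ut r)).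
Proof.
intros Hv Hn; rewrite in_eigenspace_iff, derrick_regular by trivial.
assert (HM := derrick_is_mode n vt ut); split.
- intros [HC [HR HE]].
  assert (C : CR 2 vt /\ CR 2 ut).
  { apply (mode_CR_Cos _ _ _ _ _ _ _ _ _ 0 HM HC); apply Cos_10_0. }
  split; [exact C|split; [exact HR|]].
  rewrite (mode_solves n lambda f beta w2 _ _ _ _ _ _ _ _ Hv HM (proj1 C) (CR_zero 2) (proj2 C)
    (CR_zero 2)) in HE.
  intros r Hr; apply derrick_eqs; trivial; destruct (HE r 0 Hr) as [_ [E1 [E2 _]]].
  rewrite (proj1 (Cos_10_0 0)) in *; split; lra.
- intros [C [HR HE]].
  assert (HC := CD_mode _ _ _ _ _ _ _ _ _ HM (proj1 C) (CR_zero 2) (proj2 C) (CR_zero 2)).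
  split; [exact HC|split; [exact HR|]].
  rewrite (mode_solves n lambda f beta w2 _ _ _ _ _ _ _ _ Hv HM (proj1 C) (CR_zero 2) (proj2 C)
    (CR_zero 2)).
  intros r t Hr; destruct (proj1 (derrick_eqs n lambda f beta w2 vt ut r Hr) (HE r Hr)) as [E1 E2].
  destruct (Cos_10_0 t) as [-> ->]; rewrite E1, E2; repeat split; ring.
Qed.

Lemma derrick_eigenfunction n lambda f beta w2 vt ut : vortex_profiles n lambda f beta ->
  (1 <= n)%nat ->
  (eigenfunction n lambda f beta w2 (derrick n vt ut) <->
   radial_eigenfunction0 n lambda f beta w2 vt ut /\ radial_regular0 vt ut).
Proof.
intros Hv Hn; unfold eigenfunction; rewrite derrick_in by trivial.
rewrite (mode_nonzero _ _ _ _ _ _ _ _ _ (derrick_is_mode n vt ut)).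
split.
- intros [[[C1 C2] [HR HE]] [r [t [Hr HN]]]]; split; trivial.
  split; [apply CR_twice_derivable, C1|split; [apply CR_twice_derivable, C2|split; [exact HE|]]].
  exists r; split; trivial; destruct (Cos_10_0 t) as [Z1 Z2]; rewrite Z1, Z2 in HN.
  rewrite !Rmult_0_l, !Rmult_1_l in HN; tauto.
- intros [[T1 [T2 [HE [r [Hr HN]]]]] HR].
  assert (Cb := CR_pred _ _ (CR_beta n lambda f beta Hv)).
  assert (Cf := CR_pred _ _ (CR_pred _ _ (CR_f n lambda f beta Hv))).
  assert (C1 := twice_derivable_CR _ T1); assert (C2 := twice_derivable_CR _ T2).
  destruct (CR_derives 0 _ C1) as [_ D1]; destruct (CR_derives 0 _ C2) as [_ D2].
  apply CR_pred in C1; apply CR_pred in C2.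
  assert (E : forall r, 0 < r ->
    Derive_n vt 2 r = - (Derive vt r * / r) + ((/ r) ^ 2 + f r ^ 2) * vt r
      + 2 * INR n * / r * (1 - beta r) * f r * ut r - w2 * vt r /\
    Derive_n ut 2 r = 2 * INR n * / r * (1 - beta r) * f r * vt r - Derive ut r * / r
      + (INR n ^ 2 * (1 - beta r) ^ 2 * (/ r) ^ 2 + 3 * lambda / 2 * f r ^ 2 - lambda / 2) * ut r
      - w2 * ut r).
  { intros s Hs; specialize (HE s Hs); unfold Hbar0 in HE.
    assert (H1 := f_equal fst HE); assert (H2 := f_equal snd HE); cbn [fst snd] in H1, H2.
    rewrite !pow_inv; unfold Rdiv in *; split; lra. }
  split; [split; [split|]|].
  + eapply CR_SS; [exact T1|intros s Hs; apply (E s Hs)|]; CR_tac.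
  + eapply CR_SS; [exact T2|intros s Hs; apply (E s Hs)|]; CR_tac.
  + split; trivial.
  + exists r, 0; split; trivial; destruct (Cos_10_0 0) as [-> ->].
    rewrite !Rmult_0_l, !Rmult_1_l; tauto.
Qed.

Lemma RInt_derrick : RInt (fun t => Cos 1 0 0 t ^ 2) 0 (2 * PI) = 2 * PI /\
  RInt (fun t => Sin 1 0 0 t ^ 2) 0 (2 * PI) = 0.
Proof.
split.
- rewrite (RInt_ext _ (fun _ => 1)); [rewrite RInt_const;
  change (@eq R ((2 * PI - 0) * 1) (2 * PI)); ring|].
  intros t _; rewrite (proj1 (Cos_10_0 t)); toR; ring.
- rewrite (RInt_ext _ (fun _ => 0)); [rewrite RInt_const; change (@eq R ((2 * PI - 0) * 0) 0);
  ring|].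
  intros t _; rewrite (proj2 (Cos_10_0 t)); toR; ring.
Qed.

Lemma derrick_square_integrable n vt ut :
  square_integrable (derrick n vt ut) <-> radial_square_integrable0 vt ut.
Proof.
rewrite square_integrable_density.
assert (HP := PI_RGT_0).
apply (ex_RInt_gen_scale _ _ (2 * PI)); [lra|]; intros r Hr.
rewrite (mode_density _ _ _ _ _ _ _ _ _ r (derrick_is_mode n vt ut) Hr).
destruct RInt_derrick as [-> ->]; ring.
Qed.

Lemma multipolar_square_integrable n f k v u w : (1 <= k)%nat ->
  (square_integrable (multipolar n f k v u w) <-> radial_square_integrable f k v u w).
Proof.
intros Hk; rewrite square_integrable_density.
assert (HP := PI_RGT_0).
apply (ex_RInt_gen_scale _ _ PI); [lra|]; intros r Hr.
rewrite (mode_density _ _ _ _ _ _ _ _ _ r (multipolar_is_mode n f k v u w) Hr).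
destruct (RInt_Cos_sq 1 0 k Hk) as [-> ->]; unfold ev; ring.
Qed.

(** * Multipolar modes and their partners *)

Definition mode_system n lambda f beta w2 k (e g u h : R -> R) : Prop :=
  forall r, 0 < r -> Kg f k e g h r = w2 * g r /\ Ke n f beta k e g u r = w2 * e r /\
    Ku n lambda f beta k e u h r = w2 * u r /\ Kh n lambda f beta k g u h r = w2 * h r /\
    Kc f k e g h r = 0.

Lemma mode_system_solves n lambda f beta w2 a b k e g u h xi :
  vortex_profiles n lambda f beta -> is_mode n a b k e g u h xi ->
  CR 2 e -> CR 2 g -> CR 2 u -> CR 2 h -> mode_system n lambda f beta w2 k e g u h ->
  background_gauge (vortex n f beta) xi /\ eigen_eq n lambda f beta w2 xi.
Proof.
intros Hv HM He Hg Hu Hh HS; apply (mode_solves n lambda f beta w2 _ _ _ _ _ _ _ _ Hv HM He Hg Hu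
  Hh).
intros r t Hr; destruct (HS r Hr) as [-> [-> [-> [-> ->]]]]; repeat split; ring.
Qed.

Lemma mode_system_of n lambda f beta w2 a b k e g u h xi :
  vortex_profiles n lambda f beta -> is_mode n a b k e g u h xi ->
  (exists tc ts, Cos a b k tc = 1 /\ Sin a b k ts = 1) ->
  (forall c, CD off 2 (xi c)) ->
  background_gauge (vortex n f beta) xi /\ eigen_eq n lambda f beta w2 xi ->
  (CR 2 e /\ CR 2 g /\ CR 2 u /\ CR 2 h) /\ mode_system n lambda f beta w2 k e g u h.
Proof.
intros Hv HM [tc [ts [Hc Hs]]] HC HE.
destruct (mode_CR_Cos _ _ _ _ _ _ _ _ _ tc HM HC Hc) as [Ce Cu].
destruct (mode_CR_Sin _ _ _ _ _ _ _ _ _ ts HM HC Hs) as [Cg Ch].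
split; [auto|].
rewrite (mode_solves n lambda f beta w2 _ _ _ _ _ _ _ _ Hv HM Ce Cg Cu Ch) in HE.
intros r Hr; destruct (HE r tc Hr) as [_ [E1 [E2 _]]].
destruct (HE r ts Hr) as [E3 [_ [_ [E4 E5]]]].
rewrite Hc in *; rewrite Hs in *; repeat split; lra.
Qed.

Lemma radial_equiv n lambda f beta w2 k v u w : vortex_profiles n lambda f beta -> (1 <= k)%nat ->
  (((CR 2 (ev f v w) /\ CR 2 (fun r => INR k * v r / r) /\ CR 2 u /\ CR 2 (fun r => INR k * w r)) /\
   mode_system n lambda f beta w2 k (ev f v w) (fun r => INR k * v r / r) u (fun r => INR k * w r))
     <->
   twice_derivable v /\ twice_derivable u /\ twice_derivable w /\
  (forall r, 0 < r ->
     Hbar n lambda f beta k v u w r = (w2 * v r, w2 * u r, w2 * w r))).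
Proof.
intros Hv Hk; assert (Hk' : INR k <> 0) by (apply not_0_INR; lia); split.
- intros [[Ce [Cg [Cu Ch]]] HS].
  assert (Cv : CR 2 v).
  { apply CR_ext with (fun r => / INR k * r * (INR k * v r / r)).
    - intros r Hr; field; lra.
    - apply CR_mult; [apply CR_scal, CR_id|exact Cg]. }
  assert (Cw : CR 2 w).
  { apply CR_ext with (fun r => / INR k * (INR k * w r)); [intros; field; trivial|].
    apply CR_scal, Ch. }
  split; [apply CR_twice_derivable, Cv|split; [apply CR_twice_derivable, Cu|split;
    [apply CR_twice_derivable, Cw|]]].
  apply Hbar_from_radial; trivial; [apply CR_pred, Cw|].
  intros r Hr; destruct (HS r Hr) as [E1 [E2 [E3 [E4 E5]]]]; auto.
- intros [Tv [Tu [Tw HH]]].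
  destruct (radial_from_Hbar n lambda f beta Hv w2 k v u w Tv Tu Tw HH) as [[Ce [Cv [Cu Cw]]] HS].
  split; [|exact HS].
  split; [exact Ce|split; [apply CR_div, CR_scal, Cv|split; [exact Cu|apply CR_scal, Cw]]].
Qed.

Lemma multi_gen_in n lambda f beta w2 a b k v u w xi : vortex_profiles n lambda f beta ->
  (1 <= k)%nat ->
  (exists tc ts, Cos a b k tc = 1 /\ Sin a b k ts = 1) ->
  is_mode n a b k (ev f v w) (fun r => INR k * v r / r) u (fun r => INR k * w r) xi ->
  (in_eigenspace n lambda f beta w2 xi <->
   (twice_derivable v /\ twice_derivable u /\ twice_derivable w /\
    (forall r, 0 < r ->
       Hbar n lambda f beta k v u w r = (w2 * v r, w2 * u r, w2 * w r))) /\
   regular_at_origin xi).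
Proof.
intros Hv Hk HA HM; rewrite in_eigenspace_iff, <- (radial_equiv n lambda f beta w2 k v u w Hv Hk).
split.
- intros [HC [HR HE]]; split; trivial.
  apply (mode_system_of n lambda f beta w2 a b k _ _ _ _ xi Hv HM HA HC HE).
- intros [[[Ce [Cg [Cu Ch]]] HS] HR].
  split; [apply (CD_mode _ _ _ _ _ _ _ _ _ HM Ce Cg Cu Ch)|split; [exact HR|]].
  apply (mode_system_solves n lambda f beta w2 a b k _ _ _ _ xi Hv HM Ce Cg Cu Ch HS).
Qed.

Lemma multi_gen_nonzero n f a b k v u w xi : (1 <= k)%nat ->
  (exists tc ts, Cos a b k tc = 1 /\ Sin a b k ts = 1) ->
  is_mode n a b k (ev f v w) (fun r => INR k * v r / r) u (fun r => INR k * w r) xi ->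
  (nonzero_field xi <-> exists r, 0 < r /\ (v r <> 0 \/ u r <> 0 \/ w r <> 0)).
Proof.
intros Hk [tc [ts [Hc Hs]]] HM; assert (Hk' : 0 < INR k) by (apply lt_0_INR; lia).
rewrite (mode_nonzero _ _ _ _ _ _ _ _ _ HM); split.
- intros [r [t [Hr HN]]].
  destruct (Req_dec (v r) 0) as [Z1|]; [|exists r; tauto].
  destruct (Req_dec (u r) 0) as [Z2|]; [|exists r; tauto].
  destruct (Req_dec (w r) 0) as [Z3|]; [|exists r; tauto].
  destruct (Req_dec (Derive v r) 0) as [Z4|Z4].
  + exfalso; unfold ev in HN; rewrite Z1, Z2, Z3, Z4 in HN.
    destruct HN as [HN|[HN|[HN|HN]]]; apply HN; field; lra.
  (* Here the field is nonzero only through the derivative of [v]; then [v] cannot vanish on the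
     whole half-line. *)
  + apply Classical_Prop.NNPP; intros HNN.
    assert (HZ : forall s, 0 < s -> v s = 0).
    { intros s Hs'; apply Classical_Prop.NNPP; intros Hv; apply HNN; exists s; tauto. }
    apply Z4; rewrite (Derive_ext_loc v (fun _ => 0)); [apply Derive_const|].
    generalize (locally_pos r Hr); apply filter_imp; exact HZ.
- intros [r [Hr [HN|[HN|HN]]]].
  + exists r, ts; split; trivial; left; rewrite Hs, Rmult_1_l.
    apply Rmult_integral_contrapositive; split; [|apply Rinv_neq_0_compat; lra].
    apply Rmult_integral_contrapositive; split; lra.
  + exists r, tc; split; trivial; rewrite Hc, !Rmult_1_l; tauto.
  + exists r, ts; split; trivial; right; right; right; rewrite Hs, Rmult_1_l.
    apply Rmult_integral_contrapositive; split; lra.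
Qed.

Lemma multi_gen_eigenfunction n lambda f beta w2 a b k v u w xi : vortex_profiles n lambda f beta ->
  (1 <= k)%nat ->
  (exists tc ts, Cos a b k tc = 1 /\ Sin a b k ts = 1) ->
  is_mode n a b k (ev f v w) (fun r => INR k * v r / r) u (fun r => INR k * w r) xi ->
  (eigenfunction n lambda f beta w2 xi <->
   radial_eigenfunction n lambda f beta k w2 v u w /\ regular_at_origin xi).
Proof.
intros Hv Hk HA HM; unfold eigenfunction, radial_eigenfunction.
rewrite (multi_gen_in n lambda f beta w2 a b k v u w xi Hv Hk HA HM).
rewrite (multi_gen_nonzero n f a b k v u w xi Hk HA HM); tauto.
Qed.

(** The partner is the mode turned by [PI / (2 k)], a quarter of its angular period, together with
    the scalar phase. *)
Lemma partner_regular n f k v u w : (1 <= k)%nat ->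
  (regular_at_origin (multipolar_partner n f k v u w) <->
    regular_at_origin (multipolar n f k v u w)).
Proof.
intros Hk; assert (Hk' : INR k <> 0) by (apply not_0_INR; lia); split.
- apply (mode_rotate n 0 1 1 0 k _ _ _ _ _ _ (PI / 2 / INR k) (partner_is_mode n f k v u w)
  (multipolar_is_mode n f k v u w)).
  intros t; unfold Cos, Sin; rewrite Rmult_plus_distr_l.
  replace (INR k * (PI / 2 / INR k)) with (PI / 2) by (field; trivial).
  rewrite cos_plus, sin_plus, cos_PI2, sin_PI2; split; ring.
- apply (mode_rotate n 1 0 0 1 k _ _ _ _ _ _ (- (PI / 2 / INR k)) (multipolar_is_mode n f k v u w)
  (partner_is_mode n f k v u w)).
  intros t; unfold Cos, Sin; rewrite Rmult_plus_distr_l.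
  replace (INR k * - (PI / 2 / INR k)) with (- (PI / 2)) by (field; trivial).
  rewrite cos_plus, sin_plus, cos_neg, sin_neg, cos_PI2, sin_PI2; split; ring.
Qed.

Lemma multipolar_eigenfunction n lambda f beta w2 k v u w : vortex_profiles n lambda f beta ->
  (1 <= k)%nat ->
  (eigenfunction n lambda f beta w2 (multipolar n f k v u w) <->
   radial_eigenfunction n lambda f beta k w2 v u w /\ regular_at_origin (multipolar n f k v u w)).
Proof.
intros Hv Hk; apply (multi_gen_eigenfunction n lambda f beta w2 1 0); trivial;
  [apply angle_exists, Hk|apply multipolar_is_mode].
Qed.

Lemma partner_eigenfunction n lambda f beta w2 k v u w : vortex_profiles n lambda f beta ->
  (1 <= k)%nat ->
  (eigenfunction n lambda f beta w2 (multipolar_partner n f k v u w) <->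
   eigenfunction n lambda f beta w2 (multipolar n f k v u w)).
Proof.
intros Hv Hk; rewrite multipolar_eigenfunction, <- partner_regular by trivial.
apply (multi_gen_eigenfunction n lambda f beta w2 0 1); trivial;
  [apply angle_exists', Hk|apply partner_is_mode].
Qed.

(** For [l < 0], dividing by [powerRZ r l] multiplies a convergent component by a positive power of
    [r], so the angular profile would vanish. For type A this is the bound [k <= n]. *)
Lemma scalar_exponent_nonneg xi l : regular_at_origin xi -> scalar_behaves_as xi l -> (0 <= l)%Z.
Proof.
intros HR [A [B [HA [HB [t Ht]]]]].
destruct (Z_le_gt_dec 0 l) as [|Hl]; trivial; exfalso.
set (m := Z.to_nat (- l)).
assert (Hm : (1 <= m)%nat) by (unfold m; lia).
assert (El : l = (- Z.of_nat m)%Z) by (unfold m; lia).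
assert (K : forall c L, filterlim (fun r => xi c (r * cos t) (r * sin t) / powerRZ r l)
                 (at_right 0) (locally L) -> L = 0).
{ intros c L HL.
  destruct (proj1 (regular_iff xi) HR c) as [l0 L0].
  assert (Hp : filterlim (fun r => r ^ m) (at_right 0) (locally 0)).
  { apply (lim_pow_mult (fun r => r ^ m) 1 m Hm).
    apply right_ext with (fun _ => 1); [|apply filterlim_const].
    intros r Hr; field; apply pow_nonzero; lra. }
  assert (Z := filterlim_mult_right _ _ _ _ (polar_lim_ray _ _ t L0) Hp).
  rewrite Rmult_0_r in Z; apply (right_unique _ _ _ HL), (right_ext _ _ _ ) with (2 := Z).
  intros r Hr; unfold pol; rewrite El, powerRZ_neg', powerRZ_nat.
  field; apply pow_nonzero; lra. }
destruct Ht as [Ht|Ht]; apply Ht; [apply (K P1), HA|apply (K P2), HB].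
Qed.

(** * Profiles near the origin *)

(** Divided by [r ^ m], the expansion is a power series in [r ^ 2]. Summability at [rho / 2] bounds
    its terms there, so the radius of convergence is positive and the sum is continuous at zero. *)
Lemma even_series_limit (a : nat -> R) m rho (y : R -> R) : 0 < rho ->
  (forall r, 0 <= r < rho -> is_series (fun i => a i * r ^ (m + 2 * i)) (y r)) ->
  filterlim (fun r => y r / r ^ m) (at_right 0) (locally (a 0%nat)).
Proof.
intros Hrho HS.
assert (HP : forall r, 0 < r < rho -> is_series (fun i => a i * (r ^ 2) ^ i) (y r / r ^ m)).
{ intros r Hr; assert (Hp : r ^ m <> 0) by (apply pow_nonzero; lra).
  assert (Z := is_series_scal (/ r ^ m) _ _ (HS r ltac:(lra))).
  replace (y r / r ^ m) with (scal (/ r ^ m) (y r)) by apply Rmult_comm.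
  apply is_series_ext with (2 := Z); intros i.
  change (/ r ^ m * (a i * r ^ (m + 2 * i)) = a i * (r ^ 2) ^ i).
  rewrite <- pow_mult, pow_add; field; trivial. }
set (q := (rho / 2) ^ 2).
assert (Hq : 0 < q) by (unfold q; nra).
assert (HR : Rbar_le q (CV_radius a)).
{ apply (CV_radius_bounded a).
  assert (Z : is_lim_seq (fun i => a i * q ^ i) 0).
  { apply (ex_series_lim_0 (fun i => a i * q ^ i)); eexists; exact (HP (rho / 2) ltac:(lra)). }
  destruct (filterlim_bounded (V := R_NormedModule) (fun i => a i * q ^ i)
    (ex_intro (fun x : R => filterlim _ eventually (locally x)) 0 Z)) as [M HM]; exists M;
      exact HM. }
assert (HC : continuity_pt (PSeries a) 0).
{ apply PSeries_continuity; rewrite Rabs_R0; apply Rbar_lt_le_trans with q; trivial. }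
rewrite <- PSeries_0.
apply lim_right_iff; intros eps He.
destruct (HC eps He) as [d [Hd HD]].
exists (Rmin (Rmin rho 1) d); split; [repeat apply Rmin_glb_lt; lra|]; intros r Hr.
assert (M1 := Rmin_l (Rmin rho 1) d); assert (M2 := Rmin_r (Rmin rho 1) d).
assert (M3 := Rmin_l rho 1); assert (M4 := Rmin_r rho 1).
rewrite <- (is_pseries_unique a (r ^ 2) _ (proj2 (is_pseries_R _ _ _) (HP r ltac:(lra)))).
apply HD; split; [split; [exact I|nra]|].
unfold dist; simpl; unfold Rdist; rewrite Rminus_0_r, Rabs_pos_eq; nra.
Qed.

Lemma f_origin n lambda f beta : vortex_profiles n lambda f beta ->
  exists d0, d0 <> 0 /\ filterlim (fun r => f r / r ^ n) (at_right 0) (locally d0).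
Proof.
intros [_ [_ [_ [_ [_ [_ [_ [_ [[d [rho [Hrho [Hd HS]]]] _]]]]]]]]].
exists (d 0%nat); split; trivial; apply even_series_limit with rho; trivial.
Qed.

Lemma beta_origin n lambda f beta : vortex_profiles n lambda f beta ->
  exists c0, filterlim (fun r => beta r / r ^ 2) (at_right 0) (locally c0).
Proof.
intros [_ [_ [_ [_ [_ [_ [_ [_ [_ [c [rho [Hrho [_ HS]]]]]]]]]]]]].
exists (c 0%nat); apply even_series_limit with rho; trivial.
Qed.

(** For [k >= 2] all profiles tend to zero. For [k = 1] the vector profiles have finite limits,
    which must agree: [e = v' - r f w] has the limit of [v'], and by L'Hopital's rule so has
    [g = v / r]. *)
Lemma type_B_regular n lambda f beta k v u w : vortex_profiles n lambda f beta -> (1 <= n)%nat ->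
  (1 <= k)%nat ->
  (forall r, 0 < r -> ex_derive v r) ->
  type_B n k (multipolar n f k v u w) -> regular_at_origin (multipolar n f k v u w).
Proof.
intros Hv Hn Hk Dv [BV BS]; assert (HM := multipolar_is_mode n f k v u w).
assert (Hk' : INR k <> 0) by (apply not_0_INR; lia).
destruct (mode_scalar_limits _ _ _ _ _ _ _ _ Hk HM BS) as [U [H [LU LH]]].
apply powerRZ_scalar_lim in LU; [|lia]; apply powerRZ_scalar_lim in LH; [|lia].
destruct (mode_vector_behaves _ _ _ _ _ _ _ _ Hk HM BV) as [E [G [LE [LG _]]]].
destruct (Nat.eq_dec k 1) as [->|Hk1].
- change (Z.of_nat 1 - 1)%Z with 0%Z in LE, LG.
  assert (LE' : filterlim (ev f v w) (at_right 0) (locally E)).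
  { apply right_ext with (2 := LE); intros; simpl; field. }
  assert (LG' : filterlim (fun r => v r / r) (at_right 0) (locally G)).
  { apply right_ext with (2 := LG); intros; simpl; field; lra. }
  assert (EG : E = G).
  { destruct (f_origin n lambda f beta Hv) as [d0 [_ Lf]].
    assert (Lf0 := lim_pow_mult f d0 n Hn Lf).
    assert (Lw : filterlim w (at_right 0) (locally 0)).
    { apply right_ext with (2 := LH); intros; simpl; ring. }
    assert (Lv : filterlim v (at_right 0) (locally 0)).
    { assert (Z := filterlim_mult_right _ _ _ _ LG' lim_id0); rewrite Rmult_0_r in Z.
      apply right_ext with (2 := Z); intros; field; lra. }
    assert (Lfw := filterlim_mult_right _ _ _ _ lim_id0 (filterlim_mult_right _ _ _ _ Lf0 Lw)).
    assert (Ld := filterlim_lin (at_right 0) _ _ _ _ 1 1 LE' Lfw).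
    rewrite !Rmult_1_l, !Rmult_0_l, Rplus_0_r in Ld.
    apply (right_unique (fun r => v r / r)); trivial.
    apply derivative_quotient; trivial.
    apply right_ext with (2 := Ld); intros r Hr; unfold ev; ring. }
  subst G.
  apply (mode_regular n 1 0 1 _ _ _ _ _ E 0 HM); auto.
  apply right_ext with (2 := LG'); intros; simpl; field; lra.
- apply (powerRZ_scalar_lim _ _ (Z.of_nat k - 1)) in LE; [|lia];
  apply (powerRZ_scalar_lim _ _ (Z.of_nat k - 1)) in LG; [|lia].
  apply (mode_regular n 1 0 k _ _ _ _ _ 0 0 HM); auto.
Qed.

(** * Orders of vanishing at the origin and their integration *)

Definition bigO (j : nat) (y : R -> R) : Prop :=
  exists K rho, 0 <= K /\ 0 < rho /\ forall r, 0 < r < rho -> Rabs (y r) <= K * r ^ j.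

Lemma bigO_ext j y z : (forall r, 0 < r -> y r = z r) -> bigO j y -> bigO j z.
Proof.
intros E [K [rho [HK [Hr H]]]]; exists K, rho; repeat split; trivial.
intros r Hr'; rewrite <- E by lra; auto.
Qed.

Lemma pow_le_mono r i j : 0 < r <= 1 -> (i <= j)%nat -> r ^ j <= r ^ i.
Proof.
intros Hr H; induction H as [|j H IH]; [lra|].
simpl; assert (P := pow_lt r j ltac:(lra)); nra.
Qed.

Lemma bigO_weaken i j y : (i <= j)%nat -> bigO j y -> bigO i y.
Proof.
intros Hij [K [rho [HK [Hr H]]]]; exists K, (Rmin rho 1); split; trivial.
split; [apply Rmin_glb_lt; lra|]; intros r Hr'.
assert (M1 := Rmin_l rho 1); assert (M2 := Rmin_r rho 1).
eapply Rle_trans; [apply H; lra|].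
apply Rmult_le_compat_l; trivial; apply pow_le_mono; trivial; lra.
Qed.

Lemma bigO_plus j y z : bigO j y -> bigO j z -> bigO j (fun r => y r + z r).
Proof.
intros [K [rho [HK [Hr H]]]] [K' [rho' [HK' [Hr' H']]]].
exists (K + K'), (Rmin rho rho'); split; [lra|split; [apply Rmin_glb_lt; trivial|]]; intros r Hs.
assert (M1 := Rmin_l rho rho'); assert (M2 := Rmin_r rho rho').
eapply Rle_trans; [apply Rabs_triang|].
specialize (H r ltac:(lra)); specialize (H' r ltac:(lra)); lra.
Qed.

Lemma bigO_mult i j d y z : (d <= i + j)%nat -> bigO i y -> bigO j z -> bigO d (fun r => y r * z r).
Proof.
intros Hd [K [rho [HK [Hr H]]]] [K' [rho' [HK' [Hr' H']]]].
apply bigO_weaken with (1 := Hd).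
exists (K * K'), (Rmin rho rho'); split; [nra|split; [apply Rmin_glb_lt; trivial|]]; intros r Hs.
assert (M1 := Rmin_l rho rho'); assert (M2 := Rmin_r rho rho').
specialize (H r ltac:(lra)); specialize (H' r ltac:(lra)).
rewrite Rabs_mult, pow_add.
replace (K * K' * (r ^ i * r ^ j)) with ((K * r ^ i) * (K' * r ^ j)) by ring.
apply Rmult_le_compat; trivial; apply Rabs_pos.
Qed.

Lemma bigO_const c : bigO 0 (fun _ => c).
Proof.
exists (Rabs c), 1; repeat split; [apply Rabs_pos|lra|intros; simpl; lra].
Qed.

Lemma bigO_pow j : bigO j (fun r => r ^ j).
Proof.
exists 1, 1; repeat split; try lra; intros r Hr.
rewrite Rabs_pos_eq; [lra|apply pow_le; lra].
Qed.

Lemma bigO_scal j c y : bigO j y -> bigO j (fun r => c * y r).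
Proof. intros H; apply (bigO_mult 0 j j); [lia|apply bigO_const|exact H]. Qed.

Lemma bigO_opp j y : bigO j y -> bigO j (fun r => - y r).
Proof. intros H; apply bigO_ext with (fun r => -1 * y r); [intros; ring|apply bigO_scal, H]. Qed.

Lemma bigO_minus j y z : bigO j y -> bigO j z -> bigO j (fun r => y r - z r).
Proof. intros H H'; apply bigO_plus; [|apply bigO_opp]; assumption. Qed.

Lemma bigO_lim m y L : filterlim (fun r => y r / r ^ m) (at_right 0) (locally L) -> bigO m y.
Proof.
intros H; destruct (proj1 (lim_right_iff _ _) H 1 Rlt_0_1) as [d [Hd HD]].
exists (Rabs L + 1), d; split; [assert (P := Rabs_pos L); lra|split; trivial]; intros r Hr.
assert (P : 0 < r ^ m) by (apply pow_lt; lra).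
replace (y r) with (((y r / r ^ m - L) + L) * r ^ m) by (field; lra).
rewrite Rabs_mult, (Rabs_pos_eq (r ^ m)) by lra.
apply Rmult_le_compat_r; [lra|].
eapply Rle_trans; [apply Rabs_triang|]; specialize (HD r Hr); lra.
Qed.

Lemma lim_bigO m y L : bigO (S m) (fun r => y r - L * r ^ m) ->
  filterlim (fun r => y r / r ^ m) (at_right 0) (locally L).
Proof.
intros [K [rho [HK [Hr H]]]]; apply lim_right_iff; intros eps He.
exists (Rmin rho (eps / (K + 1))); split.
{ apply Rmin_glb_lt; trivial; apply Rdiv_lt_0_compat; lra. }
intros r Hs; assert (M1 := Rmin_l rho (eps / (K + 1))); assert (M2 := Rmin_r rho (eps / (K + 1))).
assert (P : 0 < r ^ m) by (apply pow_lt; lra).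
replace (y r / r ^ m - L) with ((y r - L * r ^ m) / r ^ m) by (field; lra).
rewrite Rabs_div, (Rabs_pos_eq (r ^ m)) by lra.
apply Rle_lt_trans with (K * r).
- apply Rle_div_l; trivial; specialize (H r ltac:(lra)); simpl in H; lra.
- apply Rle_lt_trans with (K * (eps / (K + 1))); [apply Rmult_le_compat_l; lra|].
  replace eps with ((K + 1) * (eps / (K + 1))) at 2 by (field; lra).
  apply Rmult_lt_compat_r; [apply Rdiv_lt_0_compat; lra|lra].
Qed.

Lemma bigO_coef m c : bigO (S m) (fun r => c * r ^ m) -> c = 0.
Proof.
intros H.
assert (L1 : filterlim (fun r => c * r ^ m / r ^ m) (at_right 0) (locally 0)).
{ apply (lim_bigO m (fun r => c * r ^ m)); apply bigO_ext with (2 := H); intros; ring. }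
apply (right_unique (fun _ => c)); [apply filterlim_const|].
apply right_ext with (2 := L1); intros r Hr; field; apply pow_nonzero; lra.
Qed.

Lemma bigO_div j y : bigO (S j) y -> bigO j (fun r => y r / r).
Proof.
intros [K [rho [HK [Hr H]]]]; exists K, rho; repeat split; trivial; intros r Hs.
rewrite Rabs_div, (Rabs_pos_eq r) by lra.
apply Rle_div_l; [lra|]; specialize (H r Hs); simpl in H; lra.
Qed.

Lemma bigO_div_pow j m y : bigO (m + j) y -> bigO j (fun r => y r / r ^ m).
Proof.
intros [K [rho [HK [Hr H]]]]; exists K, rho; repeat split; trivial; intros r Hs.
assert (P : 0 < r ^ m) by (apply pow_lt; lra).
rewrite Rabs_div, (Rabs_pos_eq (r ^ m)) by lra.
apply Rle_div_l; trivial; specialize (H r Hs); rewrite pow_add in H; lra.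
Qed.

(** Integration from the origin without an integral: the mean value theorem bounds increments by
    [K * r ^ S i], so [g] is Cauchy at the origin, and the lower end point is sent to its limit
    [L]. *)
Lemma derive_bigO (g g' : R -> R) i : (forall r, 0 < r -> is_derive g r (g' r)) -> bigO i g' ->
  exists L, bigO (S i) (fun r => g r - L).
Proof.
intros Hd [K [rho [HK [Hr H]]]].
assert (Hc : forall r, 0 < r -> continuity_pt g r).
{ intros r Hs; apply ex_derive_cont_pt.
  eexists; apply Hd, Hs. }
assert (D : forall s r, 0 < s -> s <= r -> r < rho -> Rabs (g r - g s) <= K * r ^ (S i)).
{ intros s r Hs Hsr Hr'.
  destruct (MVT_gen g s r g') as [x [Hx E]].
  - rewrite Rmin_left, Rmax_right by lra; intros x Hx; apply Hd; lra.
  - rewrite Rmin_left, Rmax_right by lra; intros x Hx; apply Hc; lra.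
  - rewrite Rmin_left, Rmax_right in Hx by lra.
    rewrite E, Rabs_mult, (Rabs_pos_eq (r - s)) by lra.
    assert (B := H x ltac:(lra)).
    assert (P1 : x ^ i <= r ^ i) by (apply pow_incr; lra).
    assert (P0 : 0 <= r ^ i) by (apply pow_le; lra).
    apply Rle_trans with (K * r ^ i * r); [|simpl; apply Req_le; ring].
    apply Rmult_le_compat; [apply Rabs_pos|lra| |lra].
    apply Rle_trans with (1 := B); apply Rmult_le_compat_l; lra. }
assert (HC : exists L : R, filterlim g (at_right 0) (locally L)).
{ apply (filterlim_locally_cauchy (U := R_CompleteSpace) (F := at_right 0)); intros eps.
  assert (Hd0 : 0 < Rmin (Rmin rho 1) (eps / (K + 1))).
  { repeat apply Rmin_glb_lt; trivial; try lra; apply Rdiv_lt_0_compat; [apply cond_pos|lra]. }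
  set (d := Rmin (Rmin rho 1) (eps / (K + 1))) in *.
  assert (D1 : d <= rho) by (unfold d; eapply Rle_trans; [apply Rmin_l|apply Rmin_l]).
  assert (D2 : d <= 1) by (unfold d; eapply Rle_trans; [apply Rmin_l|apply Rmin_r]).
  assert (D3 : d <= eps / (K + 1)) by (unfold d; apply Rmin_r).
  assert (Q : forall s r, 0 < s -> s <= r -> r < d -> Rabs (g r - g s) < eps).
  { intros s r Hs Hsr Hrd; eapply Rle_lt_trans; [apply D; lra|].
    assert (P : r ^ S i <= r ^ 1) by (apply pow_le_mono; [lra|lia]).
    rewrite pow_1 in P.
    apply Rle_lt_trans with (K * (eps / (K + 1))).
    - apply Rmult_le_compat_l; lra.
    - replace (pos eps) with ((K + 1) * (eps / (K + 1))) at 2 by (field; lra).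
      assert (0 < eps / (K + 1)) by (apply Rdiv_lt_0_compat; [apply cond_pos|lra]); nra. }
  exists (fun r => 0 < r < d); split.
  - exists (mkposreal d Hd0); intros y Hy H0; split; trivial.
    change (Rabs (y - 0) < d) in Hy; apply Rabs_lt_between in Hy; lra.
  - intros s r Hs Hr'; change (Rabs (g r - g s) < eps).
    destruct (Rle_lt_dec s r); [apply Q; lra|rewrite Rabs_minus_sym; apply Q; lra]. }
destruct HC as [L HL]; exists L, K, rho; repeat split; trivial; intros r Hs.
apply le_epsilon; intros eps He.
destruct (proj1 (lim_right_iff _ _) HL eps He) as [d [Hd0 HD]].
set (s := Rmin (d / 2) (r / 2)).
assert (S1 : s <= d / 2) by apply Rmin_l; assert (S2 : s <= r / 2) by apply Rmin_r.
assert (S0 : 0 < s) by (apply Rmin_glb_lt; lra).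
replace (g r - L) with ((g r - g s) + (g s - L)) by ring.
eapply Rle_trans; [apply Rabs_triang|].
assert (B1 := D s r S0 ltac:(lra) ltac:(lra)); assert (B2 := HD s ltac:(lra)); lra.
Qed.

(** The counterpart for a derivative that blows up, integrated inwards from a fixed radius. For both
    signs [sg] the function [sg * g x + K / x ^ S j] is nonincreasing. The power of the derivative
    is at least two, which keeps logarithms out. *)
Lemma derive_blowup (g g' : R -> R) j : (forall r, 0 < r -> is_derive g r (g' r)) ->
  bigO 0 (fun r => g' r * r ^ (S (S j))) -> bigO 0 (fun r => g r * r ^ S j).
Proof.
intros Hd [K [rho [HK [Hr H]]]].
assert (D : forall r s, 0 < r -> r <= s -> s < rho -> Rabs (g s - g r) <= K * / r ^ S j).
{ intros r s H0 Hrs Hs.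
  assert (Hpd : forall c x, 0 < x -> is_derive (fun x => c * / x ^ S j) x
    (- c * INR (S j) * / x ^ S (S j))).
  { intros c x Hx; assert (P : 0 < x ^ j) by (apply pow_lt; trivial).
    auto_derive; [simpl; nra|].
    change (match j with 0%nat => 1 | S _ => INR j + 1 end) with (INR (S j)).
    simpl; field; lra. }
  assert (HJ : 1 <= INR (S j)) by (rewrite S_INR; assert (Z := pos_INR j); lra).
  assert (M : forall sg, sg = 1 \/ sg = -1 -> sg * (g s - g r) <= K * / r ^ S j).
  { intros sg Hsg.
    destruct (MVT_gen (fun x => sg * g x + K * / x ^ S j) r s
       (fun x => sg * g' x + - K * INR (S j) * / x ^ S (S j))) as [x [Hx E]].
    - rewrite Rmin_left, Rmax_right by lra; intros x Hx.
      apply (is_derive_plus (fun x => sg * g x) (fun x => K * / x ^ S j));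
        [apply is_derive_scal, Hd; lra|apply Hpd; lra].
    - rewrite Rmin_left, Rmax_right by lra; intros x Hx.
      apply ex_derive_cont_pt.
      apply (ex_derive_plus (fun x => sg * g x) (fun x => K * / x ^ S j)).
      + apply ex_derive_scal; eexists; apply Hd; lra.
      + eexists; apply Hpd; lra.
    - rewrite Rmin_left, Rmax_right in Hx by lra.
      assert (Px : 0 < x ^ S (S j)) by (apply pow_lt; lra).
      assert (Ps : 0 < / s ^ S j) by (apply Rinv_0_lt_compat, pow_lt; lra).
      assert (B := H x ltac:(lra)); rewrite Rabs_mult, (Rabs_pos_eq (x ^ S (S j))), Rmult_1_r in B
        by lra.
      assert (B' : Rabs (g' x) <= K * / x ^ S (S j)) by (apply Rle_div_r; trivial).
      assert (Pi : 0 < / x ^ S (S j)) by (apply Rinv_0_lt_compat; trivial).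
      assert (N : sg * g' x + - K * INR (S j) * / x ^ S (S j) <= 0).
      { apply Rabs_le_between in B'.
        assert (K * / x ^ S (S j) <= K * INR (S j) * / x ^ S (S j)).
        { apply Rmult_le_compat_r; [lra|]; nra. }
        destruct Hsg as [-> | ->]; lra. }
      assert (sg * g s + K * / s ^ S j - (sg * g r + K * / r ^ S j) <= 0) by (rewrite E; nra).
      assert (0 <= K * / s ^ S j) by (apply Rmult_le_pos; lra).
      lra. }
  apply Rabs_le; split; [assert (Z := M (-1) (or_intror eq_refl));
    lra|assert (Z := M 1 (or_introl eq_refl)); lra]. }
set (s := rho / 2).
exists (K + Rabs (g s) * s ^ S j), s; split.
{ apply Rplus_le_le_0_compat; trivial; apply Rmult_le_pos;
  [apply Rabs_pos|apply pow_le; unfold s; lra]. }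
split; [unfold s; lra|]; intros r Hs.
assert (P : 0 < r ^ S j) by (apply pow_lt; lra).
assert (Ps : r ^ S j <= s ^ S j) by (apply pow_incr; lra).
rewrite Rabs_mult, (Rabs_pos_eq (r ^ S j)), Rmult_1_r by lra.
replace (g r) with (- (g s - g r) + g s) by ring.
apply Rle_trans with ((K * / r ^ S j + Rabs (g s)) * r ^ S j).
- apply Rmult_le_compat_r; [lra|]; eapply Rle_trans; [apply Rabs_triang|].
  rewrite Rabs_Ropp; apply Rplus_le_compat_r, D; unfold s in *; lra.
- rewrite Rmult_plus_distr_r, Rmult_assoc, Rinv_l, Rmult_1_r by lra.
  apply Rplus_le_compat_l, Rmult_le_compat_l; [apply Rabs_pos|trivial].
Qed.

(** * Asymptotics of Euler-type equations *)

(** [r] times the radial Laplacian of angular momentum [m]. Its kernel is spanned by [r ^ m] and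
    [r ^ -m], or by [1] and [ln r] when [m = 0]. *)
Definition euler (m : nat) (y : R -> R) (r : R) : R :=
  r * Derive_n y 2 r + Derive y r - INR m ^ 2 * y r / r.

(** The factorisation of the operator through [r y' + m y]: the equation is solved by two
    first-order integrations, with integrating factors [/ r ^ m] and [r ^ m]. *)
Lemma euler_first m y r : CR 2 y -> 0 < r ->
  is_derive (fun r => (r * Derive y r + INR m * y r) / r ^ m) r (euler m y r / r ^ m) /\
  is_derive (fun r => r ^ m * y r) r (r ^ m * ((r * Derive y r + INR m * y r) / r)).
Proof.
intros Hy Hr; destruct (CR_derives 1 y Hy) as [D1 Hy1]; destruct (CR_derives 0 _ Hy1) as [D2 _].
assert (P : 0 < r ^ m) by (apply pow_lt; trivial).
assert (E1 := CR_ex_derive 1 y r Hy Hr); assert (E2 := CR_ex_derive 0 _ r Hy1 Hr).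
assert (Hpow : is_derive (fun r => r ^ m) r (INR m * r ^ m / r)).
{ destruct m as [|m]; [simpl; replace (0 * 1 / r) with 0 by (field; lra);
    apply (is_derive_const (V := R_NormedModule))|].
  replace (INR (S m) * r ^ S m / r) with (INR (S m) * 1 * r ^ pred (S m))
    by (simpl pred; simpl pow; field; lra).
  apply is_derive_pow, (is_derive_id (K := R_AbsRing)). }
split.
- replace (euler m y r / r ^ m) with
   (((1 * Derive y r + r * Derive_n y 2 r + INR m * Derive y r) * r ^ m
      - (r * Derive y r + INR m * y r) * (INR m * r ^ m / r)) / (r ^ m) ^ 2)
   by (unfold euler; field; lra).
  apply (is_derive_div (fun r => r * Derive y r + INR m * y r) (fun r => r ^ m)); [|exact Hpow|lra].
  auto_derive; [repeat split; trivial|].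
  change (Derive_n y 2 r) with (Derive (fun x => Derive y x) r).
  change (Derive (fun x => y x) r) with (Derive y r); ring.
- replace (r ^ m * ((r * Derive y r + INR m * y r) / r)) with
    (INR m * r ^ m / r * y r + r ^ m * Derive y r) by (field; lra).
  apply (is_derive_mult (fun r => r ^ m) y); [exact Hpow|apply D1, Hr|apply Rmult_comm].
Qed.

(** Below the exponent the source decides the order. The first integrand behaves like [r ^ (i - m)]
    with [m - i >= 2] and is integrated inwards; the second is integrated from the origin, where
    boundedness of [y] forces the constant to vanish, that is, excludes [r ^ -m]. *)
Lemma euler_low m y i : CR 2 y -> bigO 0 y -> (S i < m)%nat -> bigO i (euler m y) -> bigO (S i) y.
Proof.
intros Hy H0 Him HE.
assert (HF := fun r Hr => proj1 (euler_first m y r Hy Hr)).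
assert (HS := fun r Hr => proj2 (euler_first m y r Hy Hr)).
assert (Z : bigO (S i) (fun r => r * Derive y r + INR m * y r)).
{ replace (S i) with ((S i) + 0)%nat by lia.
  assert (B : bigO 0 (fun r => (r * Derive y r + INR m * y r) / r ^ m * r ^ S (m - i - 2))).
  { apply derive_blowup with (1 := HF).
    apply bigO_ext with (fun r => euler m y r / r ^ i).
    - intros r Hr; replace (r ^ m) with (r ^ i * r ^ S (S (m - i - 2))).
      + field; split; apply pow_nonzero; lra.
      + rewrite <- pow_add; f_equal; lia.
    - apply bigO_div_pow; rewrite Nat.add_0_r; exact HE. }
  apply bigO_ext with (fun r => r ^ S i * ((r * Derive y r + INR m * y r) / r ^ m * r ^ S
    (m - i - 2))).
  - intros r Hr; replace (r ^ m) with (r ^ S i * r ^ S (m - i - 2)).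
    + field; split; apply pow_nonzero; lra.
    + rewrite <- pow_add; f_equal; lia.
  - apply (bigO_mult (S i) 0); [lia|apply bigO_pow|exact B]. }
destruct (derive_bigO _ _ (m + i) HS) as [L HL].
{ apply (bigO_mult m i); [lia|apply bigO_pow|apply bigO_div, Z]. }
assert (L = 0).
{ apply (bigO_coef 0).
  apply bigO_ext with (fun r => r ^ m * y r - (r ^ m * y r - L)); [intros; simpl; ring|].
  apply bigO_minus; [apply (bigO_mult m 0); [lia|apply bigO_pow|exact H0]|].
  apply bigO_weaken with (2 := HL); lia. }
subst L; apply bigO_ext with (fun r => (r ^ m * y r - 0) / r ^ m).
- intros r Hr; field; apply pow_nonzero; lra.
- apply bigO_div_pow; replace (m + S i)%nat with (S (m + i)) by lia; exact HL.
Qed.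

Lemma ln_unbounded Z : bigO 0 (fun r => Z * ln r) -> Z = 0.
Proof.
intros [K [rho [HK [Hr H]]]].
destruct (Req_dec Z 0) as [|HZ]; trivial; exfalso.
assert (HZ' : 0 < Rabs Z) by (apply Rabs_pos_lt; trivial).
set (x := (K + 1) / Rabs Z).
assert (Hx : 0 < x) by (apply Rdiv_lt_0_compat; lra).
set (r := Rmin (rho / 2) (exp (- x))).
assert (R1 : r <= rho / 2) by apply Rmin_l; assert (R2 : r <= exp (- x)) by apply Rmin_r.
assert (R0 : 0 < r) by (apply Rmin_glb_lt; [lra|apply exp_pos]).
assert (Hl : ln r <= - x).
{ rewrite <- (ln_exp (- x)); destruct R2 as [R2|R2];
  [left; apply ln_increasing; trivial|rewrite R2; lra]. }
specialize (H r ltac:(lra)); rewrite Rabs_mult, (Rabs_left (ln r)) in H by lra.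
simpl in H; assert (K + 1 <= Rabs Z * - ln r).
{ replace (K + 1) with (Rabs Z * x) by (unfold x; field; lra).
  apply Rmult_le_compat_l; lra. }
lra.
Qed.

(** From the exponent on, both integrations start at the origin, and the constant [Z] of the first
    one becomes the coefficient of [r ^ m]. For [m = 0] it would multiply [ln r] and is excluded by
    boundedness; there the truncated exponent [m - 1] is harmless, being multiplied by zero. *)
Lemma euler_high m y i : CR 2 y -> bigO 0 y -> (m <= i)%nat -> bigO i (euler m y) ->
  exists Y, bigO (S i) (fun r => y r - Y * r ^ m) /\
    bigO i (fun r => Derive y r - INR m * Y * r ^ (m - 1)).
Proof.
intros Hy H0 Him HE.
assert (HF := fun r Hr => proj1 (euler_first m y r Hy Hr)).
assert (HS := fun r Hr => proj2 (euler_first m y r Hy Hr)).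
destruct (derive_bigO _ _ (i - m) HF) as [Z HZ].
{ apply bigO_div_pow; replace (m + (i - m))%nat with i by lia; exact HE. }
assert (HZ' : bigO (S i) (fun r => r * Derive y r + INR m * y r - Z * r ^ m)).
{ apply bigO_ext with (fun r => r ^ m * ((r * Derive y r + INR m * y r) / r ^ m - Z)).
  - intros r Hr; field; apply pow_nonzero; lra.
  - apply (bigO_mult m (S (i - m))); [lia|apply bigO_pow|exact HZ]. }
clear HZ; destruct m as [|m].
- assert (HD : bigO i (fun r => Derive y r - Z / r)).
  { apply bigO_ext with (2 := bigO_div _ _ HZ'); intros r Hr; simpl; field; lra. }
  destruct (derive_bigO (fun r => y r - Z * ln r) (fun r => Derive y r - Z / r) i) as [L HL];
    trivial.
  { intros r Hr; apply (is_derive_minus y (fun r => Z * ln r)); [apply (CR_derives 1 y Hy), Hr|].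
    apply is_derive_scal, is_derive_ln, Hr. }
  assert (Z = 0).
  { apply ln_unbounded, bigO_ext with (fun r => y r - ((y r - Z * ln r - L) + L)); [intros; ring|].
    apply bigO_minus; trivial; apply bigO_plus; [apply bigO_weaken with (2 := HL);
      lia|apply bigO_const]. }
  subst Z; exists L; split.
  + apply bigO_ext with (2 := HL); intros; simpl; ring.
  + apply bigO_ext with (2 := HD); intros; simpl; field; lra.
- assert (HM : INR (S m) <> 0) by (apply not_0_INR; lia).
  set (M := S m) in *.
  (* On [Y r ^ M] the first-order factor [r y' + M y] equals [2 M Y r ^ M], which has to match
     [Z r ^ M]. *)
  set (Y := Z / (2 * INR M)).
  assert (HY : bigO (S i) (fun r => y r - Y * r ^ M)).
  { destruct (derive_bigO (fun r => r ^ M * y r - Y * r ^ (2 * M))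
      (fun r => r ^ M * ((r * Derive y r + INR M * y r) / r) - Y *
        (INR (2 * M) * 1 * r ^ pred (2 * M))) (M + i)) as [L HL].
    - intros r Hr; apply (is_derive_minus (fun r => r ^ M * y r) (fun r => Y * r ^ (2 * M)));
      [apply HS, Hr|].
      apply is_derive_scal, is_derive_pow, (is_derive_id (K := R_AbsRing)).
    - apply bigO_ext with (fun r => r ^ M * ((r * Derive y r + INR M * y r - Z * r ^ M) / r)).
      + intros r Hr.
        assert (E : r ^ (2 * M) = r * r ^ pred (2 * M)) by reflexivity.
        assert (E2 : r ^ M * r ^ M = r * r ^ pred (2 * M)).
        { rewrite <- E, <- pow_add; f_equal; lia. }
        replace (r ^ M * ((r * Derive y r + INR M * y r - Z * r ^ M) / r)) with
          (r ^ M * ((r * Derive y r + INR M * y r) / r) - Z * (r ^ M * r ^ M) / r) by (field; lra).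
        rewrite E2, mult_INR; unfold Y; change (INR 2) with 2; field; split; trivial; lra.
      + apply (bigO_mult M i); [lia|apply bigO_pow|apply bigO_div, HZ'].
    - assert (L = 0).
      { apply (bigO_coef 0).
        apply bigO_ext with (fun r => r ^ M * y r - Y * r ^ (2 * M) -
          (r ^ M * y r - Y * r ^ (2 * M) - L)); [intros; simpl; ring|].
        apply bigO_minus; [apply bigO_minus|].
        - apply (bigO_mult M 0); [unfold M; lia|apply bigO_pow|exact H0].
        - apply bigO_scal, bigO_weaken with (2 * M)%nat; [unfold M; lia|apply bigO_pow].
        - apply bigO_weaken with (2 := HL); unfold M; lia. }
      subst L; apply bigO_ext with (fun r => (r ^ M * y r - Y * r ^ (2 * M) - 0) / r ^ M).
      + intros r Hr; replace (2 * M)%nat with (M + M)%nat by lia; rewrite pow_add; field;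
        apply pow_nonzero; lra.
      + apply bigO_div_pow; replace (M + S i)%nat with (S (M + i)) by lia; exact HL. }
  exists Y; split; trivial.
  apply bigO_ext with (fun r => ((r * Derive y r + INR M * y r - Z * r ^ M) - INR M *
    (y r - Y * r ^ M)) / r).
  + intros r Hr; replace (M - 1)%nat with m by (unfold M; lia).
    replace (r ^ M) with (r * r ^ m) by reflexivity; unfold Y; field; split; trivial; lra.
  + apply bigO_div, bigO_minus; trivial; apply bigO_scal, HY.
Qed.

Lemma bigO_id : bigO 1 (fun r => r).
Proof. apply bigO_ext with (2 := bigO_pow 1); intros; ring. Qed.

Lemma bigO_split d m y Y : (d <= m)%nat -> bigO d (fun r => y r - Y * r ^ m) -> bigO d y.
Proof.
intros Hd H; apply bigO_ext with (fun r => (y r - Y * r ^ m) + Y * r ^ m); [intros; ring|].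
apply bigO_plus; trivial; apply bigO_scal, bigO_weaken with (1 := Hd), bigO_pow.
Qed.

(** * Leading orders of the scalar profiles of a mode *)

Section Asymptotics.

Variables (n : nat) (lambda : R) (f beta : R -> R).
Hypotheses (Hv : vortex_profiles n lambda f beta) (Hn : (1 <= n)%nat).

Lemma beta_bigO : bigO 2 beta.
Proof. destruct (beta_origin n lambda f beta Hv) as [c Hc]; apply bigO_lim with c, Hc. Qed.

Lemma f_bigO : bigO n f.
Proof. destruct (f_origin n lambda f beta Hv) as [d [_ Hd]]; apply bigO_lim with d, Hd. Qed.

(** The expansion is not differentiated: [f] solves an Euler equation of exponent [n] with a source
    of order [n], and [euler_high] controls the derivative along with the value. Comparison with the
    expansion shows [D] nonzero. *)
Lemma f_asymptotics : exists D, D <> 0 /\ bigO (S n) (fun r => f r - D * r ^ n) /\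
  bigO n (fun r => Derive f r - INR n * D * r ^ (n - 1)).
Proof.
assert (Hf := f_bigO); assert (Hb := beta_bigO).
assert (Hf0 : bigO 0 f) by (apply bigO_weaken with (2 := Hf); lia).
destruct (euler_high n f n (CR_f n lambda f beta Hv) Hf0 (le_n n)) as [D [H1 H2]].
{ apply bigO_ext with (fun r => INR n ^ 2 * (beta r / r) * ((beta r - 2) * f r)
     - lambda / 2 * (r * ((1 - f r * f r) * f r))).
  - intros r Hr; unfold euler; rewrite (f_ode n lambda f beta Hv r Hr); field; lra.
  - apply bigO_minus.
    + apply (bigO_mult 1 n); [lia| |].
      * apply bigO_scal, bigO_div, Hb.
      * apply (bigO_mult 0 n); [lia| |exact Hf].
        apply bigO_minus; [apply bigO_weaken with (2 := Hb); lia|apply bigO_const].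
    + apply bigO_scal, (bigO_mult 1 n); [lia|apply bigO_id|].
      apply (bigO_mult 0 n); [lia| |exact Hf].
      apply bigO_minus; [apply bigO_const|apply (bigO_mult 0 0); trivial]. }
exists D; split; [|split; trivial].
destruct (f_origin n lambda f beta Hv) as [d [Hd Ld]].
rewrite <- (right_unique _ _ _ Ld (lim_bigO n f D H1)); exact Hd.
Qed.

Lemma df_bigO : bigO n (fun r => r * Derive f r).
Proof.
destruct f_asymptotics as [D [_ [_ H]]].
apply bigO_ext with (fun r => r * (Derive f r - INR n * D * r ^ (n - 1)) + INR n * D * r ^ n).
- intros r Hr; replace (r ^ n) with (r * r ^ (n - 1)).
  + ring.
  + rewrite tech_pow_Rmult; f_equal; lia.
- apply bigO_plus; [apply (bigO_mult 1 n); [lia|apply bigO_id|exact H]|apply bigO_scal, bigO_pow].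
Qed.

Variables (w2 : R) (k : nat) (e g u h : R -> R).
Hypotheses (Hk : (1 <= k)%nat) (Cu : CR 2 u) (Ch : CR 2 h)
  (HS : mode_system n lambda f beta w2 k e g u h)
  (Oe : bigO (k - 1) e) (Og : bigO (k - 1) g) (Ou : bigO 0 u) (Oh : bigO 0 h).

(** At the origin the angular terms act on [(u, h)] through the matrix with [n ^ 2 + k ^ 2] on the
    diagonal and [- 2 n k] off it. Sum and difference diagonalise it, with eigenvalues [(n - k) ^ 2]
    and [(n + k) ^ 2]. *)
Let p r := u r + h r.
Let q r := u r - h r.
Let m := Z.abs_nat (Z.of_nat n - Z.of_nat k).
Let M := (n + k)%nat.

(** The exponents differ by twice the smaller of [n] and [k]. The gap allows one more pass at order
    [m] before the order [M - 1] of the vector source is exceeded. *)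
Let mM : (m + 2 <= M)%nat. Proof. unfold m, M; lia. Qed.

Let m_sq : INR m ^ 2 = (INR n - INR k) ^ 2.
Proof.
unfold m; rewrite <- !Rsqr_pow2, !INR_IZR_INZ, Zabs2Nat.id_abs, abs_IZR, <- Rsqr_abs, minus_IZR.
reflexivity.
Qed.

(** What is left once the squared exponents are split off: [n ^ 2 (1 - beta) ^ 2 + k ^ 2 - 2 n k (1
    - beta) = (n - k) ^ 2 + beta * ap], and likewise [aq] for [n + k]. [Sp] and [Sq] are the sources
    made by the vector part. *)
Let ap r := INR n ^ 2 * (beta r - 2) + 2 * INR n * INR k.
Let aq r := INR n ^ 2 * (beta r - 2) - 2 * INR n * INR k.
Let bu r := 3 * lambda / 2 * (f r * f r) - lambda / 2 - w2.
Let bh r := (1 + lambda / 2) * (f r * f r) - lambda / 2 - w2.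
Let Sp r := 2 * INR n * ((1 - beta r) * (f r * e r)) + 2 * (r * Derive f r * g r).
Let Sq r := 2 * INR n * ((1 - beta r) * (f r * e r)) - 2 * (r * Derive f r * g r).

Lemma mode_second r : 0 < r ->
  Derive_n u 2 r = - Derive u r / r + INR k ^ 2 / r ^ 2 * u r
     - 2 * INR n * INR k * (1 - beta r) / r ^ 2 * h r
     + (INR n ^ 2 * (1 - beta r) ^ 2 / r ^ 2 + 3 * lambda / 2 * f r ^ 2 - lambda / 2 - w2) * u r
     + 2 * INR n * (1 - beta r) * f r / r * e r /\
  Derive_n h 2 r = - Derive h r / r + INR k ^ 2 / r ^ 2 * h r
     - 2 * INR n * INR k * (1 - beta r) / r ^ 2 * u r
     + (INR n ^ 2 * (1 - beta r) ^ 2 / r ^ 2 + f r ^ 2 + lambda / 2 * f r ^ 2 - lambda / 2 - w2) * h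
       r
     + 2 * Derive f r * g r.
Proof.
intros Hr; destruct (HS r Hr) as [_ [_ [E1 [E2 _]]]]; unfold Ku, Kh, Lop in *; split; lra.
Qed.

Lemma Derive_pq r : 0 < r ->
  Derive p r = Derive u r + Derive h r /\ Derive_n p 2 r = Derive_n u 2 r + Derive_n h 2 r /\
  Derive q r = Derive u r - Derive h r /\ Derive_n q 2 r = Derive_n u 2 r - Derive_n h 2 r.
Proof.
intros Hr.
destruct (CR_derives 1 u Cu) as [_ Du]; destruct (CR_derives 1 h Ch) as [_ Dh].
assert (F1 : forall r, 0 < r -> Derive p r = Derive u r + Derive h r).
{ intros s Hs; apply Derive_plus; [apply (CR_ex_derive 1); trivial|apply (CR_ex_derive 1);
  trivial]. }
assert (F2 : forall r, 0 < r -> Derive q r = Derive u r - Derive h r).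
{ intros s Hs; apply Derive_minus; [apply (CR_ex_derive 1); trivial|apply (CR_ex_derive 1);
  trivial]. }
split; [apply F1, Hr|split; [|split; [apply F2, Hr|]]].
- transitivity (Derive (fun r => Derive u r + Derive h r) r).
  + apply Derive_ext_loc; generalize (locally_pos r Hr); apply filter_imp; exact F1.
  + apply Derive_plus; [apply (CR_ex_derive 0 _ r Du Hr)|apply (CR_ex_derive 0 _ r Dh Hr)].
- transitivity (Derive (fun r => Derive u r - Derive h r) r).
  + apply Derive_ext_loc; generalize (locally_pos r Hr); apply filter_imp; exact F2.
  + apply Derive_minus; [apply (CR_ex_derive 0 _ r Du Hr)|apply (CR_ex_derive 0 _ r Dh Hr)].
Qed.

Lemma euler_p r : 0 < r ->
  euler m p r = beta r / r * (ap r * p r) + r * (bu r * u r + bh r * h r) + Sp r.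
Proof.
intros Hr; destruct (Derive_pq r Hr) as [D1 [D2 _]]; destruct (mode_second r Hr) as [E1 E2].
unfold euler; rewrite m_sq, D1, D2, E1, E2; unfold p, ap, bu, bh, Sp; field; lra.
Qed.

Lemma euler_q r : 0 < r ->
  euler M q r = beta r / r * (aq r * q r) + r * (bu r * u r - bh r * h r) + Sq r.
Proof.
intros Hr; destruct (Derive_pq r Hr) as [_ [_ [D1 D2]]]; destruct (mode_second r Hr) as [E1 E2].
unfold euler, M; rewrite plus_INR, D1, D2, E1, E2; unfold q, aq, bu, bh, Sq; field; lra.
Qed.

Let Cp : CR 2 p. Proof. apply CR_plus; assumption. Qed.
Let Cq : CR 2 q. Proof. apply CR_minus; assumption. Qed.
Let Op : bigO 0 p. Proof. apply bigO_plus; assumption. Qed.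
Let Oq : bigO 0 q. Proof. apply bigO_minus; assumption. Qed.

Lemma uh_of_pq j : bigO j p -> bigO j q -> bigO j u /\ bigO j h.
Proof.
intros H1 H2; split.
- apply bigO_ext with (fun r => / 2 * (p r + q r)); [intros; unfold p, q; field|].
  apply bigO_scal, bigO_plus; assumption.
- apply bigO_ext with (fun r => / 2 * (p r - q r)); [intros; unfold p, q; field|].
  apply bigO_scal, bigO_minus; assumption.
Qed.

Lemma Sfe : bigO (M - 1) (fun r => 2 * INR n * ((1 - beta r) * (f r * e r))).
Proof.
apply bigO_scal, (bigO_mult 0 (M - 1)); [lia| |].
- apply bigO_minus; [apply bigO_const|apply bigO_weaken with (2 := beta_bigO); lia].
- apply (bigO_mult n (k - 1)); [unfold M; lia|apply f_bigO|exact Oe].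
Qed.

Lemma Sdg : bigO (M - 1) (fun r => 2 * (r * Derive f r * g r)).
Proof.
apply bigO_scal, (bigO_mult n (k - 1)); [unfold M; lia|apply df_bigO|exact Og].
Qed.

(** The gain of one order that drives the bootstrap: both [beta / r] and the factor [r] are of order
    one. *)
Lemma regular_part j a b y : bigO 0 a -> bigO j u -> bigO j h -> bigO j y ->
  (b = (fun r => bu r * u r + bh r * h r) \/ b = (fun r => bu r * u r - bh r * h r)) ->
  bigO (S j) (fun r => beta r / r * (a r * y r) + r * b r).
Proof.
intros Ha Hu Hh Hy Hb.
assert (Off : bigO 0 (fun r => f r * f r)).
{ apply (bigO_mult n n); [lia|apply f_bigO|apply f_bigO]. }
assert (B1 : bigO 0 bu).
{ unfold bu; apply bigO_minus; [apply bigO_minus; [apply bigO_scal, Off|]|]; apply bigO_const. }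
assert (B2 : bigO 0 bh).
{ unfold bh; apply bigO_minus; [apply bigO_minus; [apply bigO_scal, Off|]|]; apply bigO_const. }
apply bigO_plus.
- apply (bigO_mult 1 j); [lia|apply bigO_div, beta_bigO|].
  apply (bigO_mult 0 j); [lia|exact Ha|exact Hy].
- apply (bigO_mult 1 j); [lia|apply bigO_id|].
  destruct Hb as [-> | ->]; [apply bigO_plus|apply bigO_minus]; apply (bigO_mult 0 j); trivial; lia.
Qed.

Let Oap : bigO 0 ap.
Proof.
unfold ap; apply bigO_plus; [apply bigO_scal, bigO_minus|]; try apply bigO_const.
apply bigO_weaken with (2 := beta_bigO); lia.
Qed.

Let Oaq : bigO 0 aq.
Proof.
unfold aq; apply bigO_minus; [apply bigO_scal, bigO_minus|]; try apply bigO_const.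
apply bigO_weaken with (2 := beta_bigO); lia.
Qed.

Lemma euler_pq_bound j : bigO j p -> bigO j q -> (S j <= M - 1)%nat ->
  bigO (S j) (euler m p) /\ bigO (S j) (euler M q).
Proof.
intros Hp Hq Hj; destruct (uh_of_pq j Hp Hq) as [Hu Hh].
assert (S1 : bigO (S j) (fun r => 2 * INR n * ((1 - beta r) * (f r * e r))))
  by (apply bigO_weaken with (2 := Sfe); lia).
assert (S2 : bigO (S j) (fun r => 2 * (r * Derive f r * g r)))
  by (apply bigO_weaken with (2 := Sdg); lia).
split.
- eapply bigO_ext; [intros r Hr; symmetry; apply euler_p, Hr|].
  apply bigO_plus; [apply (regular_part j ap _ p); auto|apply bigO_plus; assumption].
- eapply bigO_ext; [intros r Hr; symmetry; apply euler_q, Hr|].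
  apply bigO_plus; [apply (regular_part j aq _ q); auto|apply bigO_minus; assumption].
Qed.

Lemma low_order_bootstrap j : (j <= m)%nat -> bigO j p /\ bigO j q.
Proof.
induction j as [|j IH]; intros Hj; [auto|].
destruct (IH ltac:(lia)) as [Hp Hq].
destruct (euler_pq_bound j Hp Hq ltac:(lia)) as [E1 E2].
split.
(* At the last step the exponent of [p] is reached: [euler_low] no longer applies, and a term in
   [r ^ m] may appear, which is still of the required order. *)
- destruct (Nat.eq_dec (S j) m) as [Ej|Ej].
  + destruct (euler_high m p (S j) Cp Op ltac:(lia) E1) as [P [HP _]].
    apply bigO_split with m P; [lia|]; apply bigO_weaken with (2 := HP); lia.
  + apply (euler_low m); trivial; [lia|]; apply bigO_weaken with (2 := E1); lia.
- apply (euler_low M); trivial; [lia|]; apply bigO_weaken with (2 := E2); lia.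
Qed.

(** Only [p] can keep a term in [r ^ m]: the exponent [M] of [q] lies further up, so [q] gains
    another order. *)
Lemma leading_coefficient : exists P, bigO (S m) (fun r => p r - P * r ^ m) /\ bigO (S m) q.
Proof.
destruct (low_order_bootstrap m (le_n m)) as [Hp Hq].
destruct (euler_pq_bound m Hp Hq ltac:(lia)) as [E1 E2].
destruct (euler_high m p (S m) Cp Op ltac:(lia) E1) as [P [HP _]].
exists P; split; [apply bigO_weaken with (2 := HP); lia|].
apply (euler_low M); trivial; [lia|]; apply bigO_weaken with (2 := E2); lia.
Qed.

(** A function already of order [S m] has no component along [r ^ m], and above [m] the order
    follows the source. *)
Lemma high_no_leading y i : CR 2 y -> bigO (S m) y -> (S m <= i)%nat -> bigO i (euler m y) ->
  bigO (S i) y.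
Proof.
intros Cy Hy Hi HE.
destruct (euler_high m y i Cy) as [Y [HY _]]; trivial; [apply bigO_weaken with (2 := Hy); lia|lia|].
assert (Y = 0).
{ apply (bigO_coef m); apply bigO_ext with (fun r => y r - (y r - Y * r ^ m)); [intros; ring|].
  apply bigO_minus; trivial; apply bigO_weaken with (2 := HY); lia. }
subst Y; apply bigO_ext with (2 := HY); intros; ring.
Qed.

(** The bootstrap ends at [M - 1], the order of the source made by the vector part. *)
Lemma high_order_bootstrap j : bigO (S m) p -> bigO (S m) q -> (S m <= j <= M - 1)%nat ->
  bigO j p /\ bigO j q.
Proof.
intros Hp0 Hq0 [H1 H2]; induction H1 as [|j H1 IH]; [auto|].
destruct (IH ltac:(lia)) as [Hp Hq].
destruct (euler_pq_bound j Hp Hq ltac:(lia)) as [E1 E2]; split.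
- apply bigO_weaken with (S (S j)); [lia|]; apply high_no_leading; trivial; lia.
- apply (euler_low M); trivial; [lia|]; apply bigO_weaken with (2 := E2); lia.
Qed.

(** With the term in [r ^ m] absent, the vector part determines the next one: the contributions of
    [e] and [g] to the source of [p] add up to [4 n D V r ^ (M - 1)], which forces a nonzero
    multiple of [r ^ M]. The coefficient [Q] of [q] is that of a homogeneous solution and remains
    free. *)
Lemma subleading V : bigO (S m) p -> bigO (S m) q ->
  bigO k (fun r => e r - V * r ^ (k - 1)) -> bigO k (fun r => g r - V * r ^ (k - 1)) -> V <> 0 ->
  exists P Q, P <> 0 /\ bigO (S M) (fun r => p r - P * r ^ M) /\
    bigO (S M) (fun r => q r - Q * r ^ M).
Proof.
intros Hp0 Hq0 HE HG HV.
destruct (high_order_bootstrap (M - 1) Hp0 Hq0 ltac:(lia)) as [Hp Hq].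
destruct (uh_of_pq _ Hp Hq) as [Hu Hh].
destruct f_asymptotics as [D [HD [Of Odf]]].
assert (HM : S (M - 1) = M) by lia.
assert (Fe : bigO M (fun r => (1 - beta r) * (f r * e r) - D * V * r ^ (M - 1))).
{ apply bigO_ext with (fun r => (f r - D * r ^ n) * e r + D * (r ^ n * (e r - V * r ^ (k - 1))) -
  beta r * (f r * e r)).
  - intros r Hr; replace (r ^ (M - 1)) with (r ^ n * r ^ (k - 1))
    by (rewrite <- pow_add; f_equal; unfold M; lia).
    ring.
  - apply bigO_minus; [apply bigO_plus|].
    + apply (bigO_mult (S n) (k - 1)); trivial; unfold M; lia.
    + apply bigO_scal, (bigO_mult n k); [unfold M; lia|apply bigO_pow|exact HE].
    + apply (bigO_mult 2 (M - 1)); [lia|apply beta_bigO|].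
      apply (bigO_mult n (k - 1)); [unfold M; lia|apply f_bigO|exact Oe]. }
assert (Fg : bigO M (fun r => r * Derive f r * g r - INR n * D * V * r ^ (M - 1))).
{ apply bigO_ext with (fun r => r * (Derive f r - INR n * D * r ^ (n - 1)) * g r + INR n * D *
  (r ^ n * (g r - V * r ^ (k - 1)))).
  - intros r Hr; replace (r ^ (M - 1)) with (r ^ n * r ^ (k - 1))
    by (rewrite <- pow_add; f_equal; unfold M; lia).
    replace (r ^ n) with (r * r ^ (n - 1)) by (rewrite tech_pow_Rmult; f_equal; lia). ring.
  - apply bigO_plus.
    + apply (bigO_mult (S n) (k - 1)); trivial; [unfold M; lia|].
      apply (bigO_mult 1 n); [lia|apply bigO_id|exact Odf].
    + apply bigO_scal, (bigO_mult n k); [unfold M; lia|apply bigO_pow|exact HG]. }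
(* In the difference of the two vector contributions the leading terms [2 n D V r ^ (M - 1)] cancel.
   A surviving term would be resonant with the exponent [M] and produce a logarithm. *)
assert (Eq : bigO M (euler M q)).
{ eapply bigO_ext; [intros r Hr; symmetry; apply euler_q, Hr|].
  apply bigO_plus; [rewrite <- HM; apply (regular_part (M - 1) aq _ q); auto|].
  apply bigO_ext with (fun r => 2 * INR n * ((1 - beta r) * (f r * e r) - D * V * r ^ (M - 1))
     - 2 * (r * Derive f r * g r - INR n * D * V * r ^ (M - 1))); [intros; unfold Sq; ring|].
  apply bigO_minus; apply bigO_scal; assumption. }
destruct (euler_high M q M Cq Oq (le_n M) Eq) as [Q [HQ _]].
assert (HkR : INR k <> 0) by (apply not_0_INR; lia).
(* Since [M ^ 2 - m ^ 2 = 4 n k], the operator [euler m] maps [P r ^ M] to [4 n D V r ^ (M - 1)],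
   the leading part of the source of [p]. *)
set (P := D * V / INR k).
set (y := fun r => p r - P * r ^ M).
assert (Cpow : CR 2 (fun r => P * r ^ M)) by (apply CR_scal, CR_pow, CR_id).
assert (Cy : CR 2 y) by (apply CR_minus; assumption).
assert (Oy : bigO (S m) y).
{ apply bigO_minus; trivial; apply bigO_scal, bigO_weaken with M; [lia|apply bigO_pow]. }
assert (Ey : bigO M (euler m y)).
{ apply bigO_ext with (fun r => (beta r / r * (ap r * p r) + r * (bu r * u r + bh r * h r))
    + (2 * INR n * ((1 - beta r) * (f r * e r) - D * V * r ^ (M - 1))
     + 2 * (r * Derive f r * g r - INR n * D * V * r ^ (M - 1)))).
  - intros r Hr.
    assert (D1 : forall r, 0 < r -> Derive y r = Derive p r - P * (INR M * r ^ (M - 1))).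
    { intros s Hs; unfold y; rewrite Derive_minus, Derive_scal.
      - f_equal; f_equal; replace (M - 1)%nat with (pred M) by lia.
        apply is_derive_unique; replace (INR M * s ^ pred M) with (INR M * 1 * s ^ pred M) by ring.
        apply is_derive_pow, (is_derive_id (K := R_AbsRing)).
      - apply (CR_ex_derive 1); trivial.
      - apply (CR_ex_derive 1 _ s Cpow Hs). }
    assert (D2 : Derive_n y 2 r = Derive_n p 2 r - P * (INR M * (INR (M - 1) * r ^ (M - 2)))).
    { transitivity (Derive (fun r => Derive p r - P * (INR M * r ^ (M - 1))) r).
      - apply Derive_ext_loc; generalize (locally_pos r Hr); apply filter_imp; exact D1.
      - assert (X : is_derive (fun r => P * (INR M * r ^ (M - 1))) r
        (P * (INR M * (INR (M - 1) * 1 * r ^ pred (M - 1))))).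
        { apply is_derive_scal, is_derive_scal, is_derive_pow, (is_derive_id (K := R_AbsRing)). }
        rewrite Rmult_1_r in X; replace (pred (M - 1)) with (M - 2)%nat in X by lia.
        rewrite (Derive_minus (Derive p) (fun r => P * (INR M * r ^ (M - 1)))).
        + f_equal; apply is_derive_unique, X.
        + apply (CR_ex_derive 0 _ r (proj2 (CR_derives 1 p Cp)) Hr).
        + eexists; exact X. }
    assert (Ep := euler_p r Hr); unfold euler in Ep.
    transitivity (beta r / r * (ap r * p r) + r * (bu r * u r + bh r * h r) + Sp r
       - 4 * INR n * D * V * r ^ (M - 1)); [unfold Sp; ring|].
    unfold euler; rewrite <- Ep, (D1 r Hr), D2.
    replace (y r) with (p r - P * r ^ M) by reflexivity.
    replace (r ^ M) with (r * (r * r ^ (M - 2))) by (rewrite !tech_pow_Rmult; f_equal; lia).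
    replace (r ^ (M - 1)) with (r * r ^ (M - 2)) by (rewrite !tech_pow_Rmult; f_equal; lia).
    rewrite minus_INR by lia; change (INR 1) with 1; rewrite m_sq; unfold M; rewrite plus_INR.
    unfold P; field; split; trivial; lra.
  - apply bigO_plus; [rewrite <- HM; apply (regular_part (M - 1) ap _ p); auto|].
    apply bigO_plus; apply bigO_scal; assumption. }
exists P, Q; split; [|split; trivial].
- unfold P; apply Rmult_integral_contrapositive; split; [|apply Rinv_neq_0_compat; trivial].
  apply Rmult_integral_contrapositive; split; trivial.
- apply (high_no_leading y M); trivial; lia.
Qed.

Lemma halves d P Q : bigO (S d) (fun r => p r - P * r ^ d) ->
  bigO (S d) (fun r => q r - Q * r ^ d) ->
  filterlim (fun r => u r / r ^ d) (at_right 0) (locally ((P + Q) / 2)) /\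
  filterlim (fun r => h r / r ^ d) (at_right 0) (locally ((P - Q) / 2)).
Proof.
intros HP HQ; split; apply lim_bigO.
- apply bigO_ext with (fun r => / 2 * ((p r - P * r ^ d) + (q r - Q * r ^ d)));
  [intros; unfold p, q; field|].
  apply bigO_scal, bigO_plus; assumption.
- apply bigO_ext with (fun r => / 2 * ((p r - P * r ^ d) - (q r - Q * r ^ d)));
  [intros; unfold p, q; field|].
  apply bigO_scal, bigO_minus; assumption.
Qed.

(** The common amplitude [V] of [e] and [g] is required only for small [u] and [h]: it is used when
    [p] has no term in [r ^ m], and only then is it known to exist. The limits [U] and [H] add up to
    the leading coefficient of [p], so they are not both zero. *)
Lemma scalar_exponents V :
  (bigO (M - 1) u -> bigO (M - 1) h ->
     bigO k (fun r => e r - V * r ^ (k - 1)) /\ bigO k (fun r => g r - V * r ^ (k - 1)) /\ V <> 0)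
       ->
  exists d U H, (d = m \/ d = M) /\ (U <> 0 \/ H <> 0) /\
    filterlim (fun r => u r / r ^ d) (at_right 0) (locally U) /\
    filterlim (fun r => h r / r ^ d) (at_right 0) (locally H).
Proof.
intros HV; destruct leading_coefficient as [P [HP HQ]].
assert (Fin : forall d P Q, P <> 0 -> (d = m \/ d = M) ->
  bigO (S d) (fun r => p r - P * r ^ d) -> bigO (S d) (fun r => q r - Q * r ^ d) ->
  exists d U H, (d = m \/ d = M) /\ (U <> 0 \/ H <> 0) /\
    filterlim (fun r => u r / r ^ d) (at_right 0) (locally U) /\
    filterlim (fun r => h r / r ^ d) (at_right 0) (locally H)).
{ intros d P' Q' NP Hd B1 B2; destruct (halves d P' Q' B1 B2) as [L1 L2].
  exists d, ((P' + Q') / 2), ((P' - Q') / 2); split; [exact Hd|split; [|split; assumption]].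
  destruct (Req_dec ((P' + Q') / 2) 0); [right; lra|left; trivial]. }
destruct (Req_dec P 0) as [HP0|HP0].
- subst P.
  assert (HP' : bigO (S m) p) by (apply bigO_ext with (2 := HP); intros; ring).
  destruct (high_order_bootstrap (M - 1) HP' HQ ltac:(lia)) as [Hp Hq].
  destruct (uh_of_pq _ Hp Hq) as [Hu Hh].
  destruct (HV Hu Hh) as [HE [HG HV0]].
  destruct (subleading V HP' HQ HE HG HV0) as [P [Q [NP [B1 B2]]]].
  apply (Fin M P Q); auto.
- apply (Fin m P 0); auto; apply bigO_ext with (2 := HQ); intros; ring.
Qed.

End Asymptotics.

(** * The classes of multipolar modes *)

Lemma mode_scalar_behaves n k e g u h xi (l : Z) U H : (1 <= k)%nat -> is_mode n 1 0 k e g u h xi ->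
  filterlim (fun r => u r / powerRZ r l) (at_right 0) (locally U) ->
  filterlim (fun r => h r / powerRZ r l) (at_right 0) (locally H) -> (U <> 0 \/ H <> 0) ->
  scalar_behaves_as xi l.
Proof.
intros Hk HM LU LH HN; destruct (angle_exists k Hk) as [tc [ts [Hc Hs]]].
exists (fun t => (cos (INR n * t) * Cos 1 0 k t) * U + (sin (INR n * t) * Sin 1 0 k t) * H),
  (fun t => (sin (INR n * t) * Cos 1 0 k t) * U + (- cos (INR n * t) * Sin 1 0 k t) * H).
split; [|split].
- intros t; apply right_ext with (2 := filterlim_lin (at_right 0) _ _ _ _
  (cos (INR n * t) * Cos 1 0 k t) (sin (INR n * t) * Sin 1 0 k t) LU LH).
  intros r Hr; destruct (HM r t Hr) as [_ [_ [Q _]]]; unfold pol in Q; rewrite Q; unfold Rdiv; ring.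
- intros t; apply right_ext with (2 := filterlim_lin (at_right 0) _ _ _ _
  (sin (INR n * t) * Cos 1 0 k t) (- cos (INR n * t) * Sin 1 0 k t) LU LH).
  intros r Hr; destruct (HM r t Hr) as [_ [_ [_ Q]]]; unfold pol in Q; rewrite Q; unfold Rdiv; ring.
- assert (HT : forall t, cos (INR n * t) ^ 2 = 1 - sin (INR n * t) ^ 2)
    by (intros t; assert (Z := pow_sin_cos (INR n * t)); lra).
  set (A := fun t => (cos (INR n * t) * Cos 1 0 k t) * U + (sin (INR n * t) * Sin 1 0 k t) * H).
  set (B := fun t => (sin (INR n * t) * Cos 1 0 k t) * U + (- cos (INR n * t) * Sin 1 0 k t) * H).
  assert (K1 : forall t, cos (INR n * t) * A t + sin (INR n * t) * B t = Cos 1 0 k t * U)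
    by (intros t; unfold A, B; ring [(HT t)]).
  assert (K2 : forall t, sin (INR n * t) * A t - cos (INR n * t) * B t = Sin 1 0 k t * H)
    by (intros t; unfold A, B; ring [(HT t)]).
  destruct HN as [HN|HN]; [exists tc|exists ts].
  + destruct (Req_dec (A tc) 0) as [Z1|]; [|auto]; destruct (Req_dec (B tc) 0) as [Z2|]; [|auto].
    exfalso; apply HN; specialize (K1 tc); rewrite Z1, Z2, Hc in K1; lra.
  + destruct (Req_dec (A ts) 0) as [Z1|]; [|auto]; destruct (Req_dec (B ts) 0) as [Z2|]; [|auto].
    exfalso; apply HN; specialize (K2 ts); rewrite Z1, Z2, Hs in K2; lra.
Qed.

Lemma bounded_bigO (y : R -> R) F l t : polar_lim F l -> (forall r, 0 < r -> y r = pol F r t) ->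
  bigO 0 y.
Proof.
intros HF E; apply bigO_lim with l; apply right_ext with (2 := polar_lim_ray _ _ t HF).
intros r Hr; rewrite E by trivial; simpl; field.
Qed.

Lemma mode_scalar_bounded n k e g u h xi : (1 <= k)%nat -> is_mode n 1 0 k e g u h xi ->
  regular_at_origin xi -> bigO 0 u /\ bigO 0 h.
Proof.
intros Hk HM HR; destruct (angle_exists k Hk) as [tc [ts [Hc Hs]]].
assert (HR' := proj1 (regular_iff xi) HR); destruct (HR' P1) as [l1 L1], (HR' P2) as [l2 L2].
assert (B : forall t, bigO 0 (fun r => pol (xi P1) r t) /\ bigO 0 (fun r => pol (xi P2) r t)).
{ intros t; split; [apply (bounded_bigO _ _ _ t L1)|apply (bounded_bigO _ _ _ t L2)]; reflexivity. }
split.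
- apply bigO_ext with (fun r => cos (INR n * tc) * pol (xi P1) r tc + sin (INR n * tc) * pol (xi P2)
  r tc).
  + intros r Hr; destruct (mode_profiles _ _ _ _ _ _ _ _ _ r tc HM Hr) as [_ [_ [Q _]]].
    rewrite Hc in Q; rewrite <- Q; ring.
  + apply bigO_plus; apply bigO_scal, B.
- apply bigO_ext with (fun r => sin (INR n * ts) * pol (xi P1) r ts - cos (INR n * ts) * pol (xi P2)
  r ts).
  + intros r Hr; destruct (mode_profiles _ _ _ _ _ _ _ _ _ r ts HM Hr) as [_ [_ [_ Q]]].
    rewrite Hs in Q; lra.
  + apply bigO_minus; apply bigO_scal, B.
Qed.

(** The order [|n - k|] is that of type A for [k <= n]; for [k > n] it equals [k - n], which
    regularity does not exclude. The order [n + k] is type B. *)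
Lemma multipolar_classes n lambda f beta w2 k v u w : vortex_profiles n lambda f beta ->
  (1 <= n)%nat -> (1 <= k)%nat ->
  eigenfunction n lambda f beta w2 (multipolar n f k v u w) ->
  vector_behaves_as (multipolar n f k v u w) (Z.of_nat k - 1) ->
  type_A n k (multipolar n f k v u w) \/ type_B n k (multipolar n f k v u w) \/
  ((n < k)%nat /\ radial_char (multipolar n f k v u w) (Z.of_nat k - 1) (Z.of_nat k - Z.of_nat n)).
Proof.
intros Hv Hn Hk HE HB; assert (HM := multipolar_is_mode n f k v u w).
apply multipolar_eigenfunction in HE; trivial; destruct HE as [[Tv [Tu [Tw [HH _]]]] HR].
destruct (proj2 (radial_equiv n lambda f beta w2 k v u w Hv Hk) (conj Tv (conj Tu (conj Tw HH))))
  as [[Ce [Cg [Cu Ch]]] HS].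
assert (HkR : INR k <> 0) by (apply not_0_INR; lia).
destruct (mode_scalar_bounded _ _ _ _ _ _ _ Hk HM HR) as [Ou Oh].
destruct (mode_vector_behaves _ _ _ _ _ _ _ _ Hk HM HB) as [E [G [LE [LG HEG]]]].
replace (Z.of_nat k - 1)%Z with (Z.of_nat (k - 1)) in LE, LG by lia.
assert (LE' : filterlim (fun r => ev f v w r / r ^ (k - 1)) (at_right 0) (locally E)).
{ apply right_ext with (2 := LE); intros; rewrite powerRZ_nat; reflexivity. }
assert (LG' : filterlim (fun r => INR k * v r / r / r ^ (k - 1)) (at_right 0) (locally G)).
{ apply right_ext with (2 := LG); intros; rewrite powerRZ_nat; reflexivity. }
assert (Oe := bigO_lim _ _ _ LE'); assert (Og := bigO_lim _ _ _ LG').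
assert (Cv : CR 2 v).
{ apply CR_ext with (fun r => / INR k * r * (INR k * v r / r)).
  - intros r Hr; field; lra.
  - apply CR_mult; [apply CR_scal, CR_id|exact Cg]. }
assert (Ov : bigO k v).
{ apply bigO_ext with (fun r => / INR k * (r * (INR k * v r / r))); [intros; field; lra|].
  apply bigO_scal, (bigO_mult 1 (k - 1)); [lia|apply bigO_id|exact Og]. }
(* For small [w], the function [v] solves an Euler equation of exponent [k] with a source of order
   [k + 1]. Hence [v] has a leading term in [r ^ k], and [k v / r] and [v'] share their leading
   coefficient; the correction [r f w] in [e] is of higher order. That the coefficient is nonzero is
   the hypothesis on the vector part. *)
assert (VV : exists V, bigO (n + k - 1) u -> bigO (n + k - 1) (fun r => INR k * w r) ->
   bigO k (fun r => ev f v w r - V * r ^ (k - 1)) /\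
     bigO k (fun r => INR k * v r / r - V * r ^ (k - 1)) /\ V <> 0).
{ exists G; intros _ Hw.
  assert (Ow : bigO (n + k - 1) w).
  { apply bigO_ext with (fun r => / INR k * (INR k * w r));
    [intros; field; lra|]. apply bigO_scal, Hw. }
  assert (Of := f_bigO n lambda f beta Hv).
  assert (Odf := df_bigO n lambda f beta Hv Hn).
  assert (Ee : bigO (S k) (euler k v)).
  { apply bigO_ext with (fun r => r * ((f r * f r - w2) * v r) + 2 *
    (r * ((f r + r * Derive f r) * w r))).
    - intros r Hr; specialize (HH r Hr); unfold Hbar in HH; apply triple_eq in HH;
      destruct HH as [H1 _].
      unfold Lop in H1.
      assert (E2 : Derive_n v 2 r = - Derive v r / r + INR k ^ 2 / r ^ 2 * v r + f r ^ 2 * v r + 2 *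
        (f r + r * Derive f r) * w r - w2 * v r) by lra.
      unfold euler; rewrite E2; field; lra.
    - apply bigO_plus.
      + apply (bigO_mult 1 k); [lia|apply bigO_id|]. apply (bigO_mult 0 k); [lia| |exact Ov].
        apply bigO_minus; [apply (bigO_mult n n); trivial; lia|apply bigO_const].
      + apply bigO_scal, (bigO_mult 1 (n + (n + k - 1))); [lia|apply bigO_id|].
        apply (bigO_mult n (n + k - 1)); [lia| |exact Ow]. apply bigO_plus; trivial. }
  destruct (euler_high k v (S k) Cv) as [V [HV1 HV2]]; trivial;
    [apply bigO_weaken with (2 := Ov); lia|lia|].
  assert (BG : bigO k (fun r => INR k * v r / r - INR k * V * r ^ (k - 1))).
  { apply bigO_weaken with (S k); [lia|].
    apply bigO_ext with (fun r => INR k * ((v r - V * r ^ k) / r)).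
    - intros r Hr; replace (r ^ k) with (r * r ^ (k - 1))
      by (rewrite tech_pow_Rmult; f_equal; lia). field; lra.
    - apply bigO_scal, bigO_div, HV1. }
  assert (BE : bigO k (fun r => ev f v w r - INR k * V * r ^ (k - 1))).
  { apply bigO_ext with (fun r => (Derive v r - INR k * V * r ^ (k - 1)) - r * (f r * w r));
    [intros; unfold ev; ring|].
    apply bigO_minus; [apply bigO_weaken with (2 := HV2); lia|].
    apply (bigO_mult 1 (n + (n + k - 1))); [lia|apply bigO_id|]. apply (bigO_mult n (n + k - 1));
      trivial; lia. }
  assert (EG : G = INR k * V).
  { apply (right_unique _ _ _ LG'), lim_bigO; replace (S (k - 1)) with k by lia; exact BG. }
  assert (EE : E = INR k * V).
  { apply (right_unique _ _ _ LE'), lim_bigO; replace (S (k - 1)) with k by lia; exact BE. }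
  rewrite EG; split; [exact BE|split; [exact BG|]].
  rewrite EG, EE in HEG; tauto. }
destruct VV as [V HV].
destruct (scalar_exponents n lambda f beta Hv Hn w2 k _ _ _ _ Hk Cu Ch HS Oe Og Ou Oh V HV)
  as [d [U [H [Hd [HN [L1 L2]]]]]].
assert (HSc : scalar_behaves_as (multipolar n f k v u w) (Z.of_nat d)).
{ apply (mode_scalar_behaves n k _ _ _ _ _ _ U H Hk HM); trivial.
  - apply right_ext with (2 := L1); intros; rewrite powerRZ_nat; reflexivity.
  - apply right_ext with (2 := L2); intros; rewrite powerRZ_nat; reflexivity. }
destruct Hd as [-> | ->].
- destruct (le_lt_dec k n) as [Hkn|Hkn].
  + left; split; trivial.
    replace (Z.of_nat n - Z.of_nat k)%Z with (Z.of_nat (Z.abs_nat (Z.of_nat n - Z.of_nat k)))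
      by lia; exact HSc.
  + right; right; split; trivial; split; trivial.
    replace (Z.of_nat k - Z.of_nat n)%Z with (Z.of_nat (Z.abs_nat (Z.of_nat n - Z.of_nat k)))
      by lia; exact HSc.
- right; left; split; trivial.
  rewrite <- Nat2Z.inj_add; exact HSc.
Qed.

(** * Continuous functions and their integrals over a period *)

Definition Ct (y : R -> R) : Prop := forall t, continuous y t.
Definition I2 (y : R -> R) : R := RInt y 0 (2 * PI).

Lemma Ct_plus y z : Ct y -> Ct z -> Ct (fun t => y t + z t).
Proof. intros H1 H2 t; apply (continuous_plus y z); auto. Qed.

Lemma Ct_mult y z : Ct y -> Ct z -> Ct (fun t => y t * z t).
Proof. intros H1 H2 t; apply (continuous_mult y z); auto. Qed.

Lemma Ct_const c : Ct (fun _ => c).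
Proof. intros t; apply continuous_const. Qed.

Lemma Ct_derive y : (forall t, ex_derive y t) -> Ct y.
Proof. intros H t; apply (ex_derive_continuous (V := R_NormedModule)), H. Qed.

Lemma Ct_scal c y : Ct y -> Ct (fun t => c * y t).
Proof. intros H; apply Ct_mult; [apply Ct_const|exact H]. Qed.

Lemma Ct_ext y z : (forall t, y t = z t) -> Ct y -> Ct z.
Proof. intros E H; replace z with y; trivial; apply functional_extensionality, E. Qed.

Lemma Ct_minus y z : Ct y -> Ct z -> Ct (fun t => y t - z t).
Proof.
intros H1 H2; apply Ct_ext with (fun t => y t + -1 * z t); [intros; ring|]; apply Ct_plus;
  [|apply Ct_scal]; trivial.
Qed.

Lemma Ct_sin a : Ct (fun t => sin (a * t)).
Proof. apply Ct_derive; intros t; auto_derive; trivial. Qed.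

Lemma Ct_cos a : Ct (fun t => cos (a * t)).
Proof. apply Ct_derive; intros t; auto_derive; trivial. Qed.

Lemma Ct_RInt y a b : Ct y -> ex_RInt y a b.
Proof. intros H; apply (ex_RInt_continuous (V := R_CompleteNormedModule)); intros; apply H. Qed.

Lemma I2_lin p q y z : Ct y -> Ct z -> I2 (fun t => p * y t + q * z t) = p * I2 y + q * I2 z.
Proof. intros; apply RInt_lin; apply Ct_RInt; trivial. Qed.

Lemma I2_ext y z : (forall t, 0 < t < 2 * PI -> y t = z t) -> I2 y = I2 z.
Proof.
intros E; apply RInt_ext; intros t Ht; apply E; assert (P := PI_RGT_0).
rewrite Rmin_left, Rmax_right in Ht; lra.
Qed.

Lemma I2_scal c y : Ct y -> I2 (fun t => c * y t) = c * I2 y.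
Proof.
intros H; rewrite (I2_ext _ (fun t => c * y t + 0 * y t)) by (intros; ring).
rewrite I2_lin by trivial; ring.
Qed.

Lemma I2_plus y z : Ct y -> Ct z -> I2 (fun t => y t + z t) = I2 y + I2 z.
Proof.
intros H H'; rewrite (I2_ext _ (fun t => 1 * y t + 1 * z t)) by (intros; ring).
rewrite I2_lin by trivial; ring.
Qed.

Lemma I2_minus y z : Ct y -> Ct z -> I2 (fun t => y t - z t) = I2 y - I2 z.
Proof.
intros H H'; rewrite (I2_ext _ (fun t => 1 * y t + -1 * z t)) by (intros; ring).
rewrite I2_lin by trivial; ring.
Qed.

Lemma I2_ge0 y : Ct y -> (forall t, 0 <= y t) -> 0 <= I2 y.
Proof.
intros H H0; apply RInt_ge_0; [assert (P := PI_RGT_0); lra|apply Ct_RInt; trivial|auto].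
Qed.

Lemma I2_const c : I2 (fun _ => c) = 2 * PI * c.
Proof. unfold I2; rewrite RInt_const; change ((2 * PI - 0) * c = 2 * PI * c); ring. Qed.

Lemma I2_antiderivative F y : (forall t, is_derive F t (y t)) -> Ct y -> I2 y = F (2 * PI) - F 0.
Proof.
intros HF Hy; apply is_RInt_unique.
apply (is_RInt_derive (V := R_CompleteNormedModule) F y); intros t _; trivial.
Qed.

(** * Pointwise convergence of Fourier series *)

(** The numerator of the Dirichlet kernel. It vanishes at both ends of [[0, 2 PI]], which makes the
    family orthogonal there. *)
Definition hs (j : nat) (t : R) : R := sin ((INR j + / 2) * t).

Lemma Ct_hs j : Ct (hs j).
Proof. apply Ct_sin. Qed.

Lemma sin_half_2PI j : sin ((INR j + / 2) * (2 * PI)) = 0.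
Proof.
replace ((INR j + / 2) * (2 * PI)) with (PI + 2 * INR j * PI) by field.
rewrite sin_period; apply sin_PI.
Qed.

Lemma hs_orthogonal i j : i <> j -> I2 (fun t => hs i t * hs j t) = 0.
Proof.
intros Hij; set (a := INR i + / 2); set (b := INR j + / 2).
assert (Hab : a ^ 2 - b ^ 2 <> 0).
{ intros E; assert (Pi := pos_INR i); assert (Pj := pos_INR j).
  assert (a = b) by (unfold a, b in *; nra).
  apply Hij, INR_eq; unfold a, b in *; lra. }
(* Lagrange's identity: the Wronskian of the two sines has derivative [(a ^ 2 - b ^ 2)] times their
   product. *)
rewrite (I2_antiderivative (fun t => (b * sin (a * t) * cos (b * t) - a * cos (a * t) * sin (b * t))
  / (a ^ 2 - b ^ 2))).
- assert (Sa : sin (a * (2 * PI)) = 0) by apply sin_half_2PI.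
  assert (Sb : sin (b * (2 * PI)) = 0) by apply sin_half_2PI.
  rewrite Sa, Sb, !Rmult_0_r, sin_0; field; exact Hab.
- intros t; unfold hs; fold a b; clearbody a b; auto_derive; [trivial|field; lra].
- apply Ct_mult; apply Ct_hs.
Qed.

Lemma hs_norm j : I2 (fun t => hs j t * hs j t) = PI.
Proof.
set (a := INR j + / 2).
assert (Ha : a <> 0) by (assert (P := pos_INR j); unfold a; lra).
rewrite (I2_antiderivative (fun t => t / 2 - sin (a * t) * cos (a * t) / (2 * a))).
- assert (Sa : sin (a * (2 * PI)) = 0) by apply sin_half_2PI.
  rewrite Sa, Rmult_0_r, sin_0; field; exact Ha.
- intros t; unfold hs; fold a; clearbody a; auto_derive; [trivial|].
  assert (E := pow_sin_cos (a * t)); assert (E1 : cos (a * t) ^ 2 = 1 - sin (a * t) ^ 2) by lra.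
  field_simplify_eq; [|exact Ha]; ring [E1].
- apply Ct_mult; apply Ct_hs.
Qed.

(** The projections on [hs 0], [hs 1], ... are subtracted one at a time and [G] is the remainder.
    That its later coefficients are still those of [H] is what the induction needs. *)
Lemma bessel H N : Ct H -> exists G, Ct G /\
  I2 (fun t => H t ^ 2) = I2 (fun t => G t ^ 2) + sum_n
    (fun j => I2 (fun t => H t * hs j t) ^ 2 / PI) N /\
  (forall j, (N < j)%nat -> I2 (fun t => G t * hs j t) = I2 (fun t => H t * hs j t)).
Proof.
intros CH; assert (HP := PI_RGT_0).
assert (Step : forall G N, Ct G -> exists G', Ct G' /\
  I2 (fun t => G t ^ 2) = I2 (fun t => G' t ^ 2) + I2 (fun t => G t * hs N t) ^ 2 / PI /\
  (forall j, j <> N -> I2 (fun t => G' t * hs j t) = I2 (fun t => G t * hs j t))).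
{ clear N; intros G N CG; set (c := I2 (fun t => G t * hs N t)).
  exists (fun t => G t - c / PI * hs N t).
  assert (C1 := Ct_hs N).
  split; [apply Ct_minus; [|apply Ct_scal]; trivial|split].
  - rewrite (I2_ext (fun t => (G t - c / PI * hs N t) ^ 2)
      (fun t => 1 * (G t * G t) + 1 * (-2 * (c / PI) * (G t * hs N t) + (c / PI) ^ 2 *
        (hs N t * hs N t)))) by (intros; ring).
    assert (CGG : Ct (fun t => G t * G t)) by (apply Ct_mult; trivial).
    assert (CGh : Ct (fun t => G t * hs N t)) by (apply Ct_mult; trivial).
    assert (Chh : Ct (fun t => hs N t * hs N t)) by (apply Ct_mult; trivial).
    rewrite (I2_lin 1 1); [|trivial|apply Ct_plus; apply Ct_scal; trivial].
    rewrite I2_lin, hs_norm by trivial; fold c.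
    rewrite (I2_ext (fun t => G t ^ 2) (fun t => G t * G t)) by (intros; ring).
    field; lra.
  - intros j Hj.
    rewrite (I2_ext _ (fun t => 1 * (G t * hs j t) + - (c / PI) * (hs N t * hs j t)))
      by (intros; ring).
    rewrite I2_lin by (apply Ct_mult; trivial; apply Ct_hs).
    rewrite hs_orthogonal by auto; ring. }
induction N as [|N IH].
- destruct (Step H 0%nat CH) as [G [CG [E1 E2]]]; exists G; split; [exact CG|split].
  + rewrite sum_O; exact E1.
  + intros j Hj; apply E2; lia.
- destruct IH as [G [CG [E1 E2]]]; destruct (Step G (S N) CG) as [G' [CG' [E3 E4]]].
  exists G'; split; [exact CG'|split].
  + rewrite E1, E3, sum_Sn, E2 by lia.
    change plus with Rplus; ring.
  + intros j Hj; rewrite E4, E2 by lia; reflexivity.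
Qed.

(** The sums of the squared coefficients increase and are bounded by the integral of [H ^ 2], so the
    coefficients tend to zero. *)
Lemma riemann_lebesgue H : Ct H -> is_lim_seq (fun j => I2 (fun t => H t * hs j t)) 0.
Proof.
intros CH; assert (HP := PI_RGT_0).
set (c := fun j => I2 (fun t => H t * hs j t)).
assert (HE : ex_series (fun j => c j ^ 2 / PI)).
{ destruct (ex_finite_lim_seq_incr (sum_n (fun j => c j ^ 2 / PI)) (I2 (fun t => H t ^ 2))) as
  [l Hl].
  - intros N; rewrite sum_Sn; change plus with Rplus.
    assert (0 <= c (S N) ^ 2 / PI) by (apply Rdiv_le_0_compat; [apply pow2_ge_0|lra]); lra.
  - intros N; destruct (bessel H N CH) as [G [CG [E _]]]; rewrite E.
    assert (0 <= I2 (fun t => G t ^ 2)).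
    { apply I2_ge0; [|intros; apply pow2_ge_0].
      apply Ct_ext with (fun t => G t * G t); [intros; ring|apply Ct_mult; trivial]. }
    fold c; unfold c; lra.
  - exists l; exact Hl. }
apply ex_series_lim_0 in HE.
assert (HE2 : is_lim_seq (fun j => c j ^ 2) 0).
{ apply is_lim_seq_ext with (fun j => PI * (c j ^ 2 / PI)); [intros; field; lra|].
  assert (Z := is_lim_seq_scal_l _ PI _ HE); simpl in Z; rewrite Rmult_0_r in Z; exact Z. }
apply is_lim_seq_spec; intros eps.
apply is_lim_seq_spec in HE2.
assert (He2 : 0 < eps ^ 2) by (apply pow_lt, cond_pos).
destruct (HE2 (mkposreal _ He2)) as [N HN]; exists N; intros j Hj.
specialize (HN j Hj); simpl in HN; rewrite Rminus_0_r in *.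
fold (c j); destruct (Rlt_or_le (Rabs (c j)) eps) as [|Hc]; trivial; exfalso.
assert (E : Rabs (c j * (c j * 1)) = Rabs (c j) * Rabs (c j))
  by (rewrite Rmult_1_r; apply Rabs_mult).
assert (Pe := cond_pos eps); rewrite E in HN; nra.
Qed.

(** Serves to remove the singularities of [(Y s - Y 0) / (2 sin (s / 2))] at the ends of the period,
    where numerator and denominator vanish. *)
Lemma quotient_limit (y z : R -> R) a l : is_derive y a l -> is_derive z a 1 ->
  filterlim (fun s => (y s - y a) / (z s - z a)) (locally' a) (locally l).
Proof.
intros Hy Hz.
assert (Q : forall (y : R -> R) l, is_derive y a l -> forall eps, 0 < eps ->
  exists d, 0 < d /\ forall s, s <> a -> Rabs (s - a) < d ->
    Rabs ((y s - y a) / (s - a) - l) < eps).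
{ intros x m Hx eps He; apply is_derive_Reals in Hx; destruct (Hx eps He) as [d Hd].
  exists d; split; [apply cond_pos|]; intros s Hs Hsd.
  specialize (Hd (s - a) ltac:(lra) Hsd); replace (a + (s - a)) with s in Hd
    by (symmetry; apply Rplus_minus); exact Hd. }
intros P [eps HP].
assert (Hc : 0 < Rmin (/ 2) (eps / (2 * (Rabs l + 2)))).
{ apply Rmin_glb_lt; [lra|apply Rdiv_lt_0_compat; [apply cond_pos|assert (Z := Rabs_pos l); lra]]. }
set (c := Rmin (/ 2) (eps / (2 * (Rabs l + 2)))) in *.
assert (C1 : c <= / 2) by apply Rmin_l; assert (C2 : c <= eps / (2 * (Rabs l + 2))) by apply Rmin_r.
destruct (Q y l Hy c Hc) as [d1 [Hd1 H1]], (Q z 1 Hz c Hc) as [d2 [Hd2 H2]].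
assert (Hd : 0 < Rmin d1 d2) by (apply Rmin_glb_lt; trivial).
exists (mkposreal _ Hd); intros s Hs Hsa; apply HP.
change (Rabs (s - a) < Rmin d1 d2) in Hs.
assert (M1 := Rmin_l d1 d2); assert (M2 := Rmin_r d1 d2).
specialize (H1 s Hsa ltac:(lra)); specialize (H2 s Hsa ltac:(lra)).
set (A := (y s - y a) / (s - a)) in *; set (B := (z s - z a) / (s - a)) in *.
apply Rabs_lt_between in H2.
assert (HB : / 2 < B) by lra.
assert (Hz0 : z s - z a <> 0).
{ intros E; unfold B in HB; rewrite E in HB; unfold Rdiv in HB; rewrite Rmult_0_l in HB; lra. }
change (Rabs ((y s - y a) / (z s - z a) - l) < eps).
replace ((y s - y a) / (z s - z a) - l) with ((A - l - l * (B - 1)) / B)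
  by (unfold A, B; field; split; lra).
rewrite Rabs_div, (Rabs_pos_eq B) by lra.
assert (Pl := Rabs_pos l).
assert (N : Rabs (A - l - l * (B - 1)) < (Rabs l + 2) * c).
{ unfold Rminus at 1; eapply Rle_lt_trans; [apply Rabs_triang|].
  rewrite Rabs_Ropp, Rabs_mult.
  assert (Rabs (B - 1) <= c) by (apply Rabs_le; lra). nra. }
apply Rlt_div_l; [lra|].
assert ((Rabs l + 2) * c <= (Rabs l + 2) * (eps / (2 * (Rabs l + 2))))
  by (apply Rmult_le_compat_l; lra).
assert (E : (Rabs l + 2) * (eps / (2 * (Rabs l + 2))) = eps / 2) by (field; lra).
assert (Pe := cond_pos eps); nra.
Qed.

(** The sum telescopes, since [2 sin (s / 2) cos (j s)] is a difference of consecutive [hs]. Without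
    division the identity also holds at the zeros of the sine. *)
Lemma dirichlet_kernel N s :
  2 * sin (s / 2) * sum_n (fun j => cos (INR (S j) * s)) N = hs (S N) s - sin (s / 2).
Proof.
assert (T : forall j, 2 * sin (s / 2) * cos (INR (S j) * s) = hs (S j) s - hs j s).
{ intros j; unfold hs.
  replace ((INR (S j) + / 2) * s) with (INR (S j) * s + s / 2) by field.
  replace ((INR j + / 2) * s) with (INR (S j) * s - s / 2) by (rewrite S_INR; field).
  rewrite sin_plus, sin_minus; ring. }
induction N as [|N IH].
- rewrite sum_O, T; unfold hs; f_equal; f_equal; simpl; field.
- rewrite sum_Sn; change plus with Rplus; rewrite Rmult_plus_distr_l, IH, T; ring.
Qed.

Lemma RInt_shift P x : Ct P -> (forall t, P (t + 2 * PI) = P t) -> I2 (fun s => P (s + x)) = I2 P.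
Proof.
intros CP HP.
assert (E1 : forall a b c, RInt (fun s => P (s + c)) a b = RInt P (a + c) (b + c)).
{ intros a b c.
  assert (Z := RInt_comp_lin P 1 c a b (Ct_RInt P _ _ CP)).
  rewrite !Rmult_1_l in Z; rewrite <- Z; apply RInt_ext; intros t _.
  change (P (t + c) = 1 * P (1 * t + c)); rewrite !Rmult_1_l; reflexivity. }
unfold I2; rewrite E1.
assert (E2 : RInt P (2 * PI) (2 * PI + x) = RInt P 0 x).
{ assert (Z := E1 0 x (2 * PI)); rewrite Rplus_0_l, (Rplus_comm x) in Z; rewrite <- Z.
  apply RInt_ext; intros t _; apply HP. }
assert (C1 := RInt_Chasles P (0 + x) 0 (2 * PI) (Ct_RInt P _ _ CP) (Ct_RInt P _ _ CP)).
assert (C2 := RInt_Chasles P (0 + x) (2 * PI) (2 * PI + x) (Ct_RInt P _ _ CP) (Ct_RInt P _ _ CP)).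
assert (C3 := opp_RInt_swap P 0 x (Ct_RInt P _ _ CP)).
rewrite Rplus_0_l in *.
change (RInt P x 0 + RInt P 0 (2 * PI) = RInt P x (2 * PI)) in C1.
change (RInt P x (2 * PI) + RInt P (2 * PI) (2 * PI + x) = RInt P x (2 * PI + x)) in C2.
change (- RInt P 0 x = RInt P x 0) in C3.
rewrite <- C2, <- C1, E2, <- C3; toR; ring.
Qed.

Lemma I2_cos_S j : I2 (fun s => cos (INR (S j) * s)) = 0.
Proof.
assert (Hj : INR (S j) <> 0) by (apply not_0_INR; lia).
rewrite (I2_antiderivative (fun s => sin (INR (S j) * s) / INR (S j))).
- rewrite (proj2 (sin_cos_2PI (S j))), Rmult_0_r, sin_0; field; exact Hj.
- intros t; auto_derive; [trivial|].
  change (match j with 0%nat => 1 | S _ => INR j + 1 end) with (INR (S j)); field; exact Hj.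
- apply Ct_cos.
Qed.

(** The term of frequency [S j]. The mean is left apart because it belongs to the modes without
    angular modulation. *)
Definition fourier_term (y : R -> R) (x : R) (j : nat) : R :=
  cos (INR (S j) * x) * (/ PI * I2 (fun t => y t * cos (INR (S j) * t)))
  + sin (INR (S j) * x) * (/ PI * I2 (fun t => y t * sin (INR (S j) * t))).

Lemma sum_n_I2 (F : nat -> R -> R) N : (forall j, Ct (F j)) ->
  sum_n (fun j => I2 (F j)) N = I2 (fun t => sum_n (fun j => F j t) N) /\
    Ct (fun t => sum_n (fun j => F j t) N).
Proof.
intros HF; induction N as [|N [IH1 IH2]].
- split; [rewrite sum_O; apply I2_ext; intros; rewrite sum_O; reflexivity|].
  apply Ct_ext with (F 0%nat); trivial; intros; rewrite sum_O; reflexivity.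
- split.
  + rewrite sum_Sn, IH1; change plus with Rplus; rewrite <- I2_plus by trivial.
    apply I2_ext; intros; rewrite sum_Sn; reflexivity.
  + apply Ct_ext with (fun t => sum_n (fun j => F j t) N + F (S N) t);
    [intros; rewrite sum_Sn; reflexivity|].
    apply Ct_plus; trivial.
Qed.

(** Dirichlet's argument: up to a factor, a partial sum differs from its limit by the integral of
    [(y (s + x) - y x) / (2 sin (s / 2))] against [hs (S N)]. Differentiability of [y] extends this
    quotient continuously to the closed period, where the Riemann-Lebesgue lemma applies. *)
Lemma fourier_series y x : (forall t, ex_derive y t) -> (forall t, y (t + 2 * PI) = y t) ->
  is_series (fourier_term y x) (y x - / (2 * PI) * I2 y).
Proof.
intros Dy Py; assert (HP := PI_RGT_0); assert (Cy := Ct_derive y Dy).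
set (Y := fun s => y (s + x)).
assert (DY : forall s, ex_derive Y s).
{ intros s; apply (ex_derive_comp y (fun s => s + x)); [apply Dy|auto_derive; trivial]. }
assert (CY := Ct_derive Y DY).
(* Subtracting [Y 0] changes nothing, since a cosine of positive frequency has mean zero; it creates
   the zero that balances the kernel. *)
assert (HT : forall j, fourier_term y x j = / PI * I2 (fun s => (Y s - Y 0) * cos (INR (S j) * s))).
{ intros j; set (k := S j).
  assert (Cc := Ct_cos (INR k)); assert (Cs := Ct_sin (INR k)).
  transitivity (/ PI * I2 (fun t => y t * cos (INR k * (t - x)))).
  - rewrite (I2_ext (fun t => y t * cos (INR k * (t - x)))
      (fun t => cos (INR k * x) * (y t * cos (INR k * t)) + sin (INR k * x) *
        (y t * sin (INR k * t)))).
    + rewrite I2_lin by (apply Ct_mult; trivial). unfold fourier_term; fold k; ring.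
    + intros t _; rewrite Rmult_minus_distr_l, cos_minus; ring.
  - f_equal; rewrite <- (RInt_shift (fun t => y t * cos (INR k * (t - x))) x).
    + rewrite (I2_ext (fun s => (Y s - Y 0) * cos (INR k * s))
        (fun s => 1 * (Y s * cos (INR k * s)) + - Y 0 * cos (INR k * s))) by (intros; ring).
      rewrite I2_lin by (trivial; apply Ct_mult; trivial).
      assert (Z : I2 (fun s => cos (INR k * s)) = 0) by apply I2_cos_S.
      rewrite Z, Rmult_0_r, Rplus_0_r, Rmult_1_l.
      apply I2_ext; intros s _; unfold Y; f_equal; f_equal; ring.
    + apply Ct_mult; trivial; apply Ct_derive; intros t; auto_derive; trivial.
    + intros t; rewrite Py; f_equal.
      replace (INR k * (t + 2 * PI - x)) with (INR k * (t - x) + 2 * INR k * PI) by ring.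
      apply cos_period. }
assert (YP : Y (2 * PI) = Y 0) by (unfold Y; rewrite Rplus_comm, Py, Rplus_0_l; reflexivity).
set (z := fun s => 2 * sin (s / 2)).
assert (Z0 : z 0 = 0) by (unfold z; replace (0 / 2) with 0 by field; rewrite sin_0; ring).
assert (Z1 : z (2 * PI) = 0) by (unfold z; replace (2 * PI / 2) with PI by field; rewrite sin_PI;
  ring).
assert (Zpos : forall s, 0 < s < 2 * PI -> 0 < z s).
{ intros s Hs; unfold z; assert (0 < sin (s / 2)) by (apply sin_gt_0; lra); lra. }
assert (L0 : filterlim (fun s => (Y s - Y 0) / z s) (at_right 0) (locally (Derive Y 0))).
{ assert (Q := quotient_limit Y z 0 (Derive Y 0)).
  rewrite Z0 in Q; eapply filterlim_ext; [|eapply filterlim_filter_le_1; [|apply Q]].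
  - intros s; simpl; f_equal; ring.
  - intros P [eps HP']; exists eps; intros s Hs Hs0; apply HP'; trivial; apply Rgt_not_eq, Hs0.
  - apply Derive_correct, DY.
  - unfold z; auto_derive; trivial; replace (0 * / 2) with 0 by field; rewrite cos_0; field. }
(* The derivative of [2 sin (s / 2)] is [-1] at [2 PI], so both signs are reversed to meet the
   normalisation of [quotient_limit]. *)
assert (L1 : filterlim (fun s => (Y s - Y 0) / z s) (at_left (2 * PI))
  (locally (- Derive Y (2 * PI)))).
{ assert (Q := quotient_limit (fun s => - Y s) (fun s => - z s) (2 * PI) (- Derive Y (2 * PI))).
  cbv beta in Q; rewrite Z1, YP in Q; eapply filterlim_ext_loc;
    [|eapply filterlim_filter_le_1; [|apply Q]].
  - assert (Hd : 0 < 2 * PI) by lra. exists (mkposreal _ Hd); intros s Hs Hs0.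
    change (Rabs (s - 2 * PI) < 2 * PI) in Hs; apply Rabs_lt_between in Hs.
    assert (Zs := Zpos s ltac:(lra)); field; lra.
  - intros P [eps HP']; exists eps; intros s Hs Hs0; apply HP'; trivial; apply Rlt_not_eq, Hs0.
  - apply opp_derive, Derive_correct, DY.
  - unfold z; auto_derive; trivial; replace (2 * PI * / 2) with PI by field; rewrite cos_PI;
    field. }
assert (HC : forall c, 0 < c < 2 * PI ->
   filterlim (fun s => (Y s - Y 0) / z s) (locally c) (locally ((Y c - Y 0) / z c))).
{ intros c Hc; apply (ex_derive_continuous (V := R_NormedModule) (fun s => (Y s - Y 0) / z s)).
  assert (Zs := Zpos c Hc); unfold z in *; auto_derive; repeat split; [apply DY|].
  replace (c * / 2) with (c / 2) by reflexivity; lra. }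
(* The one-sided limits turn the quotient into a function [H] continuous on the whole line that
   agrees with it inside the period. *)
destruct (C0_extension_lt (fun s => (Y s - Y 0) / z s) _ _ 0 (2 * PI) ltac:(lra) HC L0 L1) as
  [H [CH [HE _]]].
assert (CH' : Ct H) by exact CH.
assert (HS : forall N, sum_n (fourier_term y x) N =
  / PI * I2 (fun t => H t * hs (S N) t) + (y x - / (2 * PI) * I2 y)).
{ intros N.
  assert (CF : forall j, Ct (fun s => (Y s - Y 0) * cos (INR (S j) * s))).
  { intros j; apply Ct_mult; [apply Ct_minus; trivial; apply Ct_const|apply Ct_cos]. }
  transitivity (/ PI * I2 (fun s => sum_n (fun j => (Y s - Y 0) * cos (INR (S j) * s)) N)).
  { rewrite (sum_n_ext _ _ N HT), <- (proj1 (sum_n_I2 _ N CF)).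
    exact (sum_n_mult_l (K := R_Ring) _ _ N). }
  rewrite (I2_ext _ (fun s => 1 * (H s * hs (S N) s) + - / 2 * (Y s - Y 0))).
  - rewrite I2_lin by (first [apply Ct_mult; trivial; apply Ct_hs|apply Ct_minus; trivial;
    apply Ct_const]).
    rewrite I2_minus, I2_const by (trivial; apply Ct_const).
    assert (EY : I2 Y = I2 y) by (apply RInt_shift; trivial).
    assert (EY0 : Y 0 = y x) by (unfold Y; rewrite Rplus_0_l; reflexivity).
    rewrite EY, EY0; toR; field; lra.
  - intros s Hs; rewrite (HE s Hs); assert (Zs := Zpos s Hs).
    assert (M : sum_n (fun j => (Y s - Y 0) * cos (INR (S j) * s)) N
      = (Y s - Y 0) * sum_n (fun j => cos (INR (S j) * s)) N)
        by exact (sum_n_mult_l (K := R_Ring) _ _ N).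
    assert (K := dirichlet_kernel N s); fold (z s) in K; rewrite M.
    set (S0 := sum_n (fun j => cos (INR (S j) * s)) N) in *; clearbody S0.
    replace (hs (S N) s) with (z s * S0 + z s / 2) by (rewrite K; unfold z; field).
    toR; field; lra. }
assert (Lim : is_lim_seq (sum_n (fourier_term y x)) (y x - / (2 * PI) * I2 y)).
{ apply is_lim_seq_ext with (fun N => / PI * I2 (fun t => H t * hs (S N) t) +
  (y x - / (2 * PI) * I2 y)).
  - intros N; symmetry; apply HS.
  - assert (RL := riemann_lebesgue H CH'). apply is_lim_seq_incr_1 in RL.
    assert (RL2 := is_lim_seq_scal_l _ (/ PI) _ RL).
    assert (RL3 := is_lim_seq_plus' _ _ _ _ RL2 (is_lim_seq_const (y x - / (2 * PI) * I2 y))).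
    simpl in RL3; rewrite Rmult_0_r, Rplus_0_l in RL3; exact RL3. }
exact Lim.
Qed.

(** * Angular integrals as functions of the radius *)

Lemma Ct_slice n Y r : CD half n Y -> 0 < r -> Ct (fun t => Y r t).
Proof.
intros HY Hr t; apply continuity_pt_filterlim, (continuity_2d_slice2 Y).
apply (CD_cont half n); trivial.
Qed.

Lemma I2_bound y eps : Ct y -> (forall t, 0 <= t <= 2 * PI -> Rabs (y t) <= eps) ->
  Rabs (I2 y) <= 2 * PI * eps.
Proof.
intros Cy Hy; assert (HP := PI_RGT_0).
apply Rabs_le; split.
- assert (0 <= I2 (fun t => y t + eps)).
  { apply RInt_ge_0; [lra|apply Ct_RInt, Ct_plus; trivial; apply Ct_const|].
    intros t Ht; specialize (Hy t ltac:(lra)); apply Rabs_le_between in Hy; lra. }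
  rewrite I2_plus, I2_const in H by (trivial; apply Ct_const); lra.
- assert (0 <= I2 (fun t => eps - y t)).
  { apply RInt_ge_0; [lra|apply Ct_RInt, Ct_minus; trivial; apply Ct_const|].
    intros t Ht; specialize (Hy t ltac:(lra)); apply Rabs_le_between in Hy; lra. }
  rewrite I2_minus, I2_const in H by (trivial; apply Ct_const); lra.
Qed.

(** Joint continuity is uniform over the compact period, which bounds the integrand and hence the
    integral. *)
Lemma I2_continuous Y r : CD half 0 Y -> 0 < r -> continuity_pt (fun r => I2 (fun t => Y r t)) r.
Proof.
intros HY Hr; assert (HP := PI_RGT_0).
intros eps He.
assert (He' : 0 < eps / (2 * (2 * PI))) by (apply Rdiv_lt_0_compat; lra).
destruct (uniform_continuity_2d_1d' Y 0 (2 * PI) r) with (eps := mkposreal _ He') as [d Hd].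
{ intros t _; apply (CD_cont half 0); trivial. }
exists (Rmin d r); split; [apply Rmin_glb_lt; trivial; apply cond_pos|].
intros s [_ Hs]; unfold dist in *; simpl in *; unfold Rdist in *.
assert (M1 := Rmin_l d r); assert (M2 := Rmin_r d r).
assert (Hs' : Rabs (s - r) < d) by lra; assert (Hs'' : Rabs (s - r) < r) by lra.
apply Rabs_lt_between in Hs'; apply Rabs_lt_between in Hs''.
assert (C1 := Ct_slice 0 Y s HY ltac:(lra)); assert (C2 := Ct_slice 0 Y r HY Hr).
rewrite <- I2_minus by trivial.
apply Rle_lt_trans with (2 * PI * (eps / (2 * (2 * PI)))).
- apply I2_bound; [apply Ct_minus; trivial|]; intros t Ht; left.
  apply Hd; try lra; assert (Pd := cond_pos d); try lra.
  rewrite Rminus_diag, Rabs_R0; exact Pd.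
- apply Rle_lt_trans with (eps / 2); [apply Req_le; field; lra|lra].
Qed.

Lemma I2_derive n Y r : CD half (S n) Y -> 0 < r ->
  is_derive (fun r => I2 (fun t => Y r t)) r (I2 (fun t => d1 Y r t)).
Proof.
intros HY Hr; destruct (CD_derives half n Y open_half HY) as [Hd [H1 _]].
apply (is_derive_RInt_param Y 0 (2 * PI) r).
- generalize (locally_pos r Hr); apply filter_imp; intros s Hs t _; eexists; apply (Hd s t Hs).
- intros t _; apply (CD_cont half n (d1 Y)); trivial.
- generalize (locally_pos r Hr); apply filter_imp; intros s Hs;
  apply Ct_RInt, (Ct_slice (S n) Y s HY Hs).
Qed.

Lemma I2_CR n Y : CD half n Y -> CR n (fun r => I2 (fun t => Y r t)).
Proof.
revert Y; induction n as [|n IH]; intros Y HY.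
- apply CR_0; intros r Hr; apply I2_continuous; trivial.
- apply CR_derive with (fun r => I2 (fun t => d1 Y r t)).
  + intros r Hr; apply (I2_derive n); trivial.
  + apply IH, (CD_derives half n Y open_half HY).
Qed.

Definition periodic (Y : R -> R -> R) : Prop := forall r t, Y r (t + 2 * PI) = Y r t.

Lemma periodic_d2 Y : periodic Y -> periodic (d2 Y).
Proof.
intros HP r t; unfold d2.
transitivity (Derive (fun z => Y r (z + 2 * PI)) t); [|apply Derive_ext; intros; apply HP].
unfold Derive; f_equal; f_equal; apply functional_extensionality; intros h.
replace (t + 2 * PI + h) with (t + h + 2 * PI) by ring; reflexivity.
Qed.

Lemma I2_by_parts Y T T' r : CD half 1 Y -> periodic Y -> 0 < r ->
  (forall t, is_derive T t (T' t)) -> Ct T' -> T (2 * PI) = T 0 ->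
  I2 (fun t => d2 Y r t * T t) = - I2 (fun t => Y r t * T' t).
Proof.
intros HY PY Hr HT CT' PT.
destruct (CD_derives half 0 Y open_half HY) as [Hd [_ H2]].
assert (CT : Ct T) by (apply Ct_derive; intros t; eexists; apply HT).
assert (CY := Ct_slice 1 Y r HY Hr); assert (CY2 := Ct_slice 0 _ r H2 Hr).
assert (C1 := Ct_mult _ _ CY2 CT); assert (C2 := Ct_mult _ _ CY CT').
assert (E : I2 (fun t => d2 Y r t * T t + Y r t * T' t) = 0).
{ rewrite (I2_antiderivative (fun t => Y r t * T t)).
  - replace (Y r (2 * PI)) with (Y r 0) by (rewrite <- (PY r 0); f_equal; ring).
    rewrite PT; ring.
  - intros t; apply (is_derive_mult (fun t => Y r t) T); [apply Hd, Hr|apply HT|apply Rmult_comm].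
  - apply Ct_plus; trivial. }
rewrite I2_plus in E by trivial; lra.
Qed.

Lemma Ct_Cos a b k : Ct (Cos a b k).
Proof. apply Ct_derive; intros t; exact (proj1 (Cos_Sin_ex_derive a b k t)). Qed.

Lemma Ct_Sin a b k : Ct (Sin a b k).
Proof. apply Ct_derive; intros t; exact (proj2 (Cos_Sin_ex_derive a b k t)). Qed.

Lemma I2_d2_Cos Y a b k r : CD half 1 Y -> periodic Y -> 0 < r ->
  I2 (fun t => d2 Y r t * Cos a b k t) = INR k * I2 (fun t => Y r t * Sin a b k t).
Proof.
intros HY PY Hr; rewrite (I2_by_parts Y _ (fun t => - INR k * Sin a b k t) r HY PY Hr).
- rewrite (I2_ext _ (fun t => - INR k * (Y r t * Sin a b k t))) by (intros; ring).
  rewrite I2_scal; [ring|apply Ct_mult; [apply (Ct_slice 1 Y r HY Hr)|apply Ct_Sin]].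
- intros; apply Cos_derive.
- apply Ct_scal, Ct_Sin.
- rewrite <- (proj1 (Cos_Sin_2PI a b k 0)); f_equal; ring.
Qed.

Lemma I2_d2_Sin Y a b k r : CD half 1 Y -> periodic Y -> 0 < r ->
  I2 (fun t => d2 Y r t * Sin a b k t) = - INR k * I2 (fun t => Y r t * Cos a b k t).
Proof.
intros HY PY Hr; rewrite Sin_as_Cos, I2_d2_Cos by trivial.
rewrite (I2_ext _ (fun t => -1 * (Y r t * Cos a b k t))) by (intros; rewrite Sin_rotated; ring).
rewrite I2_scal; [ring|apply Ct_mult; [apply (Ct_slice 1 Y r HY Hr)|apply Ct_Cos]].
Qed.

Lemma Lop_scal k c y r : Lop k (fun r => c * y r) r = c * Lop k y r.
Proof.
unfold Lop; rewrite (Derive_scal y), (Derive_n_scal_l y); unfold Rdiv; ring.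
Qed.

Lemma plap_projection (T : R -> R) k Y r : CD half 2 Y -> 0 < r ->
  (forall n, CD half n (fun _ t => T t)) ->
  I2 (fun t => d2 (d2 Y) r t * T t) = - INR k ^ 2 * I2 (fun t => Y r t * T t) ->
  I2 (fun t => plap Y r t * T t) = - Lop k (fun r => I2 (fun t => Y r t * T t)) r.
Proof.
intros HY Hr HT E.
destruct (CD_derives half 1 Y open_half HY) as [_ [H1 H2]].
destruct (CD_derives half 0 _ open_half H1) as [_ [H11 _]].
destruct (CD_derives half 0 _ open_half H2) as [_ [_ H22]].
assert (CT : Ct T) by exact (Ct_slice 0 (fun _ t => T t) r (HT 0%nat) Hr).
assert (Q : forall Z r, CD half 1 Z -> 0 < r ->
   Derive (fun r => I2 (fun t => Z r t * T t)) r = I2 (fun t => d1 Z r t * T t)).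
{ intros Z s HZ Hs; apply is_derive_unique.
  assert (D := I2_derive 0 (fun r t => Z r t * T t) s (CD_mult _ _ _ _ HZ (HT 1%nat)) Hs).
  replace (I2 (fun t => d1 Z s t * T t)) with (I2 (fun t => d1 (fun r t => Z r t * T t) s t));
    trivial.
  apply I2_ext; intros t _; unfold d1; apply Derive_scal_l. }
unfold Lop; rewrite (Q Y r (CD_pred _ _ _ HY) Hr).
replace (Derive_n (fun r => I2 (fun t => Y r t * T t)) 2 r)
  with (I2 (fun t => d1 (d1 Y) r t * T t)).
2:{ rewrite <- (Q (d1 Y) r H1 Hr); symmetry; apply Derive_ext_loc.
    generalize (locally_pos r Hr); apply filter_imp; intros s Hs;
      apply (Q Y s (CD_pred _ _ _ HY) Hs). }
assert (C1 := Ct_mult _ _ (Ct_slice 0 _ r H11 Hr) CT).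
assert (C2 := Ct_mult _ _ (Ct_slice 1 _ r H1 Hr) CT).
assert (C3 := Ct_mult _ _ (Ct_slice 0 _ r H22 Hr) CT).
rewrite (I2_ext (fun t => plap Y r t * T t) (fun t => 1 * (d1 (d1 Y) r t * T t) +
   1 * (/ r * (d1 Y r t * T t) + / r ^ 2 * (d2 (d2 Y) r t * T t))))
     by (intros; unfold plap; field; lra).
rewrite (I2_lin 1 1); [|trivial|apply Ct_plus; apply Ct_scal; trivial].
rewrite I2_lin, E by trivial; field; lra.
Qed.

Lemma plap_Cos a b k Y r : CD half 2 Y -> periodic Y -> 0 < r ->
  I2 (fun t => plap Y r t * Cos a b k t) = - Lop k (fun r => I2 (fun t => Y r t * Cos a b k t)) r.
Proof.
intros HY PY Hr; apply plap_projection; trivial; [intros; apply CD_Cos|].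
rewrite I2_d2_Cos, I2_d2_Sin; trivial; [ring|apply CD_pred, HY| |apply periodic_d2, PY].
apply (CD_derives half 1 Y open_half HY).
Qed.

Lemma plap_Sin a b k Y r : CD half 2 Y -> periodic Y -> 0 < r ->
  I2 (fun t => plap Y r t * Sin a b k t) = - Lop k (fun r => I2 (fun t => Y r t * Sin a b k t)) r.
Proof. rewrite Sin_as_Cos; apply plap_Cos. Qed.

(** * Projection on angular modes *)

(** For [(a, b) = (1, 0)] or [(0, 1)], the reciprocal of the integral of the squared angular factor
    over a period; at [k = 0] this concerns the factor that does not vanish. *)
Definition kap (k : nat) : R := match k with O => / (2 * PI) | S _ => / PI end.

Section Projection.

Variables (n : nat) (lambda : R) (f beta : R -> R) (w2 : R) (xi : field).
Hypothesis Hv : vortex_profiles n lambda f beta.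

Definition far r t := cos t * pol (xi A1) r t + sin t * pol (xi A2) r t.
Definition fat r t := - sin t * pol (xi A1) r t + cos t * pol (xi A2) r t.
Definition fsg r t := cos (INR n * t) * pol (xi P1) r t + sin (INR n * t) * pol (xi P2) r t.
Definition fta r t := - sin (INR n * t) * pol (xi P1) r t + cos (INR n * t) * pol (xi P2) r t.

(** Factors and signs follow [is_mode], so these are the profiles of the component of [xi] in that
    angular sector. *)
Definition pe a b k r := - kap k * I2 (fun t => fat r t * Cos a b k t).
Definition pg a b k r := - kap k * I2 (fun t => far r t * Sin a b k t).
Definition pu a b k r := kap k * I2 (fun t => fsg r t * Cos a b k t).
Definition ph a b k r := - kap k * I2 (fun t => fta r t * Sin a b k t).

Hypothesis HC : forall c, CD off 2 (xi c).

Lemma frame_CD : CD half 2 far /\ CD half 2 fat /\ CD half 2 fsg /\ CD half 2 fta /\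
  frame n xi far fat fsg fta.
Proof.
destruct (frame_exists n xi HC) as [ar [at' [sg [ta [H1 [H2 [H3 [H4 [H5 [-> [-> [-> ->]]]]]]]]]]]].
auto 10.
Qed.

Lemma frame_periodic : periodic far /\ periodic fat /\ periodic fsg /\ periodic fta.
Proof.
assert (E : forall c, periodic (pol (xi c))).
{ intros c r t; unfold pol.
  replace (t + 2 * PI) with (t + 2 * INR 1 * PI) by (simpl; ring); rewrite cos_period, sin_period;
    reflexivity. }
assert (Tn : forall t, cos (INR n * (t + 2 * PI)) = cos (INR n * t) /\
  sin (INR n * (t + 2 * PI)) = sin (INR n * t)).
{ intros t; replace (INR n * (t + 2 * PI)) with (INR n * t + 2 * INR n * PI) by ring.
  rewrite cos_period, sin_period; auto. }
assert (T1 : forall t, cos (t + 2 * PI) = cos t /\ sin (t + 2 * PI) = sin t).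
{ intros t; replace (t + 2 * PI) with (t + 2 * INR 1 * PI) by (simpl; ring);
  rewrite cos_period, sin_period; auto. }
repeat split; intros r t; unfold far, fat, fsg, fta; rewrite !E;
  try destruct (T1 t) as [-> ->]; try destruct (Tn t) as [-> ->]; reflexivity.
Qed.

Lemma projections_CR a b k : CR 2 (pe a b k) /\ CR 2 (pg a b k) /\ CR 2 (pu a b k) /\
  CR 2 (ph a b k).
Proof.
destruct frame_CD as [H1 [H2 [H3 [H4 _]]]].
assert (TC := CD_Cos half 2 a b k); assert (TS := CD_Sin half 2 a b k).
split; [|split; [|split]].
- apply (CR_scal 2), (I2_CR 2 (fun r t => fat r t * Cos a b k t)), CD_mult; assumption.
- apply (CR_scal 2), (I2_CR 2 (fun r t => far r t * Sin a b k t)), CD_mult; assumption.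
- apply (CR_scal 2), (I2_CR 2 (fun r t => fsg r t * Cos a b k t)), CD_mult; assumption.
- apply (CR_scal 2), (I2_CR 2 (fun r t => fta r t * Sin a b k t)), CD_mult; assumption.
Qed.

Hypotheses (HG : background_gauge (vortex n f beta) xi) (HE : eigen_eq n lambda f beta w2 xi).

Lemma projected_system a b k :
  mode_system n lambda f beta w2 k (pe a b k) (pg a b k) (pu a b k) (ph a b k).
Proof.
destruct frame_CD as [H1 [H2 [H3 [H4 HF]]]].
destruct frame_periodic as [Q1 [Q2 [Q3 Q4]]].
assert (GG := proj1 (gauge_iff n lambda f beta xi _ _ _ _ Hv H1 H2 H3 H4 HC HF) HG).
assert (EE := proj1 (eigen_frame n lambda f beta w2 xi _ _ _ _ Hv H1 H2 H3 H4 HC HF) HE).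
intros r Hr.
destruct (CD_derives half 1 _ open_half H1) as [_ [D1r D1t]].
destruct (CD_derives half 1 _ open_half H2) as [_ [D2r D2t]].
destruct (CD_derives half 1 _ open_half H3) as [_ [D3r D3t]].
destruct (CD_derives half 1 _ open_half H4) as [_ [D4r D4t]].
assert (CC := Ct_Cos a b k); assert (CS := Ct_Sin a b k).
assert (PL : forall Y, CD half 2 Y -> Ct (fun t => plap Y r t)).
{ intros Y HY; destruct (CD_derives half 1 _ open_half HY) as [_ [Dr Dt]].
  destruct (CD_derives half 0 _ open_half Dr) as [_ [Drr _]].
  destruct (CD_derives half 0 _ open_half Dt) as [_ [_ Dtt]].
  unfold plap; apply Ct_plus; [apply Ct_plus|].
  - apply (Ct_slice 0 _ r Drr Hr).
  - apply Ct_mult; [apply (Ct_slice 1 _ r Dr Hr)|apply Ct_const].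
  - apply Ct_mult; [apply (Ct_slice 0 _ r Dtt Hr)|apply Ct_const]. }
assert (S1 := Ct_slice 2 _ r H1 Hr); assert (S2 := Ct_slice 2 _ r H2 Hr).
assert (S3 := Ct_slice 2 _ r H3 Hr); assert (S4 := Ct_slice 2 _ r H4 Hr).
assert (T1 := Ct_slice 1 _ r D1t Hr); assert (T2 := Ct_slice 1 _ r D2t Hr).
assert (T3 := Ct_slice 1 _ r D3t Hr); assert (T4 := Ct_slice 1 _ r D4t Hr).
assert (R1 := Ct_slice 1 _ r D1r Hr).
(* Each of the five equations is a combination of four functions of the angle with coefficients
   depending on [r] only. *)
assert (L5 : forall T c1 c2 c3 c4 y1 y2 y3 y4, Ct T -> Ct y1 -> Ct y2 -> Ct y3 -> Ct y4 ->
  I2 (fun t => (c1 * y1 t + (c2 * y2 t + (c3 * y3 t + c4 * y4 t))) * T t) =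
  c1 * I2 (fun t => y1 t * T t) + (c2 * I2 (fun t => y2 t * T t)
   + (c3 * I2 (fun t => y3 t * T t) + c4 * I2 (fun t => y4 t * T t)))).
{ intros T c1 c2 c3 c4 y1 y2 y3 y4 HT K1 K2 K3 K4.
  assert (J1 := Ct_mult _ _ K1 HT); assert (J2 := Ct_mult _ _ K2 HT).
  assert (J3 := Ct_mult _ _ K3 HT); assert (J4 := Ct_mult _ _ K4 HT).
  rewrite (I2_ext _ (fun t => c1 * (y1 t * T t) + 1 *
    (c2 * (y2 t * T t) + 1 * (c3 * (y3 t * T t) + c4 * (y4 t * T t))))) by (intros; ring).
  assert (J34 := Ct_plus _ _ (Ct_scal c3 _ J3) (Ct_scal c4 _ J4)).
  assert (J234 := Ct_plus _ _ (Ct_scal c2 _ J2) (Ct_scal 1 _ J34)).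
  rewrite (I2_lin c1 1), (I2_lin c2 1), I2_lin by assumption; ring. }
split; [|split; [|split; [|split]]].
(* The integrand vanishes by the frame equation. Expanding its integral by linearity and moving
   angular derivatives onto the angular factor leaves the radial equation; the other four equations
   are treated alike. *)
- assert (E := I2_ext (fun t => (-1 * plap far r t + ((/ r ^ 2 + f r ^ 2 - w2) * far r t
      + (2 / r ^ 2 * d2 fat r t + 2 * Derive f r * fta r t))) * Sin a b k t) (fun _ => 0)
     ltac:(intros t _; destruct (EE r t Hr) as [X _]; unfold Er in X; toR;
           cbv beta; match goal with |- ?S * _ = _ => replace S with 0
             by (unfold Rdiv in *; lra) end; ring)).
  rewrite L5, I2_const, plap_Sin, I2_d2_Sin in E; auto; [|apply CD_pred; trivial].
  unfold Kg; change (Lop k (pg a b k) r) with (Lop k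
    (fun r => - kap k * I2 (fun t => far r t * Sin a b k t)) r); rewrite Lop_scal;
      unfold pg, pe, ph.
  apply Rminus_diag_uniq; match type of E with ?L = _ => transitivity (- kap k * L) end;
    [field; lra|rewrite E; ring].
- assert (E := I2_ext (fun t => (-1 * plap fat r t + ((/ r ^ 2 + f r ^ 2 - w2) * fat r t
      + (- (2 / r ^ 2) * d2 far r t + - (2 * INR n * (1 - beta r) * f r / r) * fsg r t))) * Cos a b
        k t) (fun _ => 0)
     ltac:(intros t _; destruct (EE r t Hr) as [_ [X _]]; unfold Et in X; toR;
           cbv beta; match goal with |- ?S * _ = _ => replace S with 0
             by (unfold Rdiv in *; lra) end; ring)).
  rewrite L5, I2_const, plap_Cos, I2_d2_Cos in E; auto; [|apply CD_pred; trivial].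
  unfold Ke; change (Lop k (pe a b k) r) with (Lop k
    (fun r => - kap k * I2 (fun t => fat r t * Cos a b k t)) r); rewrite Lop_scal;
      unfold pg, pe, pu.
  apply Rminus_diag_uniq; match type of E with ?L = _ => transitivity (- kap k * L) end;
    [field; lra|rewrite E; ring].
- assert (E := I2_ext (fun t => (-1 * plap fsg r t +
  ((INR n ^ 2 * (1 - beta r) ^ 2 / r ^ 2 + 3 * lambda / 2 * f r ^ 2 - lambda / 2 - w2) * fsg r t
      + (2 * INR n * (1 - beta r) / r ^ 2 * d2 fta r t + - (2 * INR n * (1 - beta r) * f r / r) *
        fat r t))) * Cos a b k t) (fun _ => 0)
     ltac:(intros t _; destruct (EE r t Hr) as [_ [_ [X _]]]; unfold Es in X; toR;
           cbv beta; match goal with |- ?S * _ = _ => replace S with 0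
             by (unfold Rdiv in *; lra) end; ring)).
  rewrite L5, I2_const, plap_Cos, I2_d2_Cos in E; auto; [|apply CD_pred; trivial].
  unfold Ku; change (Lop k (pu a b k) r) with (Lop k
    (fun r => kap k * I2 (fun t => fsg r t * Cos a b k t)) r); rewrite Lop_scal; unfold ph, pe, pu.
  apply Rminus_diag_uniq; match type of E with ?L = _ => transitivity (kap k * L) end;
    [field; lra|rewrite E; ring].
- assert (E := I2_ext (fun t => (-1 * plap fta r t +
  ((INR n ^ 2 * (1 - beta r) ^ 2 / r ^ 2 + f r ^ 2 + lambda / 2 * f r ^ 2 - lambda / 2 - w2) * fta r
    t
      + (- (2 * INR n * (1 - beta r) / r ^ 2) * d2 fsg r t + 2 * Derive f r * far r t))) * Sin a b k
        t) (fun _ => 0)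
     ltac:(intros t _; destruct (EE r t Hr) as [_ [_ [_ X]]]; unfold Eta in X; toR;
           cbv beta; match goal with |- ?S * _ = _ => replace S with 0
             by (unfold Rdiv in *; lra) end; ring)).
  rewrite L5, I2_const, plap_Sin, I2_d2_Sin in E; auto; [|apply CD_pred; trivial].
  unfold Kh; change (Lop k (ph a b k) r) with (Lop k
    (fun r => - kap k * I2 (fun t => fta r t * Sin a b k t)) r); rewrite Lop_scal;
      unfold ph, pg, pu.
  apply Rminus_diag_uniq; match type of E with ?L = _ => transitivity (- kap k * L) end;
    [field; lra|rewrite E; ring].
- assert (E := I2_ext (fun t => (1 * d1 far r t + (/ r * far r t
      + (/ r * d2 fat r t + - f r * fta r t))) * Sin a b k t) (fun _ => 0)
     ltac:(intros t _; assert (X := GG r t Hr); unfold Eg in X; toR;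
           cbv beta; match goal with |- ?S * _ = _ => replace S with 0
             by (unfold Rdiv in *; lra) end; ring)).
  rewrite L5, I2_const, I2_d2_Sin in E; auto; [|apply CD_pred; trivial].
  assert (DP : Derive (pg a b k) r = - kap k * I2 (fun t => d1 far r t * Sin a b k t)).
  { unfold pg; rewrite Derive_scal; f_equal; apply is_derive_unique.
    assert (D := I2_derive 0 (fun r t => far r t * Sin a b k t) r
      (CD_mult _ _ _ _ (CD_pred _ _ _ H1) (CD_Sin half 1 a b k)) Hr).
    replace (I2 (fun t => d1 far r t * Sin a b k t))
      with (I2 (fun t => d1 (fun r t => far r t * Sin a b k t) r t)); trivial.
    apply I2_ext; intros t _; unfold d1; apply Derive_scal_l. }
  unfold Kc; rewrite DP; unfold pg, pe, ph.
  match type of E with ?L = _ => transitivity (- kap k * L) end; [field; lra|rewrite E; ring].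
Qed.

End Projection.

(** * Regularity of the projections *)

Lemma I2_limit (Y : R -> R -> R) (Y0 T : R -> R) :
  (forall r, 0 < r -> Ct (fun t => Y r t)) -> Ct Y0 -> Ct T ->
  (forall eps, 0 < eps -> exists d, 0 < d /\ forall r t, 0 < r < d ->
    Rabs ((Y r t - Y0 t) * T t) < eps) ->
  filterlim (fun r => I2 (fun t => Y r t * T t)) (at_right 0) (locally (I2 (fun t => Y0 t * T t))).
Proof.
intros CY C0 CT H; assert (HP := PI_RGT_0); apply lim_right_iff; intros eps He.
assert (He' : 0 < eps / (2 * (2 * PI))) by (apply Rdiv_lt_0_compat; lra).
destruct (H _ He') as [d [Hd HD]]; exists d; split; trivial; intros r Hr.
assert (K1 := Ct_mult _ _ (CY r ltac:(lra)) CT); assert (K2 := Ct_mult _ _ C0 CT).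
rewrite <- I2_minus by trivial.
apply Rle_lt_trans with (2 * PI * (eps / (2 * (2 * PI)))).
- apply I2_bound; [apply Ct_minus; trivial|]; intros t _; left.
  replace (Y r t * T t - Y0 t * T t) with ((Y r t - Y0 t) * T t) by ring; apply HD, Hr.
- apply Rle_lt_trans with (eps / 2); [apply Req_le; field; lra|lra].
Qed.

(** [rc] and [rs] are the components of the constant pair [(p, q)] in the frame turned by [m t],
    that is, the limits at the origin of the frame components of a regular field. *)
Definition rc (m : nat) (p q t : R) : R := p * cos (INR m * t) + q * sin (INR m * t).
Definition rs (m : nat) (p q t : R) : R := - p * sin (INR m * t) + q * cos (INR m * t).

Lemma Ct_rc m p q : Ct (rc m p q).
Proof. apply Ct_derive; intros t; unfold rc; auto_derive; trivial. Qed.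

Lemma Ct_rs m p q : Ct (rs m p q).
Proof. apply Ct_derive; intros t; unfold rs; auto_derive; trivial. Qed.

(* Integrating by parts twice shows that both integrals are multiplied by [(k / m) ^ 2]. *)
Lemma constant_projection m k a b p q : (1 <= m)%nat ->
  I2 (fun t => rs m p q t * Cos a b k t) = I2 (fun t => rc m p q t * Sin a b k t) /\
  (k = m \/ I2 (fun t => rc m p q t * Sin a b k t) = 0).
Proof.
intros Hm; assert (Hm' : INR m <> 0) by (apply not_0_INR; lia).
assert (C1 := Ct_rc m p q); assert (C2 := Ct_rs m p q).
assert (C3 := Ct_Cos a b k); assert (C4 := Ct_Sin a b k).
set (J1 := I2 (fun t => rs m p q t * Cos a b k t));
  set (J2 := I2 (fun t => rc m p q t * Sin a b k t)).
assert (PC := proj1 (Cos_Sin_2PI a b k 0)); assert (PS := proj2 (Cos_Sin_2PI a b k 0)).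
rewrite Rplus_0_l in PC, PS.
destruct (sin_cos_2PI m) as [QC QS].
assert (E1 : INR m * J1 - INR k * J2 = 0).
{ unfold J1, J2; rewrite <- (I2_scal (INR m)), <- (I2_scal (INR k)), <- I2_minus
    by (try apply Ct_scal; apply Ct_mult; trivial).
  rewrite (I2_antiderivative (fun t => rc m p q t * Cos a b k t)).
  - unfold rc; rewrite PC, QC, QS, !Rmult_0_r, cos_0, sin_0; ring.
  - intros t; unfold rc, rs, Cos, Sin; auto_derive; trivial; ring.
  - apply Ct_minus; apply Ct_scal, Ct_mult; trivial. }
assert (E2 : - INR m * J2 + INR k * J1 = 0).
{ unfold J1, J2; rewrite <- (I2_scal (- INR m)), <- (I2_scal (INR k)), <- I2_plus
    by (try apply Ct_scal; apply Ct_mult; trivial).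
  rewrite (I2_antiderivative (fun t => rs m p q t * Sin a b k t)).
  - unfold rs; rewrite PS, QC, QS, !Rmult_0_r, cos_0, sin_0; ring.
  - intros t; unfold rc, rs, Cos, Sin; auto_derive; trivial; ring.
  - apply Ct_plus; apply Ct_scal, Ct_mult; trivial. }
destruct (Nat.eq_dec k m) as [->|Hkm].
- split; [|auto]; apply (Rmult_eq_reg_l (INR m)); trivial; lra.
- assert (D : INR m ^ 2 - INR k ^ 2 <> 0).
  { intros D; apply Hkm, INR_eq; assert (X := pos_INR m); assert (Z := pos_INR k); nra. }
  assert (F1 : (INR m ^ 2 - INR k ^ 2) * J1 = 0).
  { transitivity (INR m * (INR m * J1 - INR k * J2) - INR k * (- INR m * J2 + INR k * J1));
    [ring|rewrite E1, E2; ring]. }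
  assert (F2 : (INR m ^ 2 - INR k ^ 2) * J2 = 0).
  { transitivity (INR k * (INR m * J1 - INR k * J2) - INR m * (- INR m * J2 + INR k * J1));
    [ring|rewrite E1, E2; ring]. }
  apply Rmult_integral in F1; apply Rmult_integral in F2.
  destruct F1 as [F1|F1]; [tauto|]; destruct F2 as [F2|F2]; [tauto|].
  rewrite F1, F2; auto.
Qed.

(** The frame components tend to those of a constant pair uniformly in the angle, so the profiles
    tend to the coefficients of [rc] and [rs]. By [constant_projection] these are equal in pairs and
    vanish unless [k = 1] for the vector or [k = n] for the scalar, as [mode_regular] demands. *)
Lemma projected_regular n xi a b k xi' : (1 <= n)%nat -> (forall c, CD off 2 (xi c)) ->
  regular_at_origin xi ->
  is_mode n a b k (pe xi a b k) (pg xi a b k) (pu n xi a b k) (ph n xi a b k) xi' ->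
  regular_at_origin xi'.
Proof.
intros Hn HC HR HM; assert (HR' := proj1 (regular_iff xi) HR).
destruct (HR' A1) as [l1 L1], (HR' A2) as [l2 L2], (HR' P1) as [l3 L3], (HR' P2) as [l4 L4].
destruct (frame_CD n xi HC) as [F1 [F2 [F3 [F4 _]]]].
assert (Pa := Rabs_pos a); assert (Pb := Rabs_pos b).
assert (Gen : forall F G p q (al be Y0 T : R -> R) (Y : R -> R -> R), polar_lim F p ->
  polar_lim G q ->
  CD half 2 Y -> Ct Y0 -> Ct T -> (forall t, Rabs (T t) <= Rabs a + Rabs b) ->
  (forall t, Rabs (al t) <= 1) -> (forall t, Rabs (be t) <= 1) ->
  (forall r t, 0 < r -> Y r t = al t * pol F r t + be t * pol G r t) ->
  (forall t, Y0 t = al t * p + be t * q) ->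
  filterlim (fun r => I2 (fun t => Y r t * T t)) (at_right 0) (locally (I2 (fun t => Y0 t * T t)))).
{ intros F G p q al be Y0 T Y HF HG HY C0 CT BT Ba Bb EY E0; apply I2_limit; trivial.
  - intros r Hr; apply (Ct_slice 2 Y r HY Hr).
  - intros eps He; set (c := 2 * (Rabs a + Rabs b) + 1).
    assert (Hc : 0 < c) by (unfold c; lra).
    assert (He' : 0 < eps / c) by (apply Rdiv_lt_0_compat; trivial).
    destruct (HF _ He') as [d [Hd H1]], (HG _ He') as [d' [Hd' H2]].
    exists (Rmin d d'); split; [apply Rmin_glb_lt; trivial|]; intros r t Hr.
    assert (M1 := Rmin_l d d'); assert (M2 := Rmin_r d d').
    specialize (H1 r t ltac:(lra)); specialize (H2 r t ltac:(lra)).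
    rewrite EY, E0 by lra.
    replace (_ - _) with (al t * (pol F r t - p) + be t * (pol G r t - q)) by ring.
    rewrite Rabs_mult.
    assert (B : Rabs (al t * (pol F r t - p) + be t * (pol G r t - q)) <= 2 * (eps / c)).
    { eapply Rle_trans; [apply Rabs_triang|]; rewrite !Rabs_mult.
      specialize (Ba t); specialize (Bb t).
      assert (Z1 := Rabs_pos (al t)); assert (Z2 := Rabs_pos (be t)).
      assert (Z3 := Rabs_pos (pol F r t - p)); assert (Z4 := Rabs_pos (pol G r t - q)). nra. }
    apply Rle_lt_trans with (2 * (eps / c) * (Rabs a + Rabs b)).
    + apply Rmult_le_compat; try apply Rabs_pos; trivial.
    + replace eps with (c * (eps / c)) at 2 by (field; lra); unfold c at 2; nra. }
assert (Bs : forall m t, Rabs (sin (m * t)) <= 1) by (intros; apply Rabs_le_between, SIN_bound).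
assert (Bc : forall m t, Rabs (cos (m * t)) <= 1) by (intros; apply Rabs_le_between, COS_bound).
assert (Bs' : forall m t, Rabs (- sin (m * t)) <= 1) by (intros; rewrite Rabs_Ropp; auto).
assert (BC := fun t => proj1 (Cos_Sin_bound a b k t));
  assert (BS := fun t => proj2 (Cos_Sin_bound a b k t)).
assert (CC := Ct_Cos a b k); assert (CS := Ct_Sin a b k).
assert (LE := Gen _ _ l1 l2 (fun t => - sin (INR 1 * t)) (fun t => cos (INR 1 * t)) (rs 1 l1 l2) _
  (fat xi) L1 L2 F2
  (Ct_rs _ _ _) CC BC (Bs' _) (Bc _) ltac:(intros; unfold fat; simpl INR; rewrite !Rmult_1_l; ring)
  ltac:(intros; unfold rs; ring)).
assert (LG := Gen _ _ l1 l2 (fun t => cos (INR 1 * t)) (fun t => sin (INR 1 * t)) (rc 1 l1 l2) _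
  (far xi) L1 L2 F1
  (Ct_rc _ _ _) CS BS (Bc _) (Bs _) ltac:(intros; unfold far; simpl INR; rewrite !Rmult_1_l; ring)
  ltac:(intros; unfold rc; ring)).
assert (LU := Gen _ _ l3 l4 (fun t => cos (INR n * t)) (fun t => sin (INR n * t)) (rc n l3 l4) _
  (fsg n xi) L3 L4 F3
  (Ct_rc _ _ _) CC BC (Bc _) (Bs _) ltac:(intros; unfold fsg; ring)
  ltac:(intros; unfold rc; ring)).
assert (LH := Gen _ _ l3 l4 (fun t => - sin (INR n * t)) (fun t => cos (INR n * t)) (rs n l3 l4) _
  (fta n xi) L3 L4 F4
  (Ct_rs _ _ _) CS BS (Bs' _) (Bc _) ltac:(intros; unfold fta; ring)
  ltac:(intros; unfold rs; ring)).
destruct (constant_projection 1 k a b l1 l2 (le_n 1)) as [J1 J1'].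
(* In the scalar part the component along the phase is paired with [Cos], whereas the radial vector
   component is paired with [Sin]; the quarter turn [(b, - a)] exchanges the factors. *)
destruct (constant_projection n k b (- a) l3 l4 Hn) as [J2 J2'].
rewrite (I2_ext (fun t => rc n l3 l4 t * Sin b (- a) k t) (fun t => rc n l3 l4 t * Cos a b k t)) in
  J2, J2'
  by (intros; unfold Sin, Cos; ring).
rewrite (I2_ext (fun t => rs n l3 l4 t * Cos b (- a) k t)
  (fun t => -1 * (rs n l3 l4 t * Sin a b k t))) in J2
  by (intros; unfold Sin, Cos; ring).
rewrite I2_scal in J2 by (apply Ct_mult; trivial; apply Ct_rs).
assert (SC : forall (y : R -> R) l c, filterlim y (at_right 0) (locally l) ->
   filterlim (fun r => c * y r) (at_right 0) (locally (c * l))).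
{ intros y l c Hy; assert (Z := filterlim_lin (at_right 0) _ _ _ _ c 0 Hy Hy).
  rewrite Rmult_0_l, Rplus_0_r in Z; apply right_ext with (2 := Z); intros; ring. }
apply (mode_regular n a b k _ _ _ _ xi' (- kap k * I2 (fun t => rc 1 l1 l2 t * Sin a b k t))
  (kap k * I2 (fun t => rc n l3 l4 t * Cos a b k t)) HM).
- destruct J1' as [->|J1']; [auto|right; rewrite J1'; ring].
- destruct J2' as [->|J2']; [auto|right; rewrite J2'; ring].
- rewrite <- J1; apply SC, LE.
- apply SC, LG.
- apply SC, LU.
- rewrite <- J2; replace (kap k * (-1 * I2 (fun t => rs n l3 l4 t * Sin a b k t)))
    with (- kap k * I2 (fun t => rs n l3 l4 t * Sin a b k t)) by (toR; ring).
  apply SC, LH.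
Qed.

(** * Square integrability of the projections *)

Lemma ex_RInt_gen_dominated (F G : R -> R) : CR 0 G -> (forall r, 0 < r -> 0 <= G r <= F r) ->
  ex_RInt_gen F (at_right 0) (Rbar_locally p_infty) ->
  ex_RInt_gen G (at_right 0) (Rbar_locally p_infty).
Proof.
intros CG HFG [l Hl].
assert (EG : forall a b, 0 < a -> a <= b -> ex_RInt G a b).
{ intros a b Ha Hab; apply (ex_RInt_continuous (V := R_CompleteNormedModule)); intros z Hz.
  rewrite Rmin_left in Hz by lra; apply continuity_pt_filterlim, (CR_cont 0); trivial; lra. }
assert (GP : forall a b, 0 < a -> a <= b -> 0 <= RInt G a b).
{ intros a b Ha Hab; apply RInt_ge_0; auto; intros x Hx; apply HFG; lra. }
assert (Mono : forall a' a b b', 0 < a' -> a' <= a -> a <= b -> b <= b' ->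
  RInt G a b <= RInt G a' b').
{ intros a' a b b' H1 H2 H3 H4.
  assert (K1 := RInt_Chasles G a' a b (EG a' a H1 H2) (EG a b ltac:(lra) H3)).
  assert (K2 := RInt_Chasles G a' b b' (EG a' b H1 ltac:(lra)) (EG b b' ltac:(lra) H4)).
  change (RInt G a' a + RInt G a b = RInt G a' b) in K1.
  change (RInt G a' b + RInt G b b' = RInt G a' b') in K2.
  assert (Z1 := GP a' a H1 H2); assert (Z2 := GP b b' ltac:(lra) H4); lra. }
destruct (Hl (ball l (mkposreal 1 Rlt_0_1)) (locally_ball l (mkposreal 1 Rlt_0_1))) as
  [Q R0 HQ HR HQR].
destruct HQ as [dq HQ]; destruct HR as [mr HR].
(* The interval is enlarged until the integral of [F] is within one of its limit [l]; the integral
   of [G] only grows meanwhile. *)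
assert (Bound : forall a b, 0 < a -> a <= b -> RInt G a b <= l + 1).
{ intros a b Ha Hab.
  set (a' := Rmin a (dq / 2)); set (b' := Rmax b (mr + 1)).
  assert (Pd := cond_pos dq).
  assert (A1 : a' <= a) by apply Rmin_l; assert (A2 : a' <= dq / 2) by apply Rmin_r.
  assert (A0 : 0 < a') by (apply Rmin_glb_lt; lra).
  assert (B1 : b <= b') by apply Rmax_l; assert (B2 : mr + 1 <= b') by apply Rmax_r.
  destruct (HQR a' b') as [y [Hy Hy2]].
  - apply HQ; trivial; change (Rabs (a' - 0) < dq); rewrite Rabs_pos_eq; lra.
  - apply HR; lra.
  - simpl in Hy; change (Rabs (y - l) < 1) in Hy2; apply Rabs_lt_between in Hy2.
    apply Rle_trans with (1 := Mono a' a b b' A0 A1 Hab B1).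
    apply Rle_trans with (RInt F a' b').
    + apply RInt_le; [lra|apply EG; lra|eexists; exact Hy|]; intros x Hx; apply HFG; lra.
    + rewrite (is_RInt_unique _ _ _ _ Hy); lra. }
(* Monotonicity in the interval makes the supremum of these integrals their limit at both ends
   simultaneously. *)
set (E := fun x => exists a b, 0 < a /\ a <= b /\ x = RInt G a b).
destruct (completeness E) as [L [HL1 HL2]].
{ exists (l + 1); intros x [a [b [Ha [Hab ->]]]]; apply Bound; trivial. }
{ exists (RInt G 1 1), 1, 1; repeat split; lra. }
exists L; intros P [eps HP].
assert (Pe := cond_pos eps).
assert (HX : exists a b, 0 < a /\ a <= b /\ L - eps < RInt G a b).
{ apply Classical_Prop.NNPP; intros HN; assert (L <= L - eps); [|lra].
  apply HL2; intros x [a [b [Ha [Hab ->]]]]; apply Rnot_lt_le; intros HK; apply HN.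
  exists a, b; auto. }
destruct HX as [a0 [b0 [Ha0 [Hab0 HX]]]].
apply Filter_prod with (fun a => 0 < a < a0) (fun b => b0 < b).
- exists (mkposreal a0 Ha0); intros y Hy H0; split; trivial.
  change (Rabs (y - 0) < a0) in Hy; apply Rabs_lt_between in Hy; lra.
- exists b0; trivial.
- intros a b Ha Hb; exists (RInt G a b); split.
  + apply (RInt_correct (V := R_CompleteNormedModule)), EG; lra.
  + apply HP; change (Rabs (RInt G a b - L) < eps).
    assert (U : RInt G a b <= L) by (apply HL1; exists a, b; repeat split; lra).
    assert (W := Mono a a0 b0 b ltac:(lra) ltac:(lra) ltac:(lra) ltac:(lra)).
    apply Rabs_lt_between; lra.
Qed.

(** Obtained by expanding the square of [y - kp * A * T]. The normalisation is an inequality because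
    [T] may vanish identically, as an angular factor can for [k = 0]. *)
Lemma bessel_mode y T kp : Ct y -> Ct T -> 0 < kp -> kp * I2 (fun t => T t ^ 2) <= 1 ->
  (kp * I2 (fun t => y t * T t)) ^ 2 * I2 (fun t => T t ^ 2) <= I2 (fun t => y t ^ 2).
Proof.
intros Cy CT Hk Hk1.
set (A := I2 (fun t => y t * T t)); set (B := I2 (fun t => T t ^ 2)) in *;
  set (D := I2 (fun t => y t ^ 2)).
assert (C2 : forall z, Ct z -> Ct (fun t => z t ^ 2)).
{ intros z Hz; apply Ct_ext with (fun t => z t * z t); [intros; ring|apply Ct_mult; trivial]. }
assert (CyT := Ct_mult _ _ Cy CT).
assert (H : 0 <= I2 (fun t => (y t - kp * A * T t) ^ 2)).
{ apply I2_ge0; [|intros; apply pow2_ge_0].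
  apply (C2 (fun t => y t - kp * A * T t)), Ct_minus; trivial; apply Ct_scal; trivial. }
rewrite (I2_ext _ (fun t => 1 * (y t ^ 2) + 1 * (-2 * (kp * A) * (y t * T t) + (kp * A) ^ 2 * T t ^
  2))) in H by (intros; ring).
assert (K1 := C2 y Cy); assert (K2 := C2 T CT).
rewrite (I2_lin 1 1) in H; [|trivial|apply Ct_plus; apply Ct_scal; trivial].
rewrite I2_lin in H by trivial; fold A B D in H.
assert (B0 : 0 <= B) by (apply I2_ge0; trivial; intros; apply pow2_ge_0).
assert (A2 := pow2_ge_0 A).
assert (E : 0 <= kp * A ^ 2 * (1 - kp * B)) by (apply Rmult_le_pos; [nra|lra]).
assert (E2 : 0 <= kp * A ^ 2) by nra.
nra.
Qed.

Lemma I2_C2 z : Ct z -> Ct (fun t => z t ^ 2).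
Proof.
intros Hz; apply Ct_ext with (fun t => z t * z t); [intros; ring|apply Ct_mult; trivial].
Qed.

Lemma kap_bound a b k : a ^ 2 + b ^ 2 = 1 ->
  0 < kap k /\ kap k * I2 (fun t => Cos a b k t ^ 2) <= 1 /\
    kap k * I2 (fun t => Sin a b k t ^ 2) <= 1.
Proof.
intros Hab; assert (HP := PI_RGT_0); destruct k as [|k].
- unfold kap; split; [apply Rinv_0_lt_compat; lra|].
  assert (Z : forall t, Cos a b 0 t = a /\ Sin a b 0 t = - b).
  { intros t; unfold Cos, Sin; simpl INR; rewrite Rmult_0_l, cos_0, sin_0; split; ring. }
  rewrite (I2_ext (fun t => Cos a b 0 t ^ 2) (fun _ => a ^ 2))
    by (intros t _; rewrite (proj1 (Z t)); reflexivity).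
  rewrite (I2_ext (fun t => Sin a b 0 t ^ 2) (fun _ => b ^ 2))
    by (intros t _; rewrite (proj2 (Z t)); toR; ring).
  rewrite !I2_const.
  replace (/ (2 * PI) * (2 * PI * a ^ 2)) with (a ^ 2) by (field; lra).
  replace (/ (2 * PI) * (2 * PI * b ^ 2)) with (b ^ 2) by (field; lra).
  assert (Z1 := pow2_ge_0 a); assert (Z2 := pow2_ge_0 b); lra.
- unfold kap; split; [apply Rinv_0_lt_compat; lra|].
  destruct (RInt_Cos_sq a b (S k) ltac:(lia)) as [E1 E2]; unfold I2; rewrite E1, E2, Hab.
  rewrite Rmult_1_r, Rinv_l; lra.
Qed.

Lemma frame_density n xi ar at' sg ta r : frame n xi ar at' sg ta ->
  CD half 2 ar -> CD half 2 at' -> CD half 2 sg -> CD half 2 ta -> 0 < r ->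
  density xi r = I2 (fun t => ar r t ^ 2) + I2 (fun t => at' r t ^ 2) + I2 (fun t => sg r t ^ 2) +
    I2 (fun t => ta r t ^ 2).
Proof.
intros HF H1 H2 H3 H4 Hr.
assert (K1 := I2_C2 _ (Ct_slice 2 _ r H1 Hr)); assert (K2 := I2_C2 _ (Ct_slice 2 _ r H2 Hr)).
assert (K3 := I2_C2 _ (Ct_slice 2 _ r H3 Hr)); assert (K4 := I2_C2 _ (Ct_slice 2 _ r H4 Hr)).
assert (K12 := Ct_plus _ _ K1 K2); assert (K123 := Ct_plus _ _ K12 K3).
rewrite <- (I2_plus _ _ K1 K2), <- (I2_plus _ _ K12 K3), <- (I2_plus _ _ K123 K4).
apply I2_ext; intros t _; destruct (HF r t Hr) as [-> [-> [-> ->]]].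
toR; ring [(cos_sq t) (cos_sq (INR n * t))].
Qed.

Lemma projected_square_integrable n xi a b k xi' : a ^ 2 + b ^ 2 = 1 ->
  (forall c, CD off 2 (xi c)) ->
  is_mode n a b k (pe xi a b k) (pg xi a b k) (pu n xi a b k) (ph n xi a b k) xi' ->
  square_integrable xi -> square_integrable xi'.
Proof.
intros Hab HC HM; rewrite !square_integrable_density.
destruct (frame_CD n xi HC) as [F1 [F2 [F3 [F4 HF]]]].
destruct (projections_CR n xi HC a b k) as [Ce [Cg [Cu Ch]]].
destruct (kap_bound a b k Hab) as [K0 [K1 K2]].
assert (CC := Ct_Cos a b k); assert (CS := Ct_Sin a b k).
apply ex_RInt_gen_dominated.
- apply CR_ext with (fun r => ((pe xi a b k r ^ 2 + pu n xi a b k r ^ 2) * RInt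
  (fun t => Cos a b k t ^ 2) 0 (2 * PI)
    + (pg xi a b k r ^ 2 + ph n xi a b k r ^ 2) * RInt (fun t => Sin a b k t ^ 2) 0 (2 * PI)) * r).
  + intros r Hr; rewrite (mode_density _ _ _ _ _ _ _ _ _ r HM Hr); reflexivity.
  + apply CR_le with 2%nat; [lia|].
    apply CR_mult; [apply CR_plus; apply CR_mult; try apply CR_const; apply CR_plus; apply CR_pow;
      assumption|apply CR_id].
- intros r Hr; rewrite (mode_density _ _ _ _ _ _ _ _ _ r HM Hr).
  rewrite (frame_density n xi _ _ _ _ r HF F1 F2 F3 F4 Hr).
  change (RInt (fun t => Cos a b k t ^ 2) 0 (2 * PI)) with (I2 (fun t => Cos a b k t ^ 2)).
  change (RInt (fun t => Sin a b k t ^ 2) 0 (2 * PI)) with (I2 (fun t => Sin a b k t ^ 2)).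
  assert (B1 := bessel_mode _ _ _ (Ct_slice 2 _ r F1 Hr) CS K0 K2).
  assert (B2 := bessel_mode _ _ _ (Ct_slice 2 _ r F2 Hr) CC K0 K1).
  assert (B3 := bessel_mode _ _ _ (Ct_slice 2 _ r F3 Hr) CC K0 K1).
  assert (B4 := bessel_mode _ _ _ (Ct_slice 2 _ r F4 Hr) CS K0 K2).
  unfold pe, pg, pu, ph.
  set (IC := I2 (fun t => Cos a b k t ^ 2)) in *; set (IS := I2 (fun t => Sin a b k t ^ 2)) in *.
  assert (PC : 0 <= IC) by (apply I2_ge0; [apply I2_C2; trivial|intros; apply pow2_ge_0]).
  assert (PS : 0 <= IS) by (apply I2_ge0; [apply I2_C2; trivial|intros; apply pow2_ge_0]).
  assert (Neg : forall x, (- kap k * x) ^ 2 = (kap k * x) ^ 2) by (intros; ring); rewrite !Neg.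
  split.
  + apply Rmult_le_pos; [|lra]; apply Rplus_le_le_0_compat; apply Rmult_le_pos; trivial;
      apply Rplus_le_le_0_compat; apply pow2_ge_0.
  + apply Rmult_le_compat_r; [lra|].
    rewrite !Rmult_plus_distr_r; lra.
Qed.

Lemma projected_in_eigenspace n lambda f beta w2 xi a b k xi' : vortex_profiles n lambda f beta ->
  (1 <= n)%nat ->
  in_eigenspace n lambda f beta w2 xi ->
  is_mode n a b k (pe xi a b k) (pg xi a b k) (pu n xi a b k) (ph n xi a b k) xi' ->
  in_eigenspace n lambda f beta w2 xi'.
Proof.
intros Hv Hn HX HM; apply in_eigenspace_iff in HX; destruct HX as [HC [HR [HG HE]]].
destruct (projections_CR n xi HC a b k) as [Ce [Cg [Cu Ch]]].
apply in_eigenspace_iff; split; [apply (CD_mode _ _ _ _ _ _ _ _ _ HM Ce Cg Cu Ch)|split].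
- apply (projected_regular n xi a b k xi' Hn HC HR HM).
- apply (mode_system_solves n lambda f beta w2 a b k _ _ _ _ xi' Hv HM Ce Cg Cu Ch).
  apply (projected_system n lambda f beta w2 xi Hv HC HG HE a b k).
Qed.

(** [pv] and [pw] solve [g = k v / r] and [h = k w] for the projected profiles. *)
Definition pv (xi : field) (a b : R) (k : nat) (r : R) : R := r * pg xi a b k r / INR k.
Definition pw (n : nat) (xi : field) (a b : R) (k : nat) (r : R) : R := ph n xi a b k r / INR k.

Lemma is_mode_ext n a b k e g u h e' g' u' h' xi :
  (forall r t, 0 < r -> Cos a b k t * e r = Cos a b k t * e' r /\
    Sin a b k t * g r = Sin a b k t * g' r /\
     Cos a b k t * u r = Cos a b k t * u' r /\ Sin a b k t * h r = Sin a b k t * h' r) ->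
  is_mode n a b k e g u h xi -> is_mode n a b k e' g' u' h' xi.
Proof.
intros H HM r t Hr; destruct (H r t Hr) as [E1 [E2 [E3 E4]]];
  destruct (HM r t Hr) as [-> [-> [-> ->]]].
rewrite !Ropp_mult_distr_l_reverse, E1, E2, E3, E4; auto.
Qed.

(** * Superposition of the projected modes *)

Section Decomposition.

Variables (n : nat) (lambda : R) (f beta : R -> R) (w2 : R) (xi : field).
Hypotheses (Hv : vortex_profiles n lambda f beta) (HX : in_eigenspace n lambda f beta w2 xi).

Let HC : forall c, CD off 2 (xi c).
Proof. exact (proj1 (proj1 (in_eigenspace_iff n lambda f beta w2 xi) HX)). Qed.

(** The projected gauge condition, solved for [e]: the azimuthal profile carries no information
    beyond [v] and [w]. *)
Lemma projected_ev a b k r : (1 <= k)%nat -> 0 < r ->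
  ev f (pv xi a b k) (pw n xi a b k) r = pe xi a b k r.
Proof.
intros Hk Hr; assert (Hk' : INR k <> 0) by (apply not_0_INR; lia).
destruct (proj1 (in_eigenspace_iff _ _ _ _ _ _) HX) as [_ [_ [HG HE]]].
destruct (projected_system n lambda f beta w2 xi Hv HC HG HE a b k r Hr) as [_ [_ [_ [_ E]]]].
destruct (projections_CR n xi HC a b k) as [_ [Cg _]].
assert (D := CR_ex_derive 1 _ r Cg Hr).
assert (DV : Derive (pv xi a b k) r = (pg xi a b k r + r * Derive (pg xi a b k) r) / INR k).
{ apply is_derive_unique; unfold pv; auto_derive; [repeat split; trivial|].
  change (Derive (fun x => pg xi a b k x) r) with (Derive (pg xi a b k) r); field; trivial. }
unfold ev; rewrite DV; unfold pw; unfold Kc in E.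
replace (pe xi a b k r) with (r / INR k * (INR k * pe xi a b k r / r))
  by (field; split; trivial; lra).
replace (INR k * pe xi a b k r / r) with (Derive (pg xi a b k) r + pg xi a b k r / r - f r * ph n xi
  a b k r) by lra.
field; split; trivial; lra.
Qed.

Lemma projected_mode a b k xi' : (1 <= k)%nat ->
  is_mode n a b k (ev f (pv xi a b k) (pw n xi a b k)) (fun r => INR k * pv xi a b k r / r)
    (pu n xi a b k)
    (fun r => INR k * pw n xi a b k r) xi' ->
  is_mode n a b k (pe xi a b k) (pg xi a b k) (pu n xi a b k) (ph n xi a b k) xi'.
Proof.
intros Hk; assert (Hk' : INR k <> 0) by (apply not_0_INR; lia).
apply is_mode_ext; intros r t Hr; rewrite projected_ev by trivial; unfold pv, pw.
repeat split; field; repeat split; trivial; lra.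
Qed.

Lemma derrick_mode : is_mode n 1 0 0 (pe xi 1 0 0) (pg xi 1 0 0) (pu n xi 1 0 0) (ph n xi 1 0 0)
  (derrick n (pe xi 1 0 0) (pu n xi 1 0 0)).
Proof.
apply is_mode_ext with (2 := derrick_is_mode n (pe xi 1 0 0) (pu n xi 1 0 0)).
intros r t Hr; destruct (Cos_10_0 t) as [-> ->]; repeat split; ring.
Qed.

Lemma monopole_mode : is_mode n 0 1 0 (pe xi 0 1 0) (pg xi 0 1 0) (pu n xi 0 1 0) (ph n xi 0 1 0)
  (odd_monopole n (pg xi 0 1 0) (ph n xi 0 1 0)).
Proof.
apply is_mode_ext with (2 := odd_monopole_is_mode n (pg xi 0 1 0) (ph n xi 0 1 0)).
intros r t Hr; destruct (Cos_01_0 t) as [-> ->]; repeat split; ring.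
Qed.

Lemma multipolar_mode k : (1 <= k)%nat ->
  is_mode n 1 0 k (pe xi 1 0 k) (pg xi 1 0 k) (pu n xi 1 0 k) (ph n xi 1 0 k)
   (multipolar n f k (pv xi 1 0 k) (pu n xi 1 0 k) (pw n xi 1 0 k)).
Proof. intros Hk; apply projected_mode; trivial; apply multipolar_is_mode. Qed.

Lemma partner_mode k : (1 <= k)%nat ->
  is_mode n 0 1 k (pe xi 0 1 k) (pg xi 0 1 k) (pu n xi 0 1 k) (ph n xi 0 1 k)
   (multipolar_partner n f k (pv xi 0 1 k) (pu n xi 0 1 k) (pw n xi 0 1 k)).
Proof. intros Hk; apply projected_mode; trivial; apply partner_is_mode. Qed.

Lemma frame_series Y r t : CD half 2 Y -> periodic Y -> 0 < r ->
  is_series (fourier_term (fun s => Y r s) t) (Y r t - / (2 * PI) * I2 (fun s => Y r s)).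
Proof.
intros HY PY Hr; apply (fourier_series (fun s => Y r s)); [|intros; apply PY].
intros s; apply (CD_half_d 1 Y r s HY Hr).
Qed.

(** The parities [(1, 0)] and [(0, 1)] together span the cosine and the sine of frequency [S j],
    whether a component is expanded in [Sin] or in [Cos]. *)
Lemma fourier_modes (Y : R -> R) t j : Ct Y ->
  Sin 1 0 (S j) t * (kap (S j) * I2 (fun s => Y s * Sin 1 0 (S j) s))
  + Sin 0 1 (S j) t * (kap (S j) * I2 (fun s => Y s * Sin 0 1 (S j) s)) = fourier_term Y t j /\
  Cos 1 0 (S j) t * (kap (S j) * I2 (fun s => Y s * Cos 1 0 (S j) s))
  + Cos 0 1 (S j) t * (kap (S j) * I2 (fun s => Y s * Cos 0 1 (S j) s)) = fourier_term Y t j.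
Proof.
intros CY; set (k := S j).
rewrite (I2_ext (fun s => Y s * Sin 1 0 k s) (fun s => Y s * sin (INR k * s)))
  by (intros; unfold Sin; toR; ring).
rewrite (I2_ext (fun s => Y s * Sin 0 1 k s) (fun s => -1 * (Y s * cos (INR k * s))))
  by (intros; unfold Sin; toR; ring).
rewrite (I2_ext (fun s => Y s * Cos 1 0 k s) (fun s => Y s * cos (INR k * s)))
  by (intros; unfold Cos; toR; ring).
rewrite (I2_ext (fun s => Y s * Cos 0 1 k s) (fun s => Y s * sin (INR k * s)))
  by (intros; unfold Cos; toR; ring).
rewrite I2_scal by (apply Ct_mult; trivial; apply Ct_cos).
unfold fourier_term; fold k; change (kap k) with (/ PI); unfold Sin, Cos; split; ring.
Qed.

Lemma zero_modes (Y : R -> R) t : Ct Y ->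
  Sin 1 0 0 t * (kap 0 * I2 (fun s => Y s * Sin 1 0 0 s))
  + Sin 0 1 0 t * (kap 0 * I2 (fun s => Y s * Sin 0 1 0 s)) = / (2 * PI) * I2 Y /\
  Cos 1 0 0 t * (kap 0 * I2 (fun s => Y s * Cos 1 0 0 s))
  + Cos 0 1 0 t * (kap 0 * I2 (fun s => Y s * Cos 0 1 0 s)) = / (2 * PI) * I2 Y.
Proof.
intros CY.
rewrite (I2_ext (fun s => Y s * Sin 0 1 0 s) (fun s => -1 * Y s))
  by (intros s _; rewrite (proj2 (Cos_01_0 s)); toR; ring).
rewrite (I2_ext (fun s => Y s * Cos 1 0 0 s) (fun s => Y s))
  by (intros s _; rewrite (proj1 (Cos_10_0 s)); toR; ring).
rewrite I2_scal by trivial.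
change (I2 (fun s => Y s)) with (I2 Y).
destruct (Cos_10_0 t) as [-> ->]; destruct (Cos_01_0 t) as [-> ->]; unfold kap; split; ring.
Qed.

(** The four frame components are expanded on the circle of radius [r]. Their means make up the
    Derrick-type mode and the odd monopole, the frequency [S j] a multipolar mode and a partner. *)
Lemma decomposition c x1 x2 : (x1, x2) <> (0, 0) ->
  is_series
    (fun j => multipolar n f (S j) (pv xi 1 0 (S j)) (pu n xi 1 0 (S j)) (pw n xi 1 0 (S j)) c x1 x2
      + multipolar_partner n f (S j) (pv xi 0 1 (S j)) (pu n xi 0 1 (S j)) (pw n xi 0 1 (S j)) c x1
        x2)
    (xi c x1 x2 - derrick n (pe xi 1 0 0) (pu n xi 1 0 0) c x1 x2
      - odd_monopole n (pg xi 0 1 0) (ph n xi 0 1 0) c x1 x2).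
Proof.
intros Hxy; destruct (off_is_polar x1 x2 Hxy) as [r [t [Hr [-> ->]]]].
destruct (frame_CD n xi HC) as [F1 [F2 [F3 [F4 HF]]]].
destruct (frame_periodic n xi) as [Q1 [Q2 [Q3 Q4]]].
assert (S1 := frame_series _ r t F1 Q1 Hr); assert (S2 := frame_series _ r t F2 Q2 Hr).
assert (S3 := frame_series _ r t F3 Q3 Hr); assert (S4 := frame_series _ r t F4 Q4 Hr).
assert (C1 := Ct_slice 2 _ r F1 Hr); assert (C2 := Ct_slice 2 _ r F2 Hr).
assert (C3 := Ct_slice 2 _ r F3 Hr); assert (C4 := Ct_slice 2 _ r F4 Hr).
(* At a fixed point each Cartesian component is a combination of two frame components with
   coefficients independent of [j]. *)
assert (Lin : forall p q (a b F : nat -> R) la lb l, is_series a la -> is_series b lb ->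
  (forall j, F j = p * a j + q * b j) -> l = p * la + q * lb -> is_series F l).
{ intros p q a b F la lb l Ha Hb HF' ->.
  apply is_series_ext with (fun j => p * a j + q * b j); [intros; symmetry; apply HF'|].
  apply (is_series_plus (fun j => p * a j) (fun j => q * b j));
    apply (is_series_scal (V := R_NormedModule)); assumption. }
destruct (HF r t Hr) as [X1 [X2 [X3 X4]]].
destruct (derrick_mode r t Hr) as [D1 [D2 [D3 D4]]].
destruct (monopole_mode r t Hr) as [M1 [M2 [M3 M4]]].
assert (PM := fun j => multipolar_mode (S j) ltac:(lia) r t Hr).
assert (PP := fun j => partner_mode (S j) ltac:(lia) r t Hr).
assert (T1 := fun j => proj1 (fourier_modes _ t j C1));
  assert (T2 := fun j => proj2 (fourier_modes _ t j C2)).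
assert (T3 := fun j => proj2 (fourier_modes _ t j C3));
  assert (T4 := fun j => proj1 (fourier_modes _ t j C4)).
assert (Z1 := proj1 (zero_modes _ t C1)); assert (Z2 := proj2 (zero_modes _ t C2)).
assert (Z3 := proj2 (zero_modes _ t C3)); assert (Z4 := proj1 (zero_modes _ t C4)).
unfold pol in X1, X2, X3, X4, D1, D2, D3, D4, M1, M2, M3, M4.
destruct c.
- apply (Lin (cos t) (- sin t) _ _ _ _ _ _ S1 S2).
  + intros j; destruct (PM j) as [E _], (PP j) as [E' _]; unfold pol in E, E'.
    rewrite E, E', <- T1, <- T2; unfold pg, pe; ring.
  + rewrite X1, D1, M1, <- Z1, <- Z2; unfold pg, pe; ring.
- apply (Lin (sin t) (cos t) _ _ _ _ _ _ S1 S2).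
  + intros j; destruct (PM j) as [_ [E _]], (PP j) as [_ [E' _]]; unfold pol in E, E'.
    rewrite E, E', <- T1, <- T2; unfold pg, pe; ring.
  + rewrite X2, D2, M2, <- Z1, <- Z2; unfold pg, pe; ring.
- apply (Lin (cos (INR n * t)) (- sin (INR n * t)) _ _ _ _ _ _ S3 S4).
  + intros j; destruct (PM j) as [_ [_ [E _]]], (PP j) as [_ [_ [E' _]]]; unfold pol in E, E'.
    rewrite E, E', <- T3, <- T4; unfold pu, ph; ring.
  + rewrite X3, D3, M3, <- Z3, <- Z4; unfold pu, ph; ring.
- apply (Lin (sin (INR n * t)) (cos (INR n * t)) _ _ _ _ _ _ S3 S4).
  + intros j; destruct (PM j) as [_ [_ [_ E]]], (PP j) as [_ [_ [_ E']]]; unfold pol in E, E'.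
    rewrite E, E', <- T3, <- T4; unfold pu, ph; ring.
  + rewrite X4, D4, M4, <- Z3, <- Z4; unfold pu, ph; ring.
Qed.

(** The substitution of [2 PI - t] for [t]. *)
Lemma I2_odd y : Ct y -> (forall t, y (t + 2 * PI) = y t) -> (forall t, y (- t) = - y t) ->
  I2 y = 0.
Proof.
intros Cy Py Oy.
assert (E := RInt_comp_lin y (-1) (2 * PI) 0 (2 * PI) (Ct_RInt y _ _ Cy)).
replace (-1 * 0 + 2 * PI) with (2 * PI) in E by ring;
  replace (-1 * (2 * PI) + 2 * PI) with 0 in E by ring.
assert (E2 : RInt (fun t => scal (-1) (y (-1 * t + 2 * PI))) 0 (2 * PI) = I2 y).
{ apply I2_ext; intros t _; change (-1 * y (-1 * t + 2 * PI) = y t).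
  rewrite Py; replace (-1 * t) with (- t) by ring; rewrite Oy; ring. }
assert (E3 : I2 y = RInt y (2 * PI) 0) by (rewrite <- E; symmetry; exact E2).
assert (C3 := opp_RInt_swap y 0 (2 * PI) (Ct_RInt y _ _ Cy)).
change (- I2 y = RInt y (2 * PI) 0) in C3; rewrite <- E3 in C3; lra.
Qed.

Hypothesis Hmirror : mirror_symmetric xi.

(** The reflection makes the azimuthal vector part and the scalar part along the phase even in the
    angle, the other two odd. For [(a, b) = (0, 1)] each of them is integrated against a factor of
    the opposite parity. *)
Lemma mirror_vanish k r : 0 < r ->
  pe xi 0 1 k r = 0 /\ pg xi 0 1 k r = 0 /\ pu n xi 0 1 k r = 0 /\ ph n xi 0 1 k r = 0.
Proof.
intros Hr; destruct (frame_CD n xi HC) as [F1 [F2 [F3 [F4 HF]]]].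
destruct (frame_periodic n xi) as [Q1 [Q2 [Q3 Q4]]].
assert (M : forall t, pol (xi A1) r (- t) = - pol (xi A1) r t /\
  pol (xi A2) r (- t) = pol (xi A2) r t /\
   pol (xi P1) r (- t) = pol (xi P1) r t /\ pol (xi P2) r (- t) = - pol (xi P2) r t).
{ intros t; unfold pol; rewrite cos_neg, sin_neg; replace (r * - sin t) with (- (r * sin t))
  by ring.
  apply Hmirror, off_polar, Hr. }
assert (EC : forall t, Cos 0 1 k (- t) = - Cos 0 1 k t /\ Sin 0 1 k (- t) = Sin 0 1 k t).
{ intros t; unfold Cos, Sin; replace (INR k * - t) with (- (INR k * t)) by ring.
  rewrite cos_neg, sin_neg; split; ring. }
assert (PC := Cos_Sin_2PI 0 1 k).
assert (CC := Ct_Cos 0 1 k); assert (CS := Ct_Sin 0 1 k).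
assert (V : forall Y T, Ct Y -> Ct T -> (forall t, Y (t + 2 * PI) = Y t) ->
  (forall t, T (t + 2 * PI) = T t) ->
  (forall t, Y (- t) * T (- t) = - (Y t * T t)) -> I2 (fun t => Y t * T t) = 0).
{ intros Y T CY CT PY PT O; apply I2_odd; trivial; [apply Ct_mult; trivial|].
  intros t; rewrite PY, PT; reflexivity. }
assert (PCc := fun t => proj1 (PC t)); assert (PCs := fun t => proj2 (PC t)).
unfold pe, pg, pu, ph.
rewrite (V (fun t => fat xi r t)), (V (fun t => far xi r t)), (V (fun t => fsg n xi r t)),
  (V (fun t => fta n xi r t));
  trivial; try (apply (Ct_slice 2); trivial; fail); try (repeat split; ring); intros t;
  destruct (M t) as [M1 [M2 [M3 M4]]]; destruct (EC t) as [E1 E2];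
  unfold far, fat, fsg, fta; rewrite M1 || idtac; rewrite ?M2, ?M3, ?M4, ?E1, ?E2, ?cos_neg,
    ?sin_neg;
  replace (INR n * - t) with (- (INR n * t)) by ring; rewrite ?cos_neg, ?sin_neg; ring.
Qed.

End Decomposition.

Theorem theorem6p4 (n : nat) (lambda : R) (f beta : R -> R)
  (hn : (1 <= n)%nat) (hlambda : 0 < lambda) (hlambda1 : lambda <> 1)
  (hvortex : vortex_profiles n lambda f beta) :
  (* Derrick-type modes: the reduced problem, and their discrete spectrum *)
  (forall (w2 : R) (vt ut : R -> R),
     (eigenfunction n lambda f beta w2 (derrick n vt ut) <->
        radial_eigenfunction0 n lambda f beta w2 vt ut /\ radial_regular0 vt ut) /\
     (eigenfunction n lambda f beta w2 (derrick n vt ut) /\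
        square_integrable (derrick n vt ut) <->
      radial_eigenfunction0 n lambda f beta w2 vt ut /\ radial_regular0 vt ut /\
        radial_square_integrable0 vt ut)) /\
  (* multipolar modes: the reduced problem, and the partners *)
  (forall (w2 : R) (k : nat) (v u w : R -> R), (1 <= k)%nat ->
     (eigenfunction n lambda f beta w2 (multipolar n f k v u w) <->
        radial_eigenfunction n lambda f beta k w2 v u w /\
        regular_at_origin (multipolar n f k v u w)) /\
     (eigenfunction n lambda f beta w2 (multipolar_partner n f k v u w) <->
        eigenfunction n lambda f beta w2 (multipolar n f k v u w))) /\
  (* type A modes exist for k in {1, ..., n} only *)
  (forall (w2 : R) (k : nat) (v u w : R -> R), (1 <= k)%nat ->
     eigenfunction n lambda f beta w2 (multipolar n f k v u w) ->
     type_A n k (multipolar n f k v u w) -> (k <= n)%nat) /\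
  (* type B modes: regularity at the origin is automatic for all k *)
  (forall (w2 : R) (k : nat) (v u w : R -> R), (1 <= k)%nat ->
     type_B n k (multipolar n f k v u w) ->
     (eigenfunction n lambda f beta w2 (multipolar n f k v u w) <->
        radial_eigenfunction n lambda f beta k w2 v u w) /\
     (eigenfunction n lambda f beta w2 (multipolar n f k v u w) /\
        square_integrable (multipolar n f k v u w) <->
      radial_eigenfunction n lambda f beta k w2 v u w /\
        radial_square_integrable f k v u w)) /\
  (* the classes of multipolar modes *)
  (forall (w2 : R) (k : nat) (v u w : R -> R), (1 <= k)%nat ->
     eigenfunction n lambda f beta w2 (multipolar n f k v u w) ->
     vector_behaves_as (multipolar n f k v u w) (Z.of_nat k - 1) ->
     type_A n k (multipolar n f k v u w) \/
     type_B n k (multipolar n f k v u w) \/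
     ((n < k)%nat /\
      radial_char (multipolar n f k v u w)
        (Z.of_nat k - 1) (Z.of_nat k - Z.of_nat n))) /\
  (* mirror-symmetric eigenfunctions are superpositions of the listed modes *)
  (forall (w2 : R) (xi : field),
     eigenfunction n lambda f beta w2 xi -> mirror_symmetric xi ->
     exists (vt ut : R -> R) (v u w : nat -> R -> R),
       in_eigenspace n lambda f beta w2 (derrick n vt ut) /\
       (forall k, (1 <= k)%nat ->
          in_eigenspace n lambda f beta w2 (multipolar n f k (v k) (u k) (w k))) /\
       (square_integrable xi ->
          square_integrable (derrick n vt ut) /\
          forall k, (1 <= k)%nat ->
            square_integrable (multipolar n f k (v k) (u k) (w k))) /\
       (forall c x1 x2, (x1, x2) <> (0, 0) ->
          is_series (fun j => multipolar n f (S j) (v (S j)) (u (S j)) (w (S j)) c x1 x2)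
            (xi c x1 x2 - derrick n vt ut c x1 x2))) /\
  (* arbitrary eigenfunctions *)
  (forall (w2 : R) (xi : field),
     eigenfunction n lambda f beta w2 xi ->
     exists (vt ut g h : R -> R) (v u w v' u' w' : nat -> R -> R),
       in_eigenspace n lambda f beta w2 (derrick n vt ut) /\
       in_eigenspace n lambda f beta w2 (odd_monopole n g h) /\
       (forall k, (1 <= k)%nat ->
          in_eigenspace n lambda f beta w2 (multipolar n f k (v k) (u k) (w k)) /\
          in_eigenspace n lambda f beta w2
            (multipolar_partner n f k (v' k) (u' k) (w' k))) /\
       (square_integrable xi ->
          square_integrable (derrick n vt ut) /\
          square_integrable (odd_monopole n g h) /\
          forall k, (1 <= k)%nat ->
            square_integrable (multipolar n f k (v k) (u k) (w k)) /\
            square_integrable (multipolar_partner n f k (v' k) (u' k) (w' k))) /\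
       (forall c x1 x2, (x1, x2) <> (0, 0) ->
          is_series
            (fun j => multipolar n f (S j) (v (S j)) (u (S j)) (w (S j)) c x1 x2
                      + multipolar_partner n f (S j) (v' (S j)) (u' (S j)) (w' (S j))
                          c x1 x2)
            (xi c x1 x2 - derrick n vt ut c x1 x2 - odd_monopole n g h c x1 x2))).
Proof.
split; [|split; [|split; [|split; [|split; [|split]]]]].
- intros w2 vt ut.
  rewrite derrick_eigenfunction, derrick_square_integrable by trivial; tauto.
- intros w2 k v u w Hk; split; [apply multipolar_eigenfunction|apply partner_eigenfunction];
  trivial.
- intros w2 k v u w Hk HE [_ HS].
  apply multipolar_eigenfunction in HE; trivial.
  (* Regularity forces the scalar exponent [n - k] to be nonnegative. *)
  assert (H := scalar_exponent_nonneg _ _ (proj2 HE) HS); lia.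
- intros w2 k v u w Hk HB.
  (* The characteristic gives regularity as soon as [v] is derivable, which the radial problem
     supplies. *)
  assert (HR : radial_eigenfunction n lambda f beta k w2 v u w ->
    regular_at_origin (multipolar n f k v u w)).
  { intros [Tv _]; apply (type_B_regular n lambda f beta); trivial; intros r Hr; apply (Tv r Hr). }
  rewrite multipolar_eigenfunction, multipolar_square_integrable by trivial; tauto.
- intros w2 k v u w Hk; apply multipolar_classes; trivial.
- intros w2 xi [HX _] HM.
  assert (HC := proj1 (proj1 (in_eigenspace_iff _ _ _ _ _ _) HX)).
  assert (Hab : 1 ^ 2 + 0 ^ 2 = 1) by ring.
  exists (pe xi 1 0 0), (pu n xi 1 0 0), (pv xi 1 0), (pu n xi 1 0), (pw n xi 1 0).
  split; [|split; [|split]].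
  + apply (projected_in_eigenspace n lambda f beta w2 xi 1 0 0); trivial; apply derrick_mode.
  + intros k Hk; apply (projected_in_eigenspace n lambda f beta w2 xi 1 0 k); trivial.
    apply (multipolar_mode n lambda f beta w2); trivial.
  + intros HS; split; [apply (projected_square_integrable n xi 1 0 0); trivial;
    apply derrick_mode|].
    intros k Hk; apply (projected_square_integrable n xi 1 0 k); trivial.
    apply (multipolar_mode n lambda f beta w2); trivial.
  + intros c x1 x2 Hx.
    assert (D := decomposition n lambda f beta w2 xi hvortex HX c x1 x2 Hx).
    destruct (off_is_polar x1 x2 Hx) as [r [t [Hr [-> ->]]]].
    (* All profiles of parity [(0, 1)] vanish, so the monopole and the partners drop out of the
       general decomposition. *)
    assert (V := fun k => mirror_vanish n lambda f beta w2 xi HX HM k r Hr).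
    assert (Z : forall a b k e g u h xi', is_mode n a b k e g u h xi' ->
      e r = 0 -> g r = 0 -> u r = 0 -> h r = 0 -> xi' c (r * cos t) (r * sin t) = 0).
    { intros a b k e g u h xi' HM' E1 E2 E3 E4; destruct (HM' r t Hr) as [X1 [X2 [X3 X4]]].
      rewrite E1, E2, E3, E4 in *; unfold pol in *.
      destruct c; [rewrite X1|rewrite X2|rewrite X3|rewrite X4]; ring. }
    rewrite (Z _ _ _ _ _ _ _ _ (monopole_mode n xi)), Rminus_0_r in D by apply V.
    apply is_series_ext with (2 := D); intros j.
    rewrite (Z _ _ _ _ _ _ _ _ (partner_mode n lambda f beta w2 xi hvortex HX (S j) ltac:(lia)))
      by apply V.
    apply Rplus_0_r.
- intros w2 xi [HX _].
  assert (HC := proj1 (proj1 (in_eigenspace_iff _ _ _ _ _ _) HX)).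
  assert (Hab : 1 ^ 2 + 0 ^ 2 = 1) by ring; assert (Hba : 0 ^ 2 + 1 ^ 2 = 1) by ring.
  exists (pe xi 1 0 0), (pu n xi 1 0 0), (pg xi 0 1 0), (ph n xi 0 1 0),
    (pv xi 1 0), (pu n xi 1 0), (pw n xi 1 0), (pv xi 0 1), (pu n xi 0 1), (pw n xi 0 1).
  split; [|split; [|split; [|split]]].
  + apply (projected_in_eigenspace n lambda f beta w2 xi 1 0 0); trivial; apply derrick_mode.
  + apply (projected_in_eigenspace n lambda f beta w2 xi 0 1 0); trivial; apply monopole_mode.
  + intros k Hk; split.
    * apply (projected_in_eigenspace n lambda f beta w2 xi 1 0 k); trivial.
      apply (multipolar_mode n lambda f beta w2); trivial.
    * apply (projected_in_eigenspace n lambda f beta w2 xi 0 1 k); trivial.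
      apply (partner_mode n lambda f beta w2); trivial.
  + intros HS; split; [|split].
    * apply (projected_square_integrable n xi 1 0 0); trivial; apply derrick_mode.
    * apply (projected_square_integrable n xi 0 1 0); trivial; apply monopole_mode.
    * intros k Hk; split.
      -- apply (projected_square_integrable n xi 1 0 k); trivial.
         apply (multipolar_mode n lambda f beta w2); trivial.
      -- apply (projected_square_integrable n xi 0 1 k); trivial.
         apply (partner_mode n lambda f beta w2); trivial.
  + apply (decomposition n lambda f beta w2); trivial.
Qed.
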